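(* The complex vector space $\mathcal{R}$ of polynomial sections of regular solutions is invariant under the following action of elements $X\in\mathfrak{g}$: for a polynomial $p$, $\ell\ge 0$, and a spherical harmonic $Y_\ell$ of degree $\ell$, $$X\colon \bigl(p\cdot F_{\ell,\lambda}\cdot Y_\ell\bigr)\longmapsto \Bigl[(\lambda,r,\vartheta)\mapsto p(\lambda)\,\bigl(X(F_{\ell,\lambda}Y_\ell)\bigr)(r,\vartheta)\Bigr].$$ As a result (with its $K$-action and $\mathcal{O}$-module structure), $\mathcal{R}$ carries the structure of an algebraic family of Harish-Chandra modules for $(\mathfrak{g},K)$.
   Context: Fix a real constant $\gamma>0$. Put $\mathbb{R}^3_0=\mathbb{R}^3\setminus\{0\}$, $r=\|x\|$, and $T=-\Delta-2\gamma/r$, viewed in the algebra of linear partial differential operators on $\mathbb{R}^3_0$ with smooth coefficients. Let $\mathcal{O}=\mathbb{C}[T]$ be the algebra of polynomials in $T$ (viewed as polynomial functions of $\lambda\in\mathbb{C}$). Let $L_1=x_2\partial_3-x_3\partial_2$, $L_2=x_3\partial_1-x_1\partial_3$, $L_3=x_1\partial_2-x_2\partial_1$, and let the Runge-Lenz operators be $R_1=\sqrt{-1}(L_3\partial_2-L_2\partial_3-\partial_1+\gamma x_1/r)$, $R_2=\sqrt{-1}(L_1\partial_3-L_3\partial_1-\partial_2+\gamma x_2/r)$, $R_3=\sqrt{-1}(L_2\partial_1-L_1\partial_2-\partial_3+\gamma x_3/r)$. All commute with $T$. $\mathfrak{g}$ is the $\mathcal{O}$-linear span of $L_1,L_2,L_3,R_1,R_2,R_3$;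 it is a Lie algebra over $\mathcal{O}$ under the commutator, free on these six elements as an $\mathcal{O}$-module, with $[L_i,L_j]=-\varepsilon_{ijk}L_k$, $[R_i,R_j]=\varepsilon_{ijk}TL_k$, $[L_i,R_j]=-\varepsilon_{ijk}R_k$. $K=O(3,\mathbb{C})$ (or, on functions, its compact form $O(3)$). $O(3)$ acts on $\mathbb{R}^3_0$ by $A\colon v\mapsto \det(A)^{-1}Av$, hence on functions and, by conjugation, on differential operators and on $\mathfrak{g}$ (so $L$ and $R$ transform as vectors under $\det(A)^{-1}A$); this extends to an algebraic action of $K$ on $\mathfrak{g}$. The infinitesimal action of $\mathfrak{k}=\mathfrak{so}(3,\mathbb{C})$ on functions identifies $\mathfrak{k}$ with the span of the $L_i$, and so $\mathfrak{k}$ with a subalgebra of $\mathfrak{g}$. An algebraic family of Harish-Chandra modules for $(\mathfrak{g},K)$ is a free $\mathcal{O}$-module $\mathcal{F}$ with a locally finite-dimensional algebraic representation of $K$ by $\mathcal{O}$-module automorphisms, all of whose isotypical summands are finitely generated free $\mathcal{O}$-modules (admissibility), and with an $\mathcal{O}$-linear Lie algebra action $\mathfrak{g}\otimes_{\mathcal{O}}\mathcal{F}\to\mathcal{F}$ that is $K$-equivariant and whose restriction to $\mathfrak{k}$ is the infinitesimal form of the $K$-action. For $\lambda\in\mathbb{C}$, $\ell\ge0$, $F_{\ell,\lambda}$ is the unique solution of $r^2\psi''+2r\psi'-\ell(\ell+1)\psi+2\gamma r\psi+\lambda r^2\psi=0$ that extends to an entire function of $r\in\mathbb{C}$ with Taylor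 series $F_{\ell,\lambda}(r)=r^\ell+\text{higher-order terms}$. In spherical coordinates $\mathbb{R}^3_0\cong\mathbb{R}_+\times S^2$, $\mathcal{R}$ is the complex vector space spanned by the functions $(\lambda,r,\vartheta)\mapsto p(\lambda)F_{\ell,\lambda}(r)Y_\ell(\vartheta)$ on $\mathbb{C}\times\mathbb{R}_+\times S^2$, with $p$ a polynomial and $Y_\ell$ any spherical harmonic of degree $\ell$. It is a free $\mathcal{O}$-module with $T$ acting as multiplication by $\lambda$, and $K$ acts through its action on $\mathbb{R}^3_0$. *)

(* Defs.v *)
From HB Require Import structures.
From mathcomp Require Import all_boot all_order all_algebra.
From mathcomp Require Import complex.
From mathcomp Require Import all_classical all_reals all_analysis.
From mathcomp Require Import ring lra.
From mathcomp Require Import -(notations) mpoly.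

Set Implicit Arguments.
Unset Strict Implicit.
Unset Printing Implicit Defensive.

Import Order.TTheory GRing.Theory Num.Theory numFieldNormedType.Exports.
Local Open Scope classical_set_scope.
Local Open Scope ring_scope.

Section PolyAction.
Variables (A : comNzRingType) (V : lmodType A) (T : {linear V -> V}).

Definition poly_act (p : {poly A}) (v : V) : V :=
  \sum_(i < size p) p`_i *: iter i T v.

Lemma poly_actE n (p : {poly A}) v : (size p <= n)%N ->
  poly_act p v = \sum_(i < n) p`_i *: iter i T v.
Proof.
move=> le_pn; rewrite /poly_act (big_ord_widen _ (fun i => p`_i *: iter i T v) le_pn).
rewrite big_mkcond; apply: eq_bigr => i _; case: ltnP => // le_pi.
by rewrite nth_default // scale0r.
Qed.

Lemma iterTD i : {morph iter i T : u v / u + v}.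
Proof. by move=> u v; elim: i => //= i ->; rewrite linearD. Qed.

Lemma iterTZ i a v : iter i T (a *: v) = a *: iter i T v.
Proof. by elim: i => //= i ->; rewrite linearZ. Qed.

Lemma poly_actDr p : {morph poly_act p : u v / u + v}.
Proof.
move=> u v; rewrite /poly_act -big_split; apply: eq_bigr => i _.
by rewrite iterTD scalerDr.
Qed.

Lemma poly_actZr p a v : poly_act p (a *: v) = a *: poly_act p v.
Proof.
rewrite /poly_act scaler_sumr; apply: eq_bigr => i _.
by rewrite iterTZ !scalerA mulrC.
Qed.

Lemma poly_actDl p q v : poly_act (p + q) v = poly_act p v + poly_act q v.
Proof.
pose n := maxn (size p) (size q).
rewrite (@poly_actE n (p + q)) ?size_polyD //.
rewrite (@poly_actE n p) ?leq_maxl // (@poly_actE n q) ?leq_maxr //.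
by rewrite -big_split; apply: eq_bigr => i _; rewrite coefD scalerDl.
Qed.

Lemma poly_actC c v : poly_act c%:P v = c *: v.
Proof.
rewrite (@poly_actE 1) ?size_polyC ?leq_b1 //.
by rewrite big_ord_recl big_ord0 addr0 coefC.
Qed.

Lemma poly_act0l v : poly_act 0 v = 0.
Proof. by rewrite /poly_act size_poly0 big_ord0. Qed.

Lemma poly_actMX p v : poly_act (p * 'X) v = poly_act p (T v).
Proof.
have [->|p0] := eqVneq p 0.
  by rewrite mul0r /poly_act size_poly0 !big_ord0.
rewrite (@poly_actE (size p).+1 (p * 'X)) ?size_mulX // big_ord_recl.
rewrite coefMX eqxx scale0r add0r.
by apply: eq_bigr => i _; rewrite coefMX /= -iterS iterSr.
Qed.

Lemma poly_actX v : poly_act 'X v = T v.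
Proof. by rewrite -['X]mul1r poly_actMX -[1]/(1%:P) poly_actC scale1r. Qed.

Lemma poly_actMC p c v : poly_act (p * c%:P) v = c *: poly_act p v.
Proof.
rewrite mulrC mul_polyC (@poly_actE (size p)) ?size_scale_leq //.
rewrite scaler_sumr; apply: eq_bigr => i _.
by rewrite coefZ scalerA.
Qed.

Lemma poly_actM p q v : poly_act (p * q) v = poly_act p (poly_act q v).
Proof.
elim/poly_ind: q v => [|q c IHq] v.
  by rewrite mulr0 poly_act0l -(scale0r v) poly_actZr !scale0r.
rewrite mulrDr mulrA !poly_actDl !poly_actMX IHq poly_actC poly_actDr.
by rewrite poly_actMC poly_actZr.
Qed.

End PolyAction.

Section PuncturedSpace.
Variable R : realType.

Definition R30 : Type := {x : 'cV[R]_3 | x != 0}.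

Definition enorm (x : 'cV[R]_3) : R := Num.sqrt (\sum_i x i 0 ^+ 2).

Definition S2 : Type := {x : 'cV[R]_3 | enorm x == 1}.

Lemma enorm_gt0 (x : R30) : 0 < enorm (val x).
Proof.
have s0 : 0 <= \sum_i (val x) i 0 ^+ 2 by apply: sumr_ge0 => i _; exact: sqr_ge0.
rewrite sqrtr_gt0 lt_neqAle s0 andbT eq_sym; apply: contra (valP x).
rewrite psumr_eq0 => [/allP x0|i _]; last exact: sqr_ge0.
apply/eqP/colP => i; rewrite mxE; apply/eqP.
by rewrite -sqrf_eq0; exact: (x0 i (mem_index_enum i)).
Qed.

Lemma enormZ a (x : 'cV[R]_3) : 0 <= a -> enorm (a *: x) = a * enorm x.
Proof.
move=> a0; rewrite /enorm.
under eq_bigr do rewrite mxE exprMn.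
by rewrite -mulr_sumr sqrtrM ?sqr_ge0 // sqrtr_sqr ger0_norm.
Qed.

Fact angular_subproof (x : R30) : enorm ((enorm (val x))^-1 *: val x) == 1.
Proof.
have x0 := enorm_gt0 x.
by rewrite enormZ ?mulVf ?lt0r_neq0 // invr_ge0 ltW.
Qed.

Definition radius (x : R30) : R := enorm (val x).
Definition angular (x : R30) : S2 := exist (fun y => enorm y == 1) _ (angular_subproof x).

(* The value of the extension at the origin is irrelevant below: it is only
   differentiated at points of the open set R30. *)
Definition ext0 (f : R30 -> R[i]) (y : 'cV[R]_3) : R[i] :=
  if insub y is Some x then f x else 0.

Definition re0 (f : R30 -> R[i]) (y : 'cV[R]_3) : R := complex.Re (ext0 f y).
Definition im0 (f : R30 -> R[i]) (y : 'cV[R]_3) : R := complex.Im (ext0 f y).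

Definition evec (i : 'I_3) : 'cV[R]_3 := delta_mx i 0.

(* Real and imaginary parts are differentiated separately because R[i] has no
   normed-space structure over R in the library. *)
Definition pderivable (i : 'I_3) (f : R30 -> R[i]) (x : R30) : Prop :=
  derivable (re0 f) (val x) (evec i) /\
  derivable (im0 f) (val x) (evec i).

Definition pd (i : 'I_3) (f : R30 -> R[i]) : R30 -> R[i] := fun x =>
  ('D_(evec i) (re0 f) (val x) +i*
   'D_(evec i) (im0 f) (val x))%C.

Definition ccontinuous (f : R30 -> R[i]) : Prop := forall x : R30,
  {for val x, continuous (re0 f)} /\
  {for val x, continuous (im0 f)}.

Fixpoint Ck (k : nat) (f : R30 -> R[i]) : Prop :=
  if k is k'.+1 then
    ccontinuous f /\ forall i, (forall x, pderivable i f x) /\ Ck k' (pd i f)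
  else ccontinuous f.

Definition is_smooth (f : R30 -> R[i]) : Prop := forall k, Ck k f.

Lemma ext0E f (x : R30) : ext0 f (val x) = f x.
Proof. by rewrite /ext0 valK. Qed.

Lemma Ck_cont k f : Ck k f -> ccontinuous f.
Proof. by case: k => [//|k []]. Qed.

Lemma CkW k f : Ck k.+1 f -> Ck k f.
Proof.
elim: k f => [|k IHk] f [fc fd]; first by [].
by split=> // i; have [? ?] := fd i; split=> //; exact: IHk.
Qed.

Lemma ext0D f g : ext0 (f \+ g) = ext0 f \+ ext0 g.
Proof. by apply/funext => y /=; rewrite /ext0; case: insub; rewrite ?addr0. Qed.

Lemma ext0M f g : ext0 (f \* g) = ext0 f \* ext0 g.
Proof. by apply/funext => y /=; rewrite /ext0; case: insub; rewrite ?mulr0. Qed.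

Lemma nbhs_R30 (x : R30) : \forall y \near val x, y != 0.
Proof.
have /closed_openC o0 : closed [set (0 : 'cV[R]_3)] := accessible_closed_set1
  (hausdorff_accessible (@norm_hausdorff _ 'cV[R]_3)) (x := 0).
have : nbhs (val x) (~` [set 0]).
  by apply: open_nbhs_nbhs; split => //; apply/eqP; exact: (valP x).
by apply: filterS => y /eqP.
Qed.

Lemma ext0_cst (c : R[i]) (x : R30) :
  \forall y \near val x, c = ext0 (fun=> c) y.
Proof.
near=> y; have y0 : y != 0 by near: y; exact: nbhs_R30.
by rewrite /ext0 insubT.
Unshelve. all: by end_near. Qed.

Definition is_pd (i : 'I_3) (f : R30 -> R[i]) (x : R30) (d : R[i]) : Prop :=
  is_derive (val x) (evec i) (re0 f) (complex.Re d) /\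
  is_derive (val x) (evec i) (im0 f) (complex.Im d).

Lemma is_pdP i f x : pderivable i f x -> is_pd i f x (pd i f x).
Proof. by move=> [f1 f2]; split; apply: DeriveDef. Qed.

Lemma is_pd_derivable i f x d : is_pd i f x d -> pderivable i f x.
Proof. by move=> [[f1 _] [f2 _]]. Qed.

Lemma is_pdE i f x d : is_pd i f x d -> pd i f x = d.
Proof. by case: d => a b [[_ /= fa] [_ /= fb]]; rewrite /pd fa fb. Qed.

Lemma ReD (a b : R[i]) : complex.Re (a + b) = complex.Re a + complex.Re b.
Proof. by case: a b => ? ? []. Qed.

Lemma ImD (a b : R[i]) : complex.Im (a + b) = complex.Im a + complex.Im b.
Proof. by case: a b => ? ? []. Qed.

Lemma ReM (a b : R[i]) : complex.Re (a * b) =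
  complex.Re a * complex.Re b - complex.Im a * complex.Im b.
Proof. by case: a b => ? ? []. Qed.

Lemma ImM (a b : R[i]) : complex.Im (a * b) =
  complex.Re a * complex.Im b + complex.Im a * complex.Re b.
Proof. by case: a b => ? ? []. Qed.

Lemma re0D f g : re0 (f \+ g) = re0 f + re0 g.
Proof. by apply/funext => y; rewrite /re0 ext0D; exact: ReD. Qed.

Lemma im0D f g : im0 (f \+ g) = im0 f + im0 g.
Proof. by apply/funext => y; rewrite /im0 ext0D; exact: ImD. Qed.

Lemma re0M f g : re0 (f \* g) = re0 f * re0 g - im0 f * im0 g.
Proof. by apply/funext => y; rewrite /re0 ext0M; exact: ReM. Qed.

Lemma im0M f g : im0 (f \* g) = re0 f * im0 g + im0 f * re0 g.
Proof. by apply/funext => y; rewrite /im0 ext0M; exact: ImM. Qed.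

Lemma re0E f (x : R30) : re0 f (val x) = complex.Re (f x).
Proof. by rewrite /re0 ext0E. Qed.

Lemma im0E f (x : R30) : im0 f (val x) = complex.Im (f x).
Proof. by rewrite /im0 ext0E. Qed.

Lemma is_pdD i f g x d e :
  is_pd i f x d -> is_pd i g x e -> is_pd i (f \+ g) x (d + e).
Proof.
move=> [f1 f2] [g1 g2]; rewrite /is_pd re0D im0D ReD ImD.
by split; exact: is_deriveD.
Qed.

Lemma is_pdM i f g x d e : is_pd i f x d -> is_pd i g x e ->
  is_pd i (f \* g) x (d * g x + f x * e).
Proof.
move=> [f1 f2] [g1 g2]; rewrite /is_pd re0M im0M.
split; apply: is_derive_eq; rewrite !(re0E, im0E).
  by rewrite ReD !ReM /GRing.scale /=; ring.
by rewrite ImD !ImM /GRing.scale /=; ring.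
Qed.

Lemma is_pd_cst i c x : is_pd i (fun=> c) x 0.
Proof.
split.
  apply: (near_eq_is_derive (f := cst (complex.Re c))).
  by near=> y; rewrite /cst /re0 /im0 -[ext0 _ _](near (ext0_cst c x)).
apply: (near_eq_is_derive (f := cst (complex.Im c))).
by near=> y; rewrite /cst /re0 /im0 -[ext0 _ _](near (ext0_cst c x)).
Unshelve. all: by end_near. Qed.

Lemma pd_add i f g : (forall x, pderivable i f x) ->
  (forall x, pderivable i g x) -> pd i (f \+ g) = pd i f \+ pd i g.
Proof.
move=> df dg; apply/funext => x.
exact: is_pdE (is_pdD (is_pdP (df x)) (is_pdP (dg x))).
Qed.

Lemma pd_mul i f g : (forall x, pderivable i f x) ->
  (forall x, pderivable i g x) ->
  pd i (f \* g) = (pd i f \* g) \+ (f \* pd i g).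
Proof.
move=> df dg; apply/funext => x.
exact: is_pdE (is_pdM (is_pdP (df x)) (is_pdP (dg x))).
Qed.

Lemma pd_cst i c : pd i (fun=> c) = fun=> 0.
Proof. by apply/funext => x; exact: is_pdE (is_pd_cst i c x). Qed.

Lemma ccontinuousD f g :
  ccontinuous f -> ccontinuous g -> ccontinuous (f \+ g).
Proof.
move=> fc gc x; have [f1 f2] := fc x; have [g1 g2] := gc x.
by rewrite re0D im0D; split; exact: continuousD.
Qed.

Lemma ccontinuousM f g :
  ccontinuous f -> ccontinuous g -> ccontinuous (f \* g).
Proof.
move=> fc gc x; have [f1 f2] := fc x; have [g1 g2] := gc x.
rewrite re0M im0M; split.
  by apply: continuousB; exact: continuousM.
by apply: continuousD; exact: continuousM.
Qed.

Lemma ccontinuous_cst c : ccontinuous (fun=> c).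
Proof.
move=> x; split; rewrite /continuous_at.
  apply: (@cvg_near_cst _ _ _ _ (nbhs (val x))).
  by have := ext0_cst c x; apply: filterS => y; rewrite /re0 ext0E => <-.
apply: (@cvg_near_cst _ _ _ _ (nbhs (val x))).
by have := ext0_cst c x; apply: filterS => y; rewrite /im0 ext0E => <-.
Qed.

Lemma Ck_add k f g : Ck k f -> Ck k g -> Ck k (f \+ g).
Proof.
elim: k f g => [|k IHk] f g; first exact: ccontinuousD.
move=> [fc fd] [gc gd]; split; first exact: ccontinuousD.
move=> i; have [df Df] := fd i; have [dg Dg] := gd i; split=> [x|].
  exact: is_pd_derivable (is_pdD (is_pdP (df x)) (is_pdP (dg x))).
by rewrite pd_add //; exact: IHk.
Qed.

Lemma Ck_mul k f g : Ck k f -> Ck k g -> Ck k (f \* g).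
Proof.
elim: k f g => [|k IHk] f g; first exact: ccontinuousM.
move=> fk gk; have [fW gW] := (CkW fk, CkW gk).
case: fk gk => [fc fd] [gc gd]; split; first exact: ccontinuousM.
move=> i; have [df Df] := fd i; have [dg Dg] := gd i; split=> [x|].
  exact: is_pd_derivable (is_pdM (is_pdP (df x)) (is_pdP (dg x))).
by rewrite pd_mul //; apply: Ck_add; exact: IHk.
Qed.

Lemma Ck_cst k c : Ck k (fun=> c).
Proof.
elim: k c => [|k IHk] c; first exact: ccontinuous_cst.
split=> [|i]; first exact: ccontinuous_cst.
split=> [x|]; first exact: is_pd_derivable (is_pd_cst i c x).
by rewrite pd_cst; exact: IHk.
Qed.

Definition coord (j : 'I_3) : R30 -> R[i] := fun x => (val x j 0)%:C%C.
Definition invr_radius : R30 -> R[i] := fun x => ((radius x)^-1)%:C%C.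

Lemma ext0_coord j y : ext0 (coord j) y = (y j 0)%:C%C.
Proof.
rewrite /ext0; case: insubP => [x _ <- //|]; rewrite negbK => /eqP ->.
by rewrite mxE.
Qed.

Lemma ext0_invr_radius y : ext0 invr_radius y = ((enorm y)^-1)%:C%C.
Proof.
rewrite /ext0; case: insubP => [x _ <- //|]; rewrite negbK => /eqP ->.
by rewrite /enorm big1 ?sqrtr0 ?invr0 // => i _; rewrite mxE expr0n.
Qed.

Lemma re0_coord j : re0 (coord j) = fun y => y j 0.
Proof. by apply/funext => y; rewrite /re0 ext0_coord. Qed.

Lemma im0_coord j : im0 (coord j) = cst 0.
Proof. by apply/funext => y; rewrite /im0 ext0_coord. Qed.

Lemma re0_invr_radius : re0 invr_radius = fun y => (enorm y)^-1.
Proof. by apply/funext => y; rewrite /re0 ext0_invr_radius. Qed.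

Lemma im0_invr_radius : im0 invr_radius = cst 0.
Proof. by apply/funext => y; rewrite /im0 ext0_invr_radius. Qed.

Lemma is_derive_coord (x : 'cV[R]_3) i j :
  is_derive x (evec i) (fun y : 'cV[R]_3 => y j 0) ((i == j)%:R).
Proof.
apply: DeriveDef; first exact: diff_derivable (differentiable_coord x j 0).
have @f : {linear 'cV[R]_3 -> R}.
  by exists (fun y : 'cV[R]_3 => y j 0); do 2![eexists]; do ?[constructor];
     rewrite ?mxE // => ? *; rewrite ?mxE //; move=> ?; rewrite !mxE.
have fc : continuous f by exact: coord_continuous.
rewrite (_ : (fun _ => _) = f) // deriveE; last exact: linear_differentiable.
by rewrite diff_lin // /f /= !mxE andbT eq_sym.
Qed.

Lemma is_pd_coord i j x : is_pd i (coord j) x ((i == j)%:R).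
Proof.
have -> : (i == j)%:R = ((i == j)%:R)%:C%C :> R[i] by rewrite rmorph_nat.
rewrite /is_pd re0_coord im0_coord; split; first exact: is_derive_coord.
exact: is_derive_cst.
Qed.

Lemma Ck_coord k j : Ck k (coord j).
Proof.
have cc : ccontinuous (coord j).
  move=> x; rewrite re0_coord im0_coord; split.
    exact: coord_continuous.
  exact: cst_continuous.
case: k => [//|k]; split=> // i; split=> [x|].
  exact: is_pd_derivable (is_pd_coord i j x).
rewrite (_ : pd i _ = fun=> (i == j)%:R); first exact: Ck_cst.
by apply/funext => x; exact: is_pdE (is_pd_coord i j x).
Qed.

Lemma enorm_sqr (y : 'cV[R]_3) : enorm y ^+ 2 = \sum_i y i 0 ^+ 2.
Proof. by rewrite sqr_sqrtr // sumr_ge0 // => i _; exact: sqr_ge0. Qed.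

Lemma differentiable_enorm (x : R30) : differentiable (enorm) (val x).
Proof.
pose s (y : 'cV[R]_3) := \sum_i y i 0 ^+ 2.
have s0 : 0 < s (val x) by rewrite /s -enorm_sqr exprn_gt0 // enorm_gt0.
rewrite (_ : enorm = Num.sqrt \o s) //; apply: differentiable_comp; last first.
  by apply/derivable1_diffP; have [] := is_derive1_sqrt s0.
rewrite (_ : s = \sum_i (fun y : 'cV[R]_3 => y i 0) ^+ 2).
  apply: differentiable_sum => i; apply: differentiableX.
  exact: differentiable_coord.
by apply/funext => y; rewrite fct_sumE; apply: eq_bigr => i _; rewrite exprfctE.
Qed.

Lemma is_derive_enorm (x : R30) i :
  is_derive (val x) (evec i) enorm (val x i 0 / enorm (val x)).
Proof.
have x0 := enorm_gt0 x.
have dx : derivable enorm (val x) (evec i).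
  by apply: diff_derivable; exact: differentiable_enorm.
apply: DeriveDef => //.
have E : is_derive (val x) (evec i) (enorm * enorm) (2 * val x i 0).
  rewrite (_ : _ * _ = \sum_j (fun y : 'cV[R]_3 => y j 0) ^+ 2); last first.
    apply/funext => y; rewrite fct_sumE -[LHS]/(enorm y * enorm y) -expr2.
    by rewrite enorm_sqr; apply: eq_bigr => j _; rewrite exprfctE.
  have H j := is_derive_coord (val x) i j.
  apply: is_derive_eq.
  rewrite (bigD1 i) //= big1 ?addr0 => [|j ji].
    by rewrite eqxx expr1 /GRing.scale /= mulr1.
  by rewrite eq_sym (negPf ji) scaler0.
have := deriveM dx dx; rewrite (@derive_val _ _ _ _ _ _ _ E) /GRing.scale /=.
by move=> De; apply: (mulfI (lt0r_neq0 x0)); rewrite mulrCA mulfV ?lt0r_neq0 //; lra.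
Qed.

Lemma is_pd_invr_radius i x :
  is_pd i invr_radius x (- (coord i x * (invr_radius x) ^+ 3)).
Proof.
have x0 := enorm_gt0 x.
have -> : - (coord i x * invr_radius x ^+ 3) =
    (- ((val x i 0) / (enorm (val x)) ^+ 3))%:C%C.
  by rewrite /coord /invr_radius /radius -exprVn -rmorphXn -rmorphM -rmorphN.
have [d1 d2] := is_derive_enorm x i.
rewrite /is_pd re0_invr_radius im0_invr_radius; split; last exact: is_derive_cst.
apply: DeriveDef; first by apply: derivableV; rewrite ?gt_eqF.
rewrite deriveV ?gt_eqF // d2 /= /GRing.scale /= mulNr; congr (- _).
by rewrite mulrCA -invfM -exprSr.
Qed.

Lemma Ck_invr_radius k : Ck k invr_radius.
Proof.
have cc : ccontinuous invr_radius.
  move=> x; rewrite re0_invr_radius im0_invr_radius; split.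
    have x0 := enorm_gt0 x.
    apply: continuousV; first by rewrite gt_eqF.
    exact: differentiable_continuous (differentiable_enorm x).
  exact: cst_continuous.
elim: k => [//|k IHk]; split=> // i; split=> [x|].
  exact: is_pd_derivable (is_pd_invr_radius i x).
rewrite (_ : pd i _ = (fun=> -1) \* (coord i \* (invr_radius \*
    (invr_radius \* invr_radius)))).
  by do ![exact: Ck_cst | exact: Ck_coord | exact: IHk | apply: Ck_mul].
apply/funext => x; rewrite (is_pdE (is_pd_invr_radius i x)) /=.
by rewrite !exprS expr0 mulr1 mulN1r.
Qed.

End PuncturedSpace.

Section Spans.
Variables (A : nzRingType).

Definition lin_span (V : lmodType A) (S : set V) : set V :=
  [set v | exists n (c : 'I_n -> A) (e : 'I_n -> V),
    (forall i, S (e i)) /\ v = \sum_i c i *: e i].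

Definition lin_indep (V : lmodType A) n (e : 'I_n -> V) : Prop :=
  forall c : 'I_n -> A, \sum_i c i *: e i = 0 -> forall i, c i = 0.

Definition is_free (V : lmodType A) : Prop :=
  exists B : set V, lin_span B = setT /\
    forall n (e : 'I_n -> V), injective e -> (forall i, B (e i)) -> lin_indep e.

Definition is_fg_free (V : lmodType A) (N : set V) : Prop :=
  exists n (e : 'I_n -> V), lin_indep e /\ lin_span (range e) = N.

(* The linear span over the ring A of constants, in a module over {poly A}. *)
Definition const_span (V : lmodType {poly A}) (S : set V) : set V :=
  [set v | exists n (c : 'I_n -> A) (e : 'I_n -> V),
    (forall i, S (e i)) /\ v = \sum_i (c i)%:P *: e i].

End Spans.

Lemma lin_spanP (A : nzRingType) (V : lmodType A) (S : set V) :
  GRing.submod_closed [pred v : V | `[< lin_span S v >]].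
Proof.
split=> [|a u v]; rewrite !inE.
  by exists 0%N, (fun=> 0), (fun=> 0); rewrite big_ord0; split=> // -[].
move=> [n [c [e [Se ->]]]] [m [d [f [Sf ->]]]].
exists (n + m)%N,
  (fun i => match fintype.split i with inl j => a * c j | inr j => d j end),
  (fun i => match fintype.split i with inl j => e j | inr j => f j end).
split=> [i|]; first by case: (fintype.split i).
rewrite big_split_ord scaler_sumr; congr (_ + _); apply: eq_bigr => i _.
  by rewrite (unsplitK (inl i)) scalerA.
by rewrite (unsplitK (inr i)).
Qed.

Lemma lin_span_gen (A : nzRingType) (V : lmodType A) (S : set V) v :
  S v -> lin_span S v.
Proof.
move=> Sv; exists 1, (fun=> 1), (fun=> v); split=> //.
by rewrite big_ord1 scale1r.
Qed.

Lemma const_span_submod (A : comNzRingType) (V : lmodType {poly A}) (S : set V) :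
  (forall p v, S v -> S (p *: v)) ->
  GRing.submod_closed [pred v : V | `[< const_span S v >]].
Proof.
move=> SZ; split=> [|a u v]; rewrite !inE.
  by exists 0%N, (fun=> 0), (fun=> 0); rewrite big_ord0; split=> // -[].
move=> [n [c [e [Se ->]]]] [m [d [f [Sf ->]]]].
exists (n + m)%N,
  (fun i => match fintype.split i with inl j => c j | inr j => d j end),
  (fun i => match fintype.split i with inl j => a *: e j | inr j => f j end).
split=> [i|]; first by case: (fintype.split i) => j; [exact: SZ|].
rewrite big_split_ord scaler_sumr; congr (_ + _); apply: eq_bigr => i _.
  by rewrite (unsplitK (inl i)) !scalerA mulrC.
by rewrite (unsplitK (inr i)).
Qed.

Section SmoothFunctions.
Variable R : realType.

Definition smooth_pred : {pred (R30 R -> R[i]^o)} :=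
  [pred f | `[< is_smooth f >]].

Lemma smooth_submod : GRing.submod_closed smooth_pred.
Proof.
split=> [|a f g]; rewrite !inE.
  by move=> k; exact: Ck_cst.
move=> fs gs k.
by apply: (Ck_add (Ck_mul (Ck_cst k a) (fs k)) (gs k)).
Qed.

HB.instance Definition _ :=
  GRing.isSubmodClosed.Build _ _ smooth_pred smooth_submod.

Record smooth := Smooth {
  smooth_fun :> R30 R -> R[i]^o ; _ : smooth_fun \in smooth_pred }.

HB.instance Definition _ := [isSub for smooth_fun].
HB.instance Definition _ := [Choice of smooth by <:].
HB.instance Definition _ := [SubChoice_isSubLmodule of smooth by <:].

Lemma smoothP (f : smooth) : is_smooth f.
Proof. by have /asboolP := valP f. Qed.

Definition mk_smooth (f : R30 R -> R[i]) (fs : is_smooth f) : smooth :=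
  Smooth (asboolT fs : f \in smooth_pred).

Lemma pd_smooth i (f : smooth) : is_smooth (pd i f).
Proof. by move=> k; have [_ /(_ i)[]] := smoothP f k.+1. Qed.

Lemma mul_smooth (f g : smooth) : is_smooth (f \* g).
Proof. by move=> k; apply: Ck_mul; exact: smoothP. Qed.

Definition spd i (f : smooth) : smooth := mk_smooth (@pd_smooth i f).
Definition smul (f g : smooth) : smooth := mk_smooth (mul_smooth f g).
Definition sx i : smooth := mk_smooth (fun k => @Ck_coord R k i).
Definition sinvr : smooth := mk_smooth (@Ck_invr_radius R).

Lemma smooth_eq (f g : smooth) : (forall x, f x = g x) -> f = g.
Proof. by move=> fg; apply/val_inj/funext. Qed.

Lemma spd_linear i : linear (spd i).
Proof.
move=> a f g; apply: smooth_eq => x /=.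
have df y : pderivable i f y by have [_ /(_ i)[]] := smoothP f 1.
have dg y : pderivable i g y by have [_ /(_ i)[]] := smoothP g 1.
have dc y : pderivable i (fun=> a) y := is_pd_derivable (is_pd_cst i a y).
rewrite -[X in pd i X]/(((fun=> a) \* f) \+ g) pd_add // => [|y]; last first.
  exact: is_pd_derivable (is_pdM (is_pdP (dc y)) (is_pdP (df y))).
by rewrite /= pd_mul //= pd_cst mul0r add0r.
Qed.
HB.instance Definition _ i :=
  GRing.isLinear.Build R[i] smooth smooth *:%R (spd i) (spd_linear i).

Lemma smul_linear f : linear (smul f).
Proof.
move=> a g h; apply: smooth_eq => x /=.
by rewrite mulrDr; congr (_ + _); rewrite /GRing.scale /= mulrCA.
Qed.
HB.instance Definition _ f :=
  GRing.isLinear.Build R[i] smooth smooth *:%R (smul f) (smul_linear f).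

Variable gamma : R.

Definition opT (f : smooth) : smooth :=
  - (\sum_i spd i (spd i f)) - (2 * gamma)%:C%C *: smul sinvr f.

Lemma opT_linear : linear opT.
Proof.
move=> a f g; rewrite /opT.
have -> : \sum_i spd i (spd i (a *: f + g)) =
    a *: (\sum_i spd i (spd i f)) + \sum_i spd i (spd i g).
  by rewrite scaler_sumr -big_split; apply: eq_bigr => i _; rewrite !linearP.
have -> : smul sinvr (a *: f + g) = a *: smul sinvr f + smul sinvr g.
  exact: linearP.
rewrite !scalerDr !scalerN !scalerA [a * _]mulrC !opprD -!addrA.
by congr (_ + _); rewrite addrCA.
Qed.
HB.instance Definition _ :=
  GRing.isLinear.Build R[i] smooth smooth *:%R opT opT_linear.

(* Indices in 'I_3 are taken cyclically, so (i, i + 1, i + 2) is an even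
   permutation of the three axes. *)
Definition opL (i : 'I_3) (f : smooth) : smooth :=
  smul (sx (i + 1)) (spd (i + 2) f) - smul (sx (i + 2)) (spd (i + 1) f).

Definition opR (i : 'I_3) (f : smooth) : smooth :=
  'i%C *: (opL (i + 2) (spd (i + 1) f) - opL (i + 1) (spd (i + 2) f)
          - spd i f + gamma%:C%C *: smul (sx i) (smul sinvr f)).

(* A linear differential operator with smooth coefficients is identified with
   the endomap of the smooth functions on R30 that it defines.  The parameter
   records the constant gamma of the operator T, through which {poly R[i]} acts:
   p *: X is the composite p(T) X. *)
Definition operator_for (_ : R) : Type := smooth -> smooth.
Local Notation operator := (operator_for gamma).

HB.instance Definition _ := GRing.Zmodule.copy operator (smooth -> smooth).

Definition op_scale (p : {poly R[i]}) (X : operator) : operator :=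
  fun f => poly_act opT p (X f).

Fact op_scalerA p q X : op_scale p (op_scale q X) = op_scale (p * q) X.
Proof. by apply/funext => f; rewrite /op_scale poly_actM. Qed.
Fact op_scale1r : left_id 1 op_scale.
Proof. by move=> X; apply/funext => f; rewrite /op_scale -[1]/(1%:P) poly_actC scale1r. Qed.
Fact op_scalerDr : right_distributive op_scale +%R.
Proof. by move=> p X Y; apply/funext => f; rewrite /op_scale poly_actDr. Qed.
Fact op_scalerDl X : {morph op_scale^~ X : p q / p + q}.
Proof. by move=> p q; apply/funext => f; rewrite /op_scale poly_actDl. Qed.

HB.instance Definition _ := GRing.Zmodule_isLmodule.Build {poly R[i]} operator
  op_scalerA op_scale1r op_scalerDr op_scalerDl.

Definition op_comm (X Y : operator) : operator := fun f => X (Y f) - Y (X f).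

Definition galg_gens : set operator := range opL `|` range opR.

Definition galg_pred : {pred operator} := [pred X | `[< lin_span galg_gens X >]].

HB.instance Definition _ :=
  GRing.isSubmodClosed.Build _ _ galg_pred (lin_spanP galg_gens).

Record galg := Galg { galg_op :> operator ; _ : galg_op \in galg_pred }.

HB.instance Definition _ := [isSub for galg_op].
HB.instance Definition _ := [Choice of galg by <:].
HB.instance Definition _ := [SubChoice_isSubLmodule of galg by <:].

Lemma opL_galg i : opL i \in galg_pred.
Proof. by rewrite inE; apply: lin_span_gen; left; exists i. Qed.

Lemma opR_galg i : opR i \in galg_pred.
Proof. by rewrite inE; apply: lin_span_gen; right; exists i. Qed.

Definition gL (i : 'I_3) : galg := Galg (opL_galg i).
Definition gR (i : 'I_3) : galg := Galg (opR_galg i).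

Definition gcomb (a b : 'cV[{poly R[i]}]_3) : galg :=
  \sum_i (a i 0 *: gL i + b i 0 *: gR i).

End SmoothFunctions.

Section OrthogonalGroup.
Variable R : realType.

Definition O3 : {pred 'M[R[i]]_3} := [pred A | A *m A^T == 1%:M].

(* The regular functions on the affine group O3 are the restrictions of the
   polynomials in the nine matrix entries, numbered as in mxvec. *)
Definition mx_eval (c : mpoly (3 * 3) R[i]) (A : 'M[R[i]]_3) : R[i] :=
  meval (mxvec A 0) c.

(* Derivative of c at the identity matrix in the direction xi. *)
Definition mx_diff1 (c : mpoly (3 * 3) R[i]) (xi : 'M[R[i]]_3) : R[i] :=
  \sum_k mxvec xi 0 k * mx_eval (mderiv k c) 1%:M.

Definition algebraic_irrep n (rho : 'M[R[i]]_3 -> 'M[R[i]]_n) : Prop :=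
  [/\ (0 < n)%N,
      rho 1%:M = 1%:M,
      {in O3 &, forall A B, rho (A *m B) = rho A *m rho B},
      exists c : 'I_n -> 'I_n -> mpoly (3 * 3) R[i],
        {in O3, forall A, forall i j, rho A i j = mx_eval (c i j) A}
    & (* a space of column vectors is encoded by the row space of U *)
      forall U : 'M[R[i]]_n,
        {in O3, forall A, stablemx U (rho A)^T} -> U = 0 \/ row_full U].

(* The action of xi in so(3) on functions, f |-> d/dt f (exp (- t xi) x) at
   t = 0, is the vector field - \sum_(i, j) xi i j x_j d_i; so3_galgE shows that
   it is given by the following element of the span of the L_i. *)
Definition so3_galg (gamma : R) (xi : 'M[R[i]]_3) : galg gamma :=
  - \sum_i (xi (i + 2) (i + 1))%:P *: gL gamma i.

Fact so3_aux (K : comNzRingType) (a b c u v w y0 y1 y2 : K) :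
  - (a * (y1 * w - y2 * v) + - b * (y2 * u - y0 * w) + c * (y0 * v - y1 * u)) =
  - (0 * y0 * u + - c * y1 * u + - b * y2 * u +
     (c * y0 * v + 0 * y1 * v + - a * y2 * v) +
     (b * y0 * w + a * y1 * w + 0 * y2 * w)).
Proof. ring. Qed.

Lemma so3_galgE gamma xi (f : smooth R) x : xi^T = - xi ->
  galg_op (so3_galg gamma xi) f x = - \sum_i \sum_j xi i j * coord j x * pd i f x.
Proof.
move=> xiT; have xiN i j : xi i j = - xi j i.
  by have /matrixP/(_ j i) := xiT; rewrite !mxE.
have xi0 i : xi i i = 0.
  have /eqP : xi i i *+ 2 = 0 by rewrite mulr2n {1}xiN addNr.
  by rewrite mulrn_eq0 => /eqP.
have galgD (X Y : galg gamma) : galg_op (X + Y) f = galg_op X f + galg_op Y f.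
  by [].
have galgN (X : galg gamma) : galg_op (- X) f = - galg_op X f by [].
have galgZ c (X : galg gamma) : galg_op (c%:P *: X) f = c *: galg_op X f.
  exact: poly_actC.
have [i0 [i1 [i2 [sum3 [e01 e02 e11] [e12 e21 e22]]]]] : exists i0 i1 i2 : 'I_3,
    [/\ forall (V : zmodType) (G : 'I_3 -> V), \sum_i G i = G i0 + G i1 + G i2,
        [/\ i0 + 1 = i1, i0 + 2 = i2 & i1 + 1 = i2]
      & [/\ i1 + 2 = i0, i2 + 1 = i0 & i2 + 2 = i1]].
  exists 0, 1, 2; split; [move=> V G|by split; apply/val_inj..].
  rewrite !big_ord_recl big_ord0 addr0 addrA.
  by congr (G _ + G _ + G _); apply/val_inj.
have -> : galg_op (so3_galg gamma xi) f =
    - \sum_i xi (i + 2) (i + 1) *: opL i f.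
  rewrite galgN; congr (- _).
  rewrite (big_morph (fun X : galg gamma => galg_op X f) galgD (erefl _)).
  by apply: eq_bigr => i _; exact: galgZ.
rewrite (sum3 _ (fun i => xi (i + 2) (i + 1) *: opL i f)).
have -> : \sum_i \sum_j xi i j * coord j x * pd i f x =
    \sum_i (xi i i0 * coord i0 x * pd i f x + xi i i1 * coord i1 x * pd i f x +
            xi i i2 * coord i2 x * pd i f x).
  by apply: eq_bigr => i _; exact: sum3.
rewrite [X in _ = - X]sum3.
rewrite !xi0.
rewrite /opL e01 e02 e11 e12 e21 e22.
rewrite (xiN i0 i1) (xiN i0 i2) (xiN i1 i2).
set d0 := pd i0 f; set d1 := pd i1 f; set d2 := pd i2 f.
rewrite -[LHS]/(- (xi i2 i1 * (coord i1 x * d2 x - coord i2 x * d1 x) +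
  - xi i2 i0 * (coord i2 x * d0 x - coord i0 x * d2 x) +
  xi i1 i0 * (coord i0 x * d1 x - coord i1 x * d0 x))).
exact: so3_aux.
Qed.

(* The operators L and R transform as vectors under (det A)^-1 A; for real A
   this is conjugation by the action of A on functions on R30.  The vector a
   holds the coordinates of \sum_i a_i L_i (or of \sum_i a_i R_i). *)
Definition Ad3 (A : 'M[R[i]]_3) (a : 'cV[{poly R[i]}]_3) : 'cV[{poly R[i]}]_3 :=
  map_mx polyC ((\det A)^-1 *: A) *m a.

End OrthogonalGroup.

Section HarishChandra.
Variables (R : realType) (gamma : R) (M : lmodType {poly R[i]}).
Variables (kact : 'M[R[i]]_3 -> M -> M) (gact : galg gamma -> M -> M).

(* The sum of the images of all K-equivariant linear maps to M from the
   representation rho; such a map is given by the images e of the standard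
   basis of column vectors. *)
Definition isotypic n (rho : 'M[R[i]]_3 -> 'M[R[i]]_n) : set M :=
  const_span [set v | exists2 e : 'I_n -> M,
    {in @O3 R, forall A, forall j, kact A (e j) = \sum_i (rho A i j)%:P *: e i}
    & exists j, v = e j].

Record HC_family : Prop := {
  hc_free : is_free M;
  hc_kact_linear : {in @O3 R, forall A p v w,
    kact A (p *: v + w) = p *: kact A v + kact A w};
  hc_kact1 : forall v, kact 1%:M v = v;
  hc_kactM : {in @O3 R &, forall A B v, kact (A *m B) v = kact A (kact B v)};
  hc_algebraic : forall v, exists n (e : 'I_n -> M)
      (c : 'I_n -> 'I_n -> mpoly (3 * 3) R[i]),
    [/\ forall b : 'I_n -> R[i],
          \sum_i (b i)%:P *: e i = 0 -> forall i, b i = 0,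
        const_span (range e) v
      & {in @O3 R, forall A, forall j,
          kact A (e j) = \sum_i (mx_eval (c i j) A)%:P *: e i}];
  hc_admissible : forall n (rho : 'M[R[i]]_3 -> 'M[R[i]]_n),
    algebraic_irrep rho -> is_fg_free (isotypic rho);
  hc_gact_linearl : forall p X Y v,
    gact (p *: X + Y) v = p *: gact X v + gact Y v;
  hc_gact_linearr : forall X p v w,
    gact X (p *: v + w) = p *: gact X v + gact X w;
  hc_gact_bracket : forall (X Y Z : galg gamma) v, galg_op Z = op_comm X Y ->
    gact Z v = gact X (gact Y v) - gact Y (gact X v);
  hc_equivariant : {in @O3 R, forall A a b v,
    kact A (gact (gcomb gamma a b) v) =
    gact (gcomb gamma (Ad3 A a) (Ad3 A b)) (kact A v)};
  hc_infinitesimal : forall xi v n (e : 'I_n -> M)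
      (c : 'I_n -> mpoly (3 * 3) R[i]), xi^T = - xi ->
    {in @O3 R, forall A, kact A v = \sum_i (mx_eval (c i) A)%:P *: e i} ->
    gact (so3_galg gamma xi) v = \sum_i (mx_diff1 (c i) xi)%:P *: e i
}.

End HarishChandra.

Section RegularSolutions.
Variable R : realType.

Definition cderive (psi : R -> R[i]) : R -> R[i] := fun r =>
  (derive1 (fun t => complex.Re (psi t)) r +i*
   derive1 (fun t => complex.Im (psi t)) r)%C.

(* Only the values of psi on ]0, +oo[ matter.  Its entire extension is given by
   its Taylor series \sum_n a n * z ^+ n, convergent for all complex z. *)
Definition is_regular_solution (gamma : R) (l : nat) (lam : R[i])
    (psi : R -> R[i]) : Prop :=
  (forall r : R, 0 < r ->
     (r ^+ 2)%:C%C * cderive (cderive psi) r + (2 * r)%:C%C * cderive psi r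
     - (l * l.+1)%N%:R * psi r + (2 * gamma * r)%:C%C * psi r
     + lam * (r ^+ 2)%:C%C * psi r = 0) /\
  exists a : nat -> (R[i] : numFieldType),
    [/\ forall z : R[i], cvgn (series (fun n => a n * z ^+ n)),
        forall r : R, 0 < r ->
          series (fun n => a n * r%:C%C ^+ n) @ \oo -->
            (psi r : (R[i] : numFieldType)),
        forall k, (k < l)%N -> a k = 0
      & a l = 1].

Definition spherical_harmonic (l : nat) (Y : S2 R -> R[i]) : Prop :=
  exists P : mpoly 3 R[i],
    [/\ P \is ishomog1 l mdeg,
        \sum_i mderiv i (mderiv i P) = 0
      & forall t : S2 R, Y t = meval (fun i => (val t i 0)%:C%C) P].

Definition sections_on_R30 : Type := R[i] -> R30 R -> R[i].

HB.instance Definition _ :=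
  GRing.Zmodule.copy sections_on_R30 (R[i] -> R30 R -> R[i]).

Definition section_scale (p : {poly R[i]}) (Phi : sections_on_R30) :
  sections_on_R30 := fun lam x => p.[lam] * Phi lam x.

Fact section_scalerA p q Phi :
  section_scale p (section_scale q Phi) = section_scale (p * q) Phi.
Proof. by apply/funext => lam; apply/funext => x; rewrite /section_scale hornerM mulrA. Qed.
Fact section_scale1r : left_id 1 section_scale.
Proof. by move=> Phi; apply/funext => lam; apply/funext => x; rewrite /section_scale hornerC mul1r. Qed.
Fact section_scalerDr : right_distributive section_scale +%R.
Proof. by move=> p Phi Psi; apply/funext => lam; apply/funext => x; rewrite /section_scale mulrDr. Qed.
Fact section_scalerDl Phi : {morph section_scale^~ Phi : p q / p + q}.
Proof. by move=> p q; apply/funext => lam; apply/funext => x; rewrite /section_scale hornerD mulrDl. Qed.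

HB.instance Definition _ := GRing.Zmodule_isLmodule.Build {poly R[i]}
  sections_on_R30 section_scalerA section_scale1r section_scalerDr
  section_scalerDl.

Variable F : nat -> R[i] -> R -> R[i].

Definition wave (l : nat) (Y : S2 R -> R[i]) (lam : R[i]) : R30 R -> R[i] :=
  fun x => F l lam (radius x) * Y (angular x).

Definition poly_wave (p : {poly R[i]}) (l : nat) (Y : S2 R -> R[i]) :
  sections_on_R30 := fun lam x => p.[lam] * wave l Y lam x.

Definition regular_gens : set sections_on_R30 :=
  [set Phi | exists p l Y, spherical_harmonic l Y /\ Phi = poly_wave p l Y].

Definition regular_pred : {pred sections_on_R30} :=
  [pred Phi | `[< const_span regular_gens Phi >]].

Lemma regular_submod : GRing.submod_closed regular_pred.
Proof.
apply: const_span_submod => q _ [p [l [Y [hY ->]]]].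
exists (q * p), l, Y; split=> //.
apply/funext => lam; apply/funext => x.
by rewrite /poly_wave hornerM -mulrA.
Qed.

HB.instance Definition _ :=
  GRing.isSubmodClosed.Build _ _ regular_pred regular_submod.

Record regular := Regular {
  regular_fun :> sections_on_R30 ; _ : regular_fun \in regular_pred }.

HB.instance Definition _ := [isSub for regular_fun].
HB.instance Definition _ := [Choice of regular by <:].
HB.instance Definition _ := [SubChoice_isSubLmodule of regular by <:].

(* Differential operators are applied to smooth functions only; other
   functions are sent to 0. *)
Definition op_apply (gamma : R) (X : operator_for gamma) (f : R30 R -> R[i]) :
  R30 R -> R[i] := X (insubd 0 f).

Definition galg_wave (gamma : R) (X : galg gamma) (p : {poly R[i]}) (l : nat)
    (Y : S2 R -> R[i]) : sections_on_R30 :=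
  fun lam x => p.[lam] * op_apply X (wave l Y lam) x.

End RegularSolutions.

(* Main.v *)
Require Import Defs.
From HB Require Import structures.
From mathcomp Require Import all_boot all_order all_algebra.
From mathcomp Require Import complex.
From mathcomp Require Import all_classical all_reals all_analysis.
From mathcomp Require Import ring lra zify.
From mathcomp Require Import -(notations) mpoly.

(* The radial function is F_l(r) = r^l G_l(r), where the Taylor coefficients of
   G_l are polynomials in lambda given by a two-step recurrence.  Hence u |->
   sum_l G_l(r) u_l, where u_l is the homogeneous part of degree l of a
   harmonic polynomial u in x_1, x_2, x_3 with coefficients in C[lambda],
   identifies these polynomials with R.  Under this identification L_i acts by
   x_(i+1) d_(i+2) - x_(i+2) d_(i+1), and R_i by the combination
     q_l(lambda) (x_i u_l - r^2 d_i u_l / (2 l + 1)) - l d_i u_l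
   up to the factor sqrt(-1), because of the contiguity relations
     (l + 1) G_l' + gamma G_l = q_l(lambda) r G_(l+1)
     l (r G_l' + (2 l + 1) G_l) - gamma r G_l = l (2 l + 1) G_(l-1),
   where q_l is a polynomial in lambda.  Everything else is algebra:
   O(3) acts by linear substitutions, and admissibility holds because the
   Casimir operator has the distinct eigenvalues -l (l + 1) on the harmonic
   polynomials of degree l, so that an irreducible representation, whose
   Casimir matrix has finitely many eigenvalues, meets finitely many degrees. *)

Set Implicit Arguments.
Unset Strict Implicit.
Unset Printing Implicit Defensive.

Import Order.TTheory GRing.Theory Num.Theory numFieldNormedType.Exports.
Local Open Scope classical_set_scope.
Local Open Scope ring_scope.

(** * Harmonic polynomials *)

(** The action of g is obtained by a choice. Every X in g acts on all fibres through some map of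
    harmonic polynomials over C[lambda], and that map is unique because u |-> sum_l G_l(r) u_l is
    injective at each fixed lambda. Linearity in X and the bracket relations are then inherited from
    the differential operators, so no commutator of the R_i is ever computed. The contiguity
    relations come from uniqueness: the left-hand side (in the first relation, after division by r)
    satisfies the recurrence of the neighbouring degree, whose solutions are determined by their
    first term. This first term is the origin of q_l. Compatibility of g with K involves derivatives
    at the identity of regular functions that are known only on O(3, C). They are computed along
    curves in the group on which these functions become polynomials in a parameter t: if xi in so(3,
    C) is nilpotent, exp(t xi) has degree 2 in t. Such xi span so(3, C), thanks to isotropic
    vectors. *)

Section PolynomialCalculus.
Variable n : nat.
Local Notation var K i := (mpolyX K (mnm1 i) : mpoly n K).

(** Ring morphisms and derivations are determined on constants and variables; this induction
    principle reduces identities between them to these two cases. *)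
Lemma mpoly_gen_ind (K : comNzRingType) (Q : mpoly n K -> Prop) :
  (forall c, Q (mpolyC n c)) -> (forall i, Q (var K i)) ->
  (forall p q, Q p -> Q q -> Q (p + q)) ->
  (forall p q, Q p -> Q q -> Q (p * q)) -> forall p, Q p.
Proof.
move=> QC QX QD QM p; rewrite [p]mpolyE.
have Q0 : Q 0 by rewrite -(mpolyC0 n K); exact: QC.
have Q1 : Q 1 by rewrite -(mpolyC1 n K); exact: QC.
apply: (big_ind Q Q0 QD) => m _.
rewrite -mul_mpolyC; apply: (QM _ _ (QC _)) => {p}.
rewrite mpolyXE_id; apply: (big_ind Q Q1 QM) => i _.
elim: (m i) => [|k IHk]; first by rewrite expr0.
by rewrite exprS; exact: QM.
Qed.

(** The chain rule for an arbitrary derivation [d] that kills constants. It is used for partial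
    derivatives of linear substitutions and for derivatives along polynomial curves. *)
Lemma mmap_chain (K A : comNzRingType) (f : {rmorphism K -> A}) (h : 'I_n -> A)
    (d : A -> A) : (forall x y, d (x + y) = d x + d y) ->
  (forall x y, d (x * y) = d x * y + x * d y) -> (forall c, d (f c) = 0) ->
  forall p, d (mmap f h p) = \sum_i mmap f h (mderiv i p) * d (h i).
Proof.
move=> dD dM dC; elim/mpoly_gen_ind => [c|j|p q IHp IHq|p q IHp IHq].
- by rewrite mmapC dC big1 // => i _; rewrite mderivC mmap0 mul0r.
- rewrite mmapX mmap1U (bigD1 j) //= mderivX mnm1E eqxx.
  rewrite (_ : mnm_sub _ _ = mnm0); last by apply/mnmP => k; rewrite mnmBE mnm0E subnn.
  rewrite mpolyX0 scale1r rmorph1 mul1r big1 ?addr0 // => i ij.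
  by rewrite mderivX mnm1E eq_sym (negPf ij) scale0r mmap0 mul0r.
- rewrite mmapD dD IHp IHq -big_split; apply: eq_bigr => i _ /=.
  by rewrite mderivD mmapD mulrDl.
rewrite rmorphM dM IHp IHq mulr_suml mulr_sumr -big_split.
apply: eq_bigr => i _ /=; rewrite mderivM rmorphD !rmorphM /=; ring.
Qed.

(** As a function, [lsubst B p] is p composed with the transpose of B. The transpose makes the
    construction covariant in B, and for orthogonal B it is composition with the inverse, the usual
    action on functions. *)
Definition lsubst (K : comNzRingType) (B : 'M[K]_n) : mpoly n K -> mpoly n K :=
  mmap (@mpolyC n K) (fun j => \sum_i B i j *: var K i).

HB.instance Definition _ K B := GRing.RMorphism.on (@lsubst K B).

Section Subst.
Variables (K : comNzRingType).
Implicit Types (A B : 'M[K]_n) (p q : mpoly n K).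

Lemma lsubstX B j : lsubst B (var K j) = \sum_i B i j *: var K i.
Proof. by rewrite /lsubst mmapX mmap1U. Qed.

Lemma lsubstC B c : lsubst B (mpolyC n c) = mpolyC n c.
Proof. exact: mmapC. Qed.

Lemma lsubstZ B c p : lsubst B (c *: p) = c *: lsubst B p.
Proof. by rewrite -!mul_mpolyC rmorphM /= lsubstC. Qed.

HB.instance Definition _ B :=
  GRing.isScalable.Build K (mpoly n K) (mpoly n K) *:%R (lsubst B) (lsubstZ B).

Lemma lsubst1 p : lsubst 1%:M p = p.
Proof.
elim/mpoly_gen_ind: p => [c|j|p q IHp IHq|p q IHp IHq].
- exact: lsubstC.
- rewrite lsubstX (bigD1 j) //= big1 ?addr0 => [|i ij].
    by rewrite mxE eqxx scale1r.
  by rewrite mxE (negPf ij) scale0r.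
- by rewrite rmorphD /= IHp IHq.
by rewrite rmorphM /= IHp IHq.
Qed.

Lemma lsubst_mulmx A B p : lsubst (A *m B) p = lsubst A (lsubst B p).
Proof.
elim/mpoly_gen_ind: p => [c|j|p q IHp IHq|p q IHp IHq].
- by rewrite !lsubstC.
- rewrite !lsubstX linear_sum /=.
  under [RHS]eq_bigr do rewrite linearZ /= lsubstX scaler_sumr.
  rewrite exchange_big; apply: eq_bigr => i _ /=.
  rewrite mxE scaler_suml; apply: eq_bigr => k _.
  by rewrite scalerA mulrC.
- by rewrite !rmorphD /= IHp IHq.
by rewrite !rmorphM /= IHp IHq.
Qed.

Lemma mderiv_var i j : mderiv i (var K j) = (i == j)%:R.
Proof.
rewrite mderivX mnm1E eq_sym; case: eqP => [->|_]; last by rewrite scale0r.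
rewrite (_ : mnm_sub _ _ = mnm0); last by apply/mnmP => k; rewrite mnmBE mnm0E subnn.
by rewrite mpolyX0 scale1r.
Qed.

Lemma mderiv_lsubst k B p :
  mderiv k (lsubst B p) = \sum_j B k j *: lsubst B (mderiv j p).
Proof.
rewrite /lsubst (@mmap_chain _ _ (@mpolyC n K) _ (mderiv k)).
- apply: eq_bigr => j _; rewrite linear_sum /= (bigD1 k) //= big1 ?addr0 => [|i ik].
    by rewrite mderivZ mderiv_var eqxx mulrC -scalerAl mul1r.
  by rewrite mderivZ mderiv_var eq_sym (negPf ik) scaler0.
- exact: mderivD.
- exact: mderivM.
exact: mderivC.
Qed.

Lemma meval_lsubst v B p :
  meval v (lsubst B p) = meval (fun j => \sum_i B i j * v i) p.
Proof.
elim/mpoly_gen_ind: p => [c|j|p q IHp IHq|p q IHp IHq].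
- by rewrite lsubstC !mevalC.
- rewrite lsubstX mevalXU raddf_sum; apply: eq_bigr => i _.
  by rewrite /= mevalZ mevalXU.
- by rewrite rmorphD /= !mevalD IHp IHq.
by rewrite rmorphM /= !mevalM IHp IHq.
Qed.

Lemma lsubst_monomial_homog B m : lsubst B (mpolyX K m) \is ishomog1 (mdeg m) mdeg.
Proof.
rewrite mpolyXE_id rmorph_prod mdegE.
apply: (big_rec2 (fun d (q : mpoly n K) => q \is ishomog1 d mdeg)).
  exact: dhomog1.
move=> i d q _ dq; apply: dhomogM => //; rewrite rmorphXn /= -[X in ishomog1 X _]mul1n.
apply: dhomogMn; rewrite lsubstX; apply: rpred_sum => j _; apply: rpredZ.
by rewrite dhomogX /= mdeg1.
Qed.

Lemma lsubstE B p :
  lsubst B p = \sum_(m <- msupp p) mcoeff m p *: lsubst B (mpolyX K m).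
Proof.
by rewrite {1}[p]mpolyE linear_sum /=; apply: eq_bigr => m _; rewrite linearZ.
Qed.

Lemma lsubst_homog B d p :
  p \is ishomog1 d mdeg -> lsubst B p \is ishomog1 d mdeg.
Proof.
move=> /dhomogP dp; rewrite lsubstE big_seq; apply: rpred_sum => m /dp <-.
exact/rpredZ/lsubst_monomial_homog.
Qed.

Lemma msize_lsubst B p : (mmeasure mdeg (lsubst B p) <= mmeasure mdeg p)%N.
Proof.
rewrite lsubstE (leq_trans (mmeasure_sum _ _ _ _)) // big_seq.
apply/bigmax_leqP_seq => m _ mp; rewrite (leq_trans (mmeasureZ_le _ _ _)) //.
rewrite (leq_trans _ (mmeasure_mnm_lt mdeg mp)) // msizeE.
apply/bigmax_leqP_seq => k kB _.
by have /dhomogP/(_ _ kB) -> := lsubst_monomial_homog B m.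
Qed.

End Subst.

Lemma map_lsubst (K A : comNzRingType) (f : {rmorphism K -> A}) (B : 'M[K]_n) p :
  map_mpoly f (lsubst B p) = lsubst (map_mx f B) (map_mpoly f p).
Proof.
elim/mpoly_gen_ind: p => [c|j|p q IHp IHq|p q IHp IHq].
- by rewrite lsubstC !map_mpolyC lsubstC.
- rewrite lsubstX map_mpolyX lsubstX raddf_sum; apply: eq_bigr => i _.
  by rewrite /= map_mpolyZ map_mpolyX mxE.
- by rewrite !rmorphD /= IHp IHq.
by rewrite !rmorphM /= IHp IHq.
Qed.

Lemma map_mderiv (K A : comNzRingType) (f : {rmorphism K -> A}) i (p : mpoly n K) :
  map_mpoly f (mderiv i p) = mderiv i (map_mpoly f p).
Proof.
by apply/mpolyP => m; rewrite mcoeff_map_mpoly !mcoeff_deriv mcoeff_map_mpoly raddfMn.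
Qed.

End PolynomialCalculus.

Section CyclicIndices.

Lemma ord3_cases (i : 'I_3) : [\/ i = 0, i = 1 | i = 2].
Proof.
by move: i; case=> [[|[|[|//]]] ?]; [constructor 1|constructor 2|constructor 3];
   apply/val_inj.
Qed.

(** The sum may start at any index, so that identities about a generic axis [i] expand into three
    terms without a case analysis on [i]. *)
Lemma sum3 (V : zmodType) (i : 'I_3) (G : 'I_3 -> V) :
  \sum_j G j = G i + G (i + 1) + G (i + 2).
Proof.
have -> : \sum_j G j = G 0 + G 1 + G 2.
  rewrite !big_ord_recl big_ord0 addr0 addrA.
  by congr (G _ + G _ + G _); apply/val_inj.
have e12 : 1 + 2 = 0 :> 'I_3 by apply/val_inj.
have e21 : 2 + 1 = 0 :> 'I_3 by apply/val_inj.
have e22 : 2 + 2 = 1 :> 'I_3 by apply/val_inj.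
have e11 : 1 + 1 = 2 :> 'I_3 by apply/val_inj.
have [->|->|->] := ord3_cases i; rewrite ?add0r ?(e12, e21, e22, e11) //.
  by rewrite -addrA addrC.
by rewrite addrC addrA.
Qed.

Lemma ord3_11 (i : 'I_3) : i + 1 + 1 = i + 2.
Proof. by move: i; case=> [[|[|[|//]]] ?]; apply/val_inj. Qed.
Lemma ord3_12 (i : 'I_3) : i + 1 + 2 = i.
Proof. by move: i; case=> [[|[|[|//]]] ?]; apply/val_inj. Qed.
Lemma ord3_21 (i : 'I_3) : i + 2 + 1 = i.
Proof. by move: i; case=> [[|[|[|//]]] ?]; apply/val_inj. Qed.
Lemma ord3_22 (i : 'I_3) : i + 2 + 2 = i + 1.
Proof. by move: i; case=> [[|[|[|//]]] ?]; apply/val_inj. Qed.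
Definition ord3E := (ord3_11, ord3_12, ord3_21, ord3_22).

Lemma ord3_eq (i : 'I_3) :
  (((i == i + 1)%R = false) * ((i == i + 2)%R = false) *
   ((i + 1 == i)%R = false) * ((i + 2 == i)%R = false) *
   ((i + 1 == i + 2)%R = false) * ((i + 2 == i + 1)%R = false))%type.
Proof. by have [->|->|->] := ord3_cases i. Qed.

End CyclicIndices.

(** * The Laplacian, the Euler field and the rotation fields on polynomials *)

Section Laplacian.
Variable K : comNzRingType.
Local Notation var i := (mpolyX K (mnm1 i) : mpoly 3 K).
Implicit Types (p q : mpoly 3 K) (B : 'M[K]_3).

Definition lapl p := \sum_i mderiv i (mderiv i p).

Lemma lapl_linear : linear lapl.
Proof.
move=> c p q; rewrite /lapl scaler_sumr -big_split; apply: eq_bigr => i _.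
by rewrite !linearP.
Qed.
HB.instance Definition _ :=
  GRing.isLinear.Build K (mpoly 3 K) (mpoly 3 K) *:%R lapl lapl_linear.

Definition rsqr : mpoly 3 K := \sum_i var i ^+ 2.
Definition euler p := \sum_i var i * mderiv i p.
Definition rot i p := var (i + 1) * mderiv (i + 2) p - var (i + 2) * mderiv (i + 1) p.

Lemma rot_linear i : linear (rot i).
Proof. by move=> c p q; rewrite /rot !linearP /= !mulrDr -!scalerAr scalerBr; ring. Qed.
HB.instance Definition _ i :=
  GRing.isLinear.Build K (mpoly 3 K) (mpoly 3 K) *:%R (rot i) (rot_linear i).

Lemma euler_linear : linear euler.
Proof.
move=> c p q; rewrite /euler scaler_sumr -big_split; apply: eq_bigr => i _.
by rewrite linearP /= mulrDr -scalerAr.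
Qed.
HB.instance Definition _ :=
  GRing.isLinear.Build K (mpoly 3 K) (mpoly 3 K) *:%R euler euler_linear.

Lemma mcoeff_euler m p : mcoeff m (euler p) = (mdeg m)%:R * mcoeff m p.
Proof.
have eX k : euler (mpolyX K k) = (mdeg k)%:R *: mpolyX K k.
  rewrite /euler mdegE natr_sum scaler_suml; apply: eq_bigr => i _.
  rewrite mderivX -scalerAr; case: (posnP (k i)) => [->|ki]; first by rewrite !scale0r.
  rewrite -mpolyXD; congr (_ *: mpolyX _ _).
  by rewrite addmC submK // lep1mP -lt0n.
have -> : euler p = \sum_(k <- msupp p) mcoeff k p *: euler (mpolyX K k).
  by rewrite {1}[p]mpolyE (linear_sum euler); apply: eq_bigr => k _; exact: linearZ.
have -> : mcoeff m p = \sum_(k <- msupp p) mcoeff m (mcoeff k p *: mpolyX K k).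
  by rewrite {1}[p]mpolyE raddf_sum.
rewrite (raddf_sum (mcoeff m)) mulr_sumr; apply: eq_bigr => k _ /=.
rewrite eX !mcoeffZ mcoeffX.
by case: eqP => [->|_]; rewrite ?mulr0 // mulrCA.
Qed.

Lemma euler_homog l p : p \is ishomog1 l mdeg -> euler p = l%:R *: p.
Proof.
move=> hp; apply/mpolyP => m; rewrite mcoeff_euler mcoeffZ.
case: (eqVneq (mdeg m) l) => [-> //|ml].
by rewrite (dhomog_nemf_coeff hp ml) !mulr0.
Qed.

Lemma mderiv_homog l i p :
  p \is ishomog1 l.+1 mdeg -> mderiv i p \is ishomog1 l mdeg.
Proof.
move=> hp; apply/dhomogP => m; rewrite mcoeff_msupp mcoeff_deriv => nz.
apply/eqP/negPn/negP => ml; move: nz; rewrite (dhomog_nemf_coeff hp) ?mul0rn ?eqxx //=.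
by rewrite mdegD mdeg1 addn1 eqSS.
Qed.

Lemma mderiv_homog0 i p : p \is ishomog1 0 mdeg -> mderiv i p = 0.
Proof.
move=> hp; apply/mpolyP => m; rewrite mcoeff_deriv mcoeff0.
by rewrite (dhomog_nemf_coeff hp) ?mul0rn //= mdegD mdeg1 addn1.
Qed.

Lemma var_homog i : var i \is ishomog1 1 mdeg.
Proof. by rewrite dhomogX /= mdeg1. Qed.

Lemma rsqr_homog : rsqr \is ishomog1 2 mdeg.
Proof.
by apply: rpred_sum => i _; have := dhomogMn 2 (var_homog i); rewrite mul1n.
Qed.

Lemma rot_homog l i p : p \is ishomog1 l mdeg -> rot i p \is ishomog1 l mdeg.
Proof.
case: l => [|l] hp; first by rewrite /rot !(mderiv_homog0 _ hp) !mulr0 subrr rpred0.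
by apply: rpredB; exact: dhomogM (var_homog _) (mderiv_homog _ hp).
Qed.

Lemma lapl_mderiv i p : lapl (mderiv i p) = mderiv i (lapl p).
Proof.
rewrite /lapl linear_sum; apply: eq_bigr => j _.
by rewrite (mderiv_comm i j) (mderiv_comm i j).
Qed.

Lemma lapl_var i p : lapl (var i * p) = mderiv i p *+ 2 + var i * lapl p.
Proof.
rewrite /lapl !(sum3 i) !(mderivM, mderiv_var, mderivD) !ord3_eq !eqxx.
rewrite !(mulr0n, mulr1n) -!(mpolyC0 3 K) -!(mpolyC1 3 K) !mderivC !mpolyC0 !mpolyC1.
ring.
Qed.

Lemma lapl_rsqr p : lapl (rsqr * p) = p *+ 6 + euler p *+ 4 + rsqr * lapl p.
Proof.
rewrite /rsqr /euler !mulr_suml linear_sum /= -!sumrMnl.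
have -> : p *+ 6 = \sum_(i < 3) p *+ 2 by rewrite sumr_const card_ord -mulrnA.
rewrite -!big_split; apply: eq_bigr => i _ /=.
rewrite expr2 -mulrA !lapl_var mderivM mderiv_var eqxx mulr1n; ring.
Qed.

Lemma lapl_rot i p : lapl (rot i p) = rot i (lapl p).
Proof.
rewrite /rot linearB /= !lapl_var !lapl_mderiv (mderiv_comm (i + 2)); ring.
Qed.

(** Orthonormality of the columns of [B] in contracted form, valid for values in any module. *)
Lemma orth_sum (V : lmodType K) B (G : 'I_3 -> V) j : B^T *m B = 1%:M ->
  \sum_k B k j *: (\sum_i B k i *: G i) = G j.
Proof.
move=> /matrixP BB; under eq_bigr do rewrite scaler_sumr.
rewrite exchange_big -[RHS](@big_pred1_eq V 0 +%R _ j G) [RHS]big_mkcond /=.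
apply: eq_bigr => i _; under eq_bigr do rewrite scalerA.
rewrite -scaler_suml (_ : \sum_k _ = (1%:M : 'M[K]_3) j i).
  by rewrite mxE eq_sym; case: eqP => _; rewrite ?scale1r ?scale0r.
by rewrite -BB mxE; apply: eq_bigr => k _; rewrite mxE.
Qed.

Lemma lapl_lsubst B p : B *m B^T = 1%:M -> lapl (lsubst B p) = lsubst B (lapl p).
Proof.
move=> /mulmx1C BB; rewrite /lapl linear_sum /=.
under eq_bigr => k _.
  rewrite mderiv_lsubst linear_sum /=.
  under eq_bigr do rewrite mderivZ mderiv_lsubst.
  over.
rewrite exchange_big; apply: eq_bigr => j _ /=.
exact: (orth_sum (fun i => lsubst B (mderiv i (mderiv j p)))).
Qed.

Lemma det2 (A : 'M[K]_2) : \det A = A 0 0 * A 1 1 - A 0 1 * A 1 0.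
Proof.
rewrite (expand_det_row _ ord0) !big_ord_recl big_ord0 /cofactor !det_mx11 !mxE /= addr0.
have -> : lift 0 0 = 1 :> 'I_2 by apply/val_inj.
have -> : lift 1 0 = 0 :> 'I_2 by apply/val_inj.
by rewrite addn0 expr0 expr1 mul1r mulN1r mulrN.
Qed.

(* On harmonic polynomials, minus the Casimir operator is [E ^ 2 + E], where
   [E] is the Euler field. *)
Lemma casimir p : lapl p = 0 ->
  \sum_i rot i (rot i p) = - (euler (euler p) + euler p).
Proof.
rewrite /lapl /euler /rot !(sum3 0) !(mderivM, mderivB, mderivD, mderiv_var).
set x0 := var 0; set x1 := var (0 + 1); set x2 := var (0 + 2).
rewrite !ord3E !ord3_eq !eqxx !(mulr0n, mulr1n).
rewrite (mderiv_comm (0 + 1) 0) (mderiv_comm (0 + 2) 0) (mderiv_comm (0 + 2) (0 + 1)).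
move=> /eqP; rewrite addrAC addr_eq0 => /eqP E.
set a := mderiv 0 (mderiv 0 p) in E *.
(* Harmonicity serves to eliminate one pure second derivative; what remains is a ring identity in
   the coordinates and the other derivatives. *)
have -> : a = - mderiv (0 + 1) (mderiv (0 + 1) p) - mderiv (0 + 2) (mderiv (0 + 2) p).
  by rewrite -E addrK.
ring.
Qed.

(** Stated coefficient by coefficient, so that it applies to harmonic polynomials that are not
    homogeneous. *)
Lemma mcoeff_casimir m p : lapl p = 0 ->
  mcoeff m (\sum_i rot i (rot i p)) = - (mdeg m * (mdeg m).+1)%:R * mcoeff m p.
Proof.
move=> /casimir ->; rewrite mcoeffN mcoeffD !mcoeff_euler natrM -[(mdeg m).+1]addn1 natrD.
ring.
Qed.

Section Rotation.
Variable B : 'M[K]_3.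
Hypotheses (BBt : B *m B^T = 1%:M) (detB : \det B = 1).

Lemma lsubst_mderiv j p :
  lsubst B (mderiv j p) = \sum_k B k j *: mderiv k (lsubst B p).
Proof.
under eq_bigr do rewrite mderiv_lsubst.
by rewrite (orth_sum (fun i => lsubst B (mderiv i p))) //; exact: mulmx1C.
Qed.

Lemma lsubst_rsqr : lsubst B rsqr = rsqr.
Proof.
rewrite /rsqr linear_sum /=.
transitivity (\sum_j \sum_i B^T j i *: (\sum_k B^T j k *: (var i * var k))).
  apply: eq_bigr => j _; rewrite rmorphXn /= lsubstX expr2 mulr_suml.
  apply: eq_bigr => i _; rewrite mxE -scalerAl mulr_sumr; congr (_ *: _).
  by apply: eq_bigr => k _; rewrite mxE -scalerAr.
rewrite exchange_big; apply: eq_bigr => i _ /=.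
by rewrite (orth_sum (fun k => var i * var k)) ?expr2 // trmxK.
Qed.

(** For orthogonal [B] of determinant 1 the adjugate is the transpose, so every entry equals its own
    cofactor. Hence cross products, and with them the fields [rot], transform as vectors under
    rotations; this is where the determinant enters. *)
Lemma rotation_minor k j :
  B (k + 1) (j + 1) * B (k + 2) (j + 2) - B (k + 1) (j + 2) * B (k + 2) (j + 1) =
  B k j.
Proof.
have Badj : B^T = \adj B.
  by rewrite -[LHS]mulmx1 -detB -mul_mx_adj mulmxA (mulmx1C BBt) mul1mx.
have -> : B k j = cofactor B k j by have /matrixP/(_ j k) := Badj; rewrite !mxE.
rewrite /cofactor det2 !mxE.
have l00 : lift 0 0 = 1 :> 'I_3 by apply/val_inj.
have l01 : lift 0 1 = 2 :> 'I_3 by apply/val_inj.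
have l10 : lift 1 0 = 0 :> 'I_3 by apply/val_inj.
have l11 : lift 1 1 = 2 :> 'I_3 by apply/val_inj.
have l20 : lift 2 0 = 0 :> 'I_3 by apply/val_inj.
have l21 : lift 2 1 = 1 :> 'I_3 by apply/val_inj.
have e12 : 1 + 2 = 0 :> 'I_3 by apply/val_inj.
have e21 : 2 + 1 = 0 :> 'I_3 by apply/val_inj.
have e22 : 2 + 2 = 1 :> 'I_3 by apply/val_inj.
have e11 : 1 + 1 = 2 :> 'I_3 by apply/val_inj.
have [->|->|->] := ord3_cases k; have [->|->|->] := ord3_cases j;
  rewrite !(l00, l01, l10, l11, l20, l21) ?add0r ?(e12, e21, e22, e11) /=; ring.
Qed.

Lemma lsubst_rot j p : lsubst B (rot j p) = \sum_k B k j *: rot k (lsubst B p).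
Proof.
rewrite /rot linearB !rmorphM /= !lsubstX !lsubst_mderiv.
transitivity (\sum_k \sum_i (B k (j + 1) * B i (j + 2) - B k (j + 2) * B i (j + 1)) *:
   (var k * mderiv i (lsubst B p))).
  rewrite !mulr_suml -sumrB; apply: eq_bigr => k _.
  rewrite !mulr_sumr -sumrB; apply: eq_bigr => i _.
  by rewrite -!scalerAl -!scalerAr !scalerA scalerBl.
rewrite !(sum3 0) -!(rotation_minor _ j) !ord3E !add0r -!mul_mpolyC.
rewrite !rmorphB !rmorphM /=; ring.
Qed.

End Rotation.
End Laplacian.

Section Harmonic.
Variable K : comNzRingType.
Local Notation var i := (mpolyX K (mnm1 i) : mpoly 3 K).

(* The harmonic part of [x_i p] when [p] is harmonic and homogeneous of
   degree [l] and [d] is the inverse of [2 l + 1]. *)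
Definition raise (d : K) i (p : mpoly 3 K) : mpoly 3 K :=
  var i * p - d *: (rsqr K * mderiv i p).

Lemma raise_linear d i : linear (raise d i).
Proof.
move=> c p q; rewrite /raise linearP /= !mulrDr -!scalerAr !scalerDr !scalerN !scalerA.
by rewrite [d * c]mulrC opprD addrACA.
Qed.
HB.instance Definition _ d i :=
  GRing.isLinear.Build K (mpoly 3 K) (mpoly 3 K) *:%R (raise d i) (raise_linear d i).

Lemma raise_homog l d i p :
  p \is ishomog1 l mdeg -> raise d i p \is ishomog1 l.+1 mdeg.
Proof.
move=> hp; apply: rpredB; first exact: dhomogM (var_homog _ _) hp.
apply: rpredZ; case: l hp => [|l] hp; first by rewrite (mderiv_homog0 _ hp) mulr0 rpred0.
exact: dhomogM (rsqr_homog _) (mderiv_homog _ hp).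
Qed.

(** The Laplacian of x_i p is 2 d_i p, and that of r^2 d_i p is (6 + 4 (l - 1)) d_i p = 2 (2 l + 1)
    d_i p. *)
Lemma lapl_raise l d i p : d * l.*2.+1%:R = 1 -> p \is ishomog1 l mdeg ->
  lapl p = 0 -> lapl (raise d i p) = 0.
Proof.
move=> dl hp hl; rewrite /raise linearB linearZ /= lapl_var lapl_rsqr lapl_mderiv hl.
rewrite linear0 !mulr0 !addr0.
have -> : euler (mderiv i p) = l%:R *: mderiv i p - mderiv i p.
  case: l {dl} hp => [|l] hp; first by rewrite (mderiv_homog0 _ hp) linear0 scaler0 subr0.
  rewrite (euler_homog (mderiv_homog i hp)) -[l.+1]addn1 natrD scalerDl scale1r.
  by rewrite addrK.
rewrite (_ : _ *+ 6 + _ = (l.*2.+1%:R *+ 2) *: mderiv i p).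
  by rewrite scalerA mulrnAr dl scaler_nat subrr.
have -> : l.*2.+1%:R *+ 2 = (l.*2.+1 * 2)%:R :> K by rewrite natrM mulr_natr.
rewrite !scaler_nat -[l.*2.+1]addn1 -mul2n; ring.
Qed.

Lemma lsubst_raise (B : 'M[K]_3) d j p : B *m B^T = 1%:M ->
  lsubst B (raise d j p) = \sum_k B k j *: raise d k (lsubst B p).
Proof.
move=> BBt; rewrite /raise linearB linearZ /= !rmorphM /= lsubstX lsubst_rsqr //.
rewrite lsubst_mderiv // mulr_suml mulr_sumr scaler_sumr -sumrB.
apply: eq_bigr => k _; rewrite scalerBr -scalerAl -scalerAr !scalerA.
by congr (_ - _); rewrite mulrC.
Qed.

End Harmonic.

Lemma map_rsqr (K A : comNzRingType) (f : {rmorphism K -> A}) :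
  map_mpoly f (rsqr K) = rsqr A.
Proof.
by rewrite /rsqr rmorph_sum; apply: eq_bigr => i _; rewrite rmorphXn /= map_mpolyX.
Qed.

Lemma map_raise (K A : comNzRingType) (f : {rmorphism K -> A}) d i (p : mpoly 3 K) :
  map_mpoly f (raise d i p) = raise (f d) i (map_mpoly f p).
Proof.
have fZ q : map_mpoly f (d *: q) = f d *: map_mpoly f q by exact: map_mpolyZ.
by rewrite /raise rmorphB /= fZ !rmorphM /= map_mpolyX map_rsqr map_mderiv.
Qed.

(** * Vanishing criterion for polynomials, and bases of spaces of bounded degree *)

Section Vanishing.

Lemma base_expansion_inj N n (f g : 'I_n -> nat) :
  (forall i, f i < N)%N -> (forall i, g i < N)%N ->
  (\sum_i f i * N ^ i = \sum_i g i * N ^ i)%N -> f =1 g.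
Proof.
elim: n f g => [|n IHn] f g fN gN; first by move=> _ [].
have N0 : (0 < N)%N by apply: leq_ltn_trans (fN 0).
rewrite !big_ord_recl !expn0 !muln1.
have E (h : 'I_n.+1 -> nat) : (\sum_(i < n) h (lift ord0 i) * N ^ lift ord0 i =
    N * \sum_(i < n) h (lift ord0 i) * N ^ i)%N.
  by rewrite big_distrr; apply: eq_bigr => i _ /=; rewrite /bump /= add1n expnS mulnCA.
rewrite !E ![(_ + N * _)%N]addnC ![(N * _)%N]mulnC => e.
have e0 : f ord0 = g ord0.
  by have := congr1 (modn^~ N) e; rewrite !modnMDl !modn_small.
have /IHn e1 : (\sum_(i < n) f (lift ord0 i) * N ^ i =
    \sum_(i < n) g (lift ord0 i) * N ^ i)%N.
  by move: e; rewrite e0 => /addIn /eqP; rewrite eqn_mul2r gtn_eqF //= => /eqP.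
move=> i; case: (unliftP ord0 i) => [j ->|-> //]; exact: e1.
Qed.

(* The substitution [x_i := t ^ (N ^ i)] maps distinct monomials of degree less
   than [N] to distinct powers of [t]. *)
Lemma mpoly_vanish (K : numDomainType) n (p : mpoly n K) :
  (forall k : 'I_n -> nat, meval (fun i => (k i).+1%:R) p = 0) -> p = 0.
Proof.
move=> p0; pose N := mmeasure mdeg p.
pose e (m : multinom n) := (\sum_i m i * N ^ i)%N.
pose q : {poly K} := \sum_(m <- msupp p) mcoeff m p *: 'X^(e m).
have q0 : q = 0.
  pose rs : seq K := [seq i.+1%:R | i <- iota 0 (size q)].
  apply: (@roots_geq_poly_eq0 _ _ rs); last by rewrite size_map size_iota.
    (* With this choice the coordinate of index i is (a + 1) ^ (N ^ i), a positive integer as the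
       hypothesis demands. *)
    apply/allP => _ /mapP[a _ ->]; apply/rootP; rewrite -(p0 (fun i => (a.+1 ^ N ^ i).-1)).
    rewrite horner_sum mevalE; apply: eq_bigr => m _.
    rewrite hornerZ hornerXn; congr (_ * _).
    rewrite -natrX expn_sum natr_prod; apply: eq_bigr => i _.
    by rewrite prednK ?expn_gt0 // -natrX mulnC expnM.
  rewrite map_inj_uniq ?iota_uniq // => i j /eqP.
  by rewrite eqr_nat eqSS => /eqP.
apply/mpolyP => m0; rewrite mcoeff0; case: (boolP (m0 \in msupp p)) => m0p; last first.
  by apply/eqP; rewrite mcoeff_eq0.
have : q`_(e m0) = 0 by rewrite q0 coef0.
rewrite /q coef_sum (bigD1_seq m0) ?msupp_uniq //= coefZ coefXn eqxx mulr1.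
rewrite big_seq_cond big1 ?addr0 // => m /andP[mp mm0].
rewrite coefZ coefXn; case: eqP => [em|]; last by rewrite mulr0.
have lN m' : m' \in msupp p -> forall i, (m' i < N)%N.
  move=> /(mmeasure_mnm_lt mdeg) /= m'N i; apply: leq_ltn_trans m'N.
  by rewrite mdegE (bigD1 i) //= leq_addr.
case/eqP: mm0; apply/mnmP => i; apply/esym.
exact: base_expansion_inj (lN _ m0p) (lN _ mp) em i.
Qed.

End Vanishing.

Section DualBasis.
Variables (K : fieldType) (n N : nat).

Lemma bounded_mpolyE (p : mpoly n K) : (mmeasure mdeg p <= N)%N ->
  p = \sum_(m : bmultinom n N) mcoeff m p *: mpolyX K m.
Proof. exact: mpolywE. Qed.

Let q := #|{: bmultinom n N}|.
Let coords (p : mpoly n K) : 'rV[K]_q := \row_j mcoeff (enum_val j : bmultinom n N) p.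

(** A maximal independent family inside [S] spans [S], and its members stay in [S]. The dual
    functionals [w] are written through monomial coefficients so that they can also be applied to
    polynomials over C[lambda]. *)
Lemma dual_basis (S : mpoly n K -> Prop) :
  (forall p, S p -> mmeasure mdeg p <= N)%N ->
  exists k (h : 'I_k -> mpoly n K) (w : 'I_k -> bmultinom n N -> K),
  [/\ forall i, S (h i),
      forall i j, \sum_m w i m * mcoeff m (h j) = (i == j)%:R
    & forall p, S p -> p = \sum_i (\sum_m w i m * mcoeff m p) *: h i].
Proof.
move=> SN.
pose P k := `[< exists h : 'I_k -> mpoly n K, (forall i, S (h i)) /\
  row_free (\matrix_i coords (h i)) >].
have P0 : exists k, P k.
  exists 0%N; apply/asboolP; exists (fun=> 0); split; first by case.
  by rewrite /row_free -leqn0 rank_leq_row.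
have Pq k : P k -> (k <= q)%N.
  by move=> /asboolP[h [_ /eqP <-]]; exact: rank_leq_col.
case: (ex_maxnP P0 Pq) => k /asboolP[h [Sh hfree]] kmax.
set A := (\matrix_i coords (h i)) in hfree.
(* Otherwise adding [p] to the family would contradict its maximality. *)
have SA p : S p -> (coords p <= A)%MS.
  move=> Sp; apply/negPn/negP => pA.
  suff : P k.+1 by move/kmax; rewrite ltnn.
  apply/asboolP; exists (fun i => if unlift ord0 i is Some j then h j else p).
  split=> [i|]; first by case: unliftP.
  rewrite (_ : \matrix_i _ = col_mx (coords p) A); last first.
    apply/row_matrixP => i; rewrite rowK; case: (split_ordP i) => j ->.
      rewrite rowKu row_id (_ : lshift k j = ord0) ?unlift_none //.
      by apply/val_inj; case: j => -[].
    by rewrite rowKd rowK (_ : rshift 1 j = lift ord0 j) ?liftK //; apply/val_inj.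
  rewrite /row_free eqn_leq rank_leq_row /=.
  suff : (\rank A < \rank (col_mx (coords p) A))%N by rewrite (eqP hfree).
  apply: rank_ltmx.
  by rewrite ltmxE -!addsmxE addsmxSr addsmx_sub (negPf pA).
(* The rows of [A] are independent, so [W] is a right inverse of [A] and reads off the coordinates
   with respect to [h]. *)
pose W := pinvmx A.
exists k, h, (fun i m => W (enum_rank m) i).
have WE i p : \sum_m W (enum_rank m) i * mcoeff m p = (coords p *m W) 0 i.
  rewrite mxE (reindex_onto (@enum_val _ _) enum_rank) /=; last by move=> m _; rewrite enum_rankK.
  apply: eq_big => [j|j _].
    by rewrite enum_valK eqxx.
  by rewrite [coords p 0 j]mxE enum_valK mulrC.
split=> // [i j|p Sp].
  rewrite WE.
  have -> : coords (h j) = row j A by rewrite rowK.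
  by rewrite -row_mul mulmxVp // row1 mxE eqxx.
under eq_bigr do rewrite WE.
rewrite {1}(bounded_mpolyE (SN _ Sp)).
have pE : coords p = coords p *m W *m A by rewrite mulmxKpV // SA.
have hE i : h i = \sum_(m : bmultinom n N) A i (enum_rank m) *: mpolyX K m.
  rewrite {1}(bounded_mpolyE (SN _ (Sh i))); apply: eq_bigr => m _.
  by rewrite !mxE enum_rankK.
under [RHS]eq_bigr do rewrite hE scaler_sumr.
rewrite exchange_big; apply: eq_bigr => m _ /=.
under eq_bigr do rewrite scalerA.
rewrite -scaler_suml; congr (_ *: _).
have := congr1 (fun v : 'rV_q => v 0 (enum_rank m)) pE.
by rewrite !mxE enum_rankK.
Qed.

End DualBasis.

(** * Derivatives at the identity of the orthogonal group *)

Section Infinitesimal.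
Variable K : numFieldType.

Lemma poly_vanish (q : {poly K}) : (forall t, q.[t] = 0) -> q = 0.
Proof.
move=> q0; pose rs : seq K := [seq i%:R | i <- iota 0 (size q)].
apply: (@roots_geq_poly_eq0 _ _ rs); last by rewrite size_map size_iota.
  by apply/allP => x _; apply/rootP.
by rewrite map_inj_uniq ?iota_uniq // => i j /eqP; rewrite eqr_nat => /eqP.
Qed.

Lemma horner_mmap n (W : 'I_n -> {poly K}) c t :
  (mmap polyC W c).[t] = meval (fun i => (W i).[t]) c.
Proof.
elim/mpoly_gen_ind: c => [c|i|p q IHp IHq|p q IHp IHq].
- by rewrite mmapC mevalC hornerC.
- by rewrite mmapX mmap1U mevalXU.
- by rewrite mmapD hornerD IHp IHq mevalD.
by rewrite rmorphM /= hornerM IHp IHq mevalM.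
Qed.

Lemma deriv_mmap n (W : 'I_n -> {poly K}) c t :
  (mmap polyC W c)^`().[t] =
  \sum_i meval (fun i => (W i).[t]) (mderiv i c) * (W i)^`().[t].
Proof.
rewrite (@mmap_chain _ _ _ polyC W (@deriv K)).
- by rewrite horner_sum; apply: eq_bigr => i _; rewrite hornerM horner_mmap.
- exact: derivD.
- exact: derivM.
exact: derivC.
Qed.

(** The exponential of t xi, exact when the cube of xi vanishes. *)
Definition mxexp (xi : 'M[K]_3) (t : K) : 'M[K]_3 :=
  1%:M + t *: xi + (t ^+ 2 / 2) *: (xi *m xi).

Lemma antisym_diag (xi : 'M[K]_3) i : xi^T = - xi -> xi i i = 0.
Proof.
move=> /matrixP/(_ i i) /eqP; rewrite !mxE -addr_eq0 -mulr2n mulrn_eq0 => /eqP.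
exact.
Qed.

Section Nilpotent.
Variable xi : 'M[K]_3.
Hypotheses (xiT : xi^T = - xi) (xi3 : xi *m xi *m xi = 0).

Lemma mxexp_tr t : (mxexp xi t)^T = mxexp xi (- t).
Proof.
rewrite /mxexp 2!linearD 2!linearZ /= trmx1 trmx_mul xiT.
by rewrite mulmxN mulNmx opprK scalerN scaleNr sqrrN.
Qed.

Lemma mxexpD s t : mxexp xi s *m mxexp xi t = mxexp xi (s + t).
Proof.
rewrite /mxexp; set a := xi *m xi.
have xa : xi *m a = 0 by rewrite /a mulmxA.
have ax : a *m xi = 0 by [].
have aa : a *m a = 0 by rewrite {2}/a mulmxA ax mul0mx.
rewrite !(mulmxDl, mulmxDr, mul1mx, mulmx1) -!scalemxAl -!scalemxAr -/a ax xa aa.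
by rewrite !scaler0 !addr0; apply/matrixP => i j; rewrite !mxE; field.
Qed.

Lemma mxexp_orthogonal t : mxexp xi t *m (mxexp xi t)^T = 1%:M.
Proof.
rewrite mxexp_tr mxexpD subrr /mxexp scale0r expr2 !mul0r scale0r.
by rewrite !addr0.
Qed.

(** Halving t exhibits the matrix as a square of an orthogonal matrix, whose determinant squares to
    1. *)
Lemma det_mxexp t : \det (mxexp xi t) = 1.
Proof.
rewrite [t]splitr -mxexpD det_mulmx; have := mxexp_orthogonal (t / 2).
by move=> /(congr1 determinant); rewrite det_mulmx det_tr det1.
Qed.

(** The curve [mxexp xi] with t replaced by an indeterminate, so that it can be differentiated
    formally. *)
Definition mxcurve : 'M[{poly K}]_3 := 1%:M + 'X *: map_mx polyC xi +
  ((2^-1)%:P * 'X ^+ 2) *: map_mx polyC (xi *m xi).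

Lemma horner_mxcurve t i j : (mxcurve i j).[t] = mxexp xi t i j.
Proof.
rewrite /mxcurve /mxexp; set a := xi *m xi; rewrite !mxE !hornerE /=.
have -> : ((i == j)%:R : {poly K}).[t] = (i == j)%:R by case: (i == j); rewrite hornerE.
by field.
Qed.

Lemma deriv_mxcurve i j : (mxcurve i j)^`().[0] = xi i j.
Proof.
rewrite !mxE !(derivD, derivM, derivC, derivX, derivXn) !hornerE /=.
by case: (i == j); rewrite !(derivC, hornerC) /= ?mulr0n ?hornerE; ring.
Qed.

(** Both sides of the hypothesis are polynomial in t. As they agree for all t they agree formally,
    and the conclusion compares their derivatives at 0 by the chain rule. *)
Lemma deriv_lsubst_mxexp (p : mpoly 3 K) (y : 'I_3 -> K) n (b : 'I_n -> K)
    (c : 'I_n -> mpoly (3 * 3) K) :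
  (forall t, meval y (lsubst (mxexp xi t) p) =
     \sum_i meval (mxvec (mxexp xi t) 0) (c i) * b i) ->
  - \sum_i xi (i + 2) (i + 1) * meval y (rot i p) =
  \sum_i (\sum_k mxvec xi 0 k * meval (mxvec (1%:M : 'M[K]_3) 0) (mderiv k (c i))) * b i.
Proof.
move=> E.
pose Wl j : {poly K} := \sum_i mxcurve i j * (y i)%:P.
pose Wr k : {poly K} := mxvec mxcurve 0 k.
have WlE t j : (Wl j).[t] = \sum_i mxexp xi t i j * y i.
  by rewrite horner_sum; apply: eq_bigr => i _; rewrite hornerM hornerC horner_mxcurve.
have WrE t k : (Wr k).[t] = mxvec (mxexp xi t) 0 k.
  by case/mxvec_indexP: k => i j; rewrite /Wr !mxvecE horner_mxcurve.
have e0 : mxexp xi 0 = 1%:M by rewrite /mxexp scale0r expr2 !mul0r scale0r !addr0.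
have {E} : (mmap polyC Wl p - \sum_i mmap polyC Wr (c i) * (b i)%:P)^`().[0] = 0.
  rewrite (_ : _ - _ = 0) ?deriv0 ?horner0 //; apply: poly_vanish => t.
  rewrite hornerD hornerN horner_mmap horner_sum.
  rewrite (meval_eq (v2 := fun j => \sum_i mxexp xi t i j * y i)) //.
  rewrite -meval_lsubst E; apply/eqP; rewrite subr_eq0; apply/eqP/eq_bigr => i _.
  rewrite hornerM hornerC horner_mmap; congr (_ * _).
  by apply: meval_eq => k; rewrite WrE.
rewrite derivB hornerD hornerN deriv_mmap => /eqP; rewrite subr_eq0 => /eqP E.
have -> : \sum_i (\sum_k mxvec xi 0 k *
    meval (mxvec (1%:M : 'M[K]_3) 0) (mderiv k (c i))) * b i =
    (\sum_i mmap polyC Wr (c i) * (b i)%:P)^`().[0].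
  rewrite (raddf_sum (@deriv K)) horner_sum; apply: eq_bigr => i _ /=.
  rewrite derivM derivC mulr0 addr0 hornerM hornerC deriv_mmap; congr (_ * _).
  apply: eq_bigr => k _; rewrite mulrC; congr (_ * _).
    by apply: meval_eq => k'; rewrite WrE e0.
  by case/mxvec_indexP: k => i' j'; rewrite /Wr !mxvecE deriv_mxcurve.
rewrite -{}E.
have WlD j : (Wl j)^`().[0] = \sum_i xi i j * y i.
  rewrite (raddf_sum (@deriv K)) horner_sum; apply: eq_bigr => i _ /=.
  by rewrite derivM derivC mulr0 addr0 hornerM hornerC deriv_mxcurve.
under [RHS]eq_bigr => j _.
  rewrite WlD (meval_eq (v2 := y)); last first.
    move=> k; rewrite WlE e0 (bigD1 k) //= big1 ?addr0 => [|i ik].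
      by rewrite mxE eqxx mul1r.
    by rewrite mxE (negPf ik) mul0r.
  over.
rewrite !(sum3 0) /rot !(mevalB, mevalM, mevalXU) !ord3E.
have xiN i j : xi i j = - xi j i by have /matrixP/(_ j i) := xiT; rewrite !mxE.
have xi0 i := antisym_diag i xiT.
rewrite !xi0 (xiN 0 (0 + 1)) (xiN 0 (0 + 2)) (xiN (0 + 1) (0 + 2)); ring.
Qed.

End Nilpotent.

Definition rot_gen (i : 'I_3) : 'M[K]_3 :=
  delta_mx (i + 2) (i + 1) - delta_mx (i + 1) (i + 2).

Lemma antisym_rot_gen (xi : 'M[K]_3) : xi^T = - xi ->
  xi = \sum_i xi (i + 2) (i + 1) *: rot_gen i.
Proof.
move=> xiT.
have xiN i j : xi i j = - xi j i by have /matrixP/(_ j i) := xiT; rewrite !mxE.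
have xi0 i := antisym_diag i xiT.
apply/matrixP => i j; rewrite summxE (sum3 i) !mxE !ord3E !eqxx !ord3_eq /=.
have [->|->|->] : [\/ j = i, j = i + 1 | j = i + 2].
- have [->|->|->] := ord3_cases i; have [->|->|->] := ord3_cases j;
    by [constructor 1 | constructor 2; apply/val_inj | constructor 3; apply/val_inj].
- by rewrite !ord3_eq xi0 /=; ring.
- by rewrite !ord3_eq !eqxx xiN /=; ring.
by rewrite !ord3_eq !eqxx /=; ring.
Qed.

Lemma rot_gen_tr i : (rot_gen i)^T = - rot_gen i.
Proof. by rewrite /rot_gen linearB /= !trmx_delta opprB. Qed.

(* If [s ^ 2 = -1], then [rot_gen i + s *: rot_gen (i + 1)] is nilpotent, its
   axis being an isotropic vector. *)
Lemma rot_gen_nilpotent (s : K) i : s ^+ 2 = -1 ->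
  let xi := rot_gen i + s *: rot_gen (i + 1) in xi *m xi *m xi = 0.
Proof.
move=> s2 xi.
have mulZl k (A B : 'M[K]_3) : (k *: A) *m B = k *: (A *m B) by rewrite scalemxAl.
have mulZr k (A B : 'M[K]_3) : A *m (k *: B) = k *: (A *m B) by rewrite scalemxAr.
pose mxr := (mulmxDl, mulmxDr, mulmxN, mulNmx, mulZl, mulZr).
have -> : xi *m xi = - delta_mx (i + 1) (i + 1) +
    s *: (delta_mx (i + 1) i + delta_mx i (i + 1)) + delta_mx i i.
  rewrite /xi /rot_gen !ord3E !mxr !mul_delta_mx_cond !ord3_eq !eqxx !(mulr0n, mulr1n).
  by apply/matrixP => k l; rewrite !mxE; ring: s2.
rewrite /xi /rot_gen !ord3E !mxr !mul_delta_mx_cond !ord3_eq !eqxx !(mulr0n, mulr1n).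
by apply/matrixP => k l; rewrite !mxE; ring: s2.
Qed.

(** The nilpotent matrices [t *: rot_gen (i + 1) + rot_gen i] for t = s and t = - s add up to twice
    [rot_gen i]; hence nilpotent antisymmetric matrices span so(3). *)
Lemma linear_so3_ind (s : K) (V : lmodType K) (Z : 'M[K]_3 -> V) : s ^+ 2 = -1 ->
  linear Z ->
  (forall xi, xi^T = - xi -> xi *m xi *m xi = 0 -> Z xi = 0) ->
  forall xi, xi^T = - xi -> Z xi = 0.
Proof.
move=> s2 Zlin Z0 xi /antisym_rot_gen ->.
have Z00 : Z 0 = 0 by apply: Z0; rewrite ?trmx0 ?oppr0 // !mul0mx.
apply: (big_ind (fun xi => Z xi = 0)) => [//|x y Zx Zy|i _].
  by rewrite -[x]scale1r Zlin Zx Zy scaler0 addr0.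
rewrite -[_ *: _]addr0 Zlin Z00 addr0.
suff -> : Z (rot_gen i) = 0 by rewrite scaler0.
have Zs t : t ^+ 2 = -1 -> Z (t *: rot_gen (i + 1) + rot_gen i) = 0.
  move=> t2; apply: Z0; last by rewrite addrC; exact: rot_gen_nilpotent.
  by rewrite linearD linearZ /= !rot_gen_tr scalerN -opprD.
have := Zs s s2; have := Zs (- s); rewrite sqrrN => /(_ s2); rewrite !Zlin scaleNr.
move=> /eqP; rewrite addrC subr_eq0 => /eqP e1 /eqP; rewrite -e1 -mulr2n -scaler_nat.
by rewrite scaler_eq0 pnatr_eq0 /= => /eqP.
Qed.

End Infinitesimal.

(** * Radial functions *)

Section EntireSeries.
Variable R : realType.
Implicit Types (a b : nat -> R) (x : R).

Definition entire a := forall x, cvgn (pseries a x).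
Definition psum a x : R := limn (pseries a x).

Lemma psum_cvg a x : entire a -> pseries a x @ \oo --> psum a x.
Proof. by move=> /(_ x). Qed.

Lemma pseries_shift a x n :
  pseries a x n.+1 = a 0%N + x * pseries (fun i => a i.+1) x n.
Proof.
rewrite /pseries /series /= big_nat_recl // expr0 mulr1 mulr_sumr; congr (_ + _).
by apply: eq_bigr => i _; rewrite exprS mulrCA.
Qed.

Lemma entire_tail a : entire a -> entire (fun i => a i.+1).
Proof.
move=> ea x; have [->|x0] := eqVneq x 0.
  apply/cvg_ex; exists (a 1%N); rewrite -cvg_shiftS.
  apply: cvg_near_cst; apply: nearW => n.
  by rewrite /= pseries_shift mul0r addr0.
have : (fun n => x^-1 * (pseries a x n.+1 - a 0%N)) @ \oo -->
    x^-1 * (psum a x - a 0%N).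
  apply: cvgMr; apply: cvgB; last exact: cvg_cst.
  by rewrite cvg_shiftS; exact: psum_cvg.
move=> c; apply/cvg_ex; exists (x^-1 * (psum a x - a 0%N)).
apply: cvg_trans c; apply: near_eq_cvg; apply: nearW => n.
by rewrite pseries_shift addrC addKr mulKf.
Qed.

Lemma entire_diffs a : entire a -> entire (pseries_diffs a).
Proof.
(* This [r] gives (i + 1) |x| ^ i <= r ^ (i + 1), because i + 1 <= 2 ^ (i + 1) and |x| ^ i <= (|x| +
   1) ^ (i + 1). The series of derivatives is thus dominated by the series of [a] at [r]. *)
move=> ea x; pose r := 2 * (`|x| + 1).
have r0 : 0 < r by rewrite mulr_gt0 // ltr_wpDl.
have ca : cvgn (pseries (fun i => `|a i.+1|) r).
  have h : `|r| < `|r + 1| by rewrite !gtr0_norm ?addr_gt0 // ltrDl.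
  exact: (is_cvg_pseries_inside_norm (@entire_tail a ea (r + 1)) h).
apply: normed_cvg; apply: (@series_le_cvg _ _ (fun i => r * (`|a i.+1| * r ^+ i))) => [i|i|i|].
- exact: normr_ge0.
- by rewrite !mulr_ge0 ?exprn_ge0 // ltW.
- rewrite /= /pseries_diffs !normrM -mulrA mulrCA [leRHS]mulrCA ler_wpM2l // normr_nat normrX.
  rewrite -exprS exprMn; apply: ler_pM => //.
    by rewrite -natrX ler_nat ltnW // ltn_expl.
  apply: (@le_trans _ _ ((`|x| + 1) ^+ i)).
    by rewrite lerXn2r ?nnegrE // lerDl.
  by rewrite exprS ler_peMl ?exprn_ge0 ?addr_ge0 // lerDr.
have -> : series (fun i => r * (`|a i.+1| * r ^+ i)) =
    (fun n => r * pseries (fun i => `|a i.+1|) r n).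
  by apply/funext => n; rewrite /pseries /series /= mulr_sumr.
by apply: is_cvgMr.
Qed.

Lemma psum_is_derive a x : entire a -> is_derive x 1 (psum a) (psum (pseries_diffs a) x).
Proof.
move=> ea; apply: (@pseries_snd_diffs _ a (`|x| + 1)).
- exact: ea.
- exact: entire_diffs.
- exact/entire_diffs/entire_diffs.
by rewrite [ltRHS]ger0_norm ?addr_ge0 // ltrDl.
Qed.

Lemma psum_tail a x : entire a -> psum a x = a 0%N + x * psum (fun i => a i.+1) x.
Proof.
move=> ea; apply: (cvg_lim (@Rhausdorff R)); rewrite -cvg_shiftS.
have -> : [sequence pseries a x n.+1]_n = (fun n => a 0%N + x * pseries (fun i => a i.+1) x n).
  by apply/funext => n; exact: pseries_shift.
apply: cvgD; first exact: cvg_cst.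
by apply: cvgMr; exact/psum_cvg/entire_tail.
Qed.

Lemma entire_of_tail a : entire (fun i => a i.+1) -> entire a.
Proof.
move=> ea x; apply/cvg_ex; exists (a 0%N + x * psum (fun i => a i.+1) x).
rewrite -cvg_shiftS.
have -> : [sequence pseries a x n.+1]_n = (fun n => a 0%N + x * pseries (fun i => a i.+1) x n).
  by apply/funext => n; exact: pseries_shift.
apply: cvgD; first exact: cvg_cst.
by apply: cvgMr; exact/psum_cvg.
Qed.

Lemma psum_lin_cvg c d a b x : entire a -> entire b ->
  pseries (fun n => c * a n + d * b n) x @ \oo --> c * psum a x + d * psum b x.
Proof.
move=> ea eb.
have -> : pseries (fun n => c * a n + d * b n) x =
    (fun n => c * pseries a x n + d * pseries b x n).
  apply/funext => n; rewrite /pseries /series /= !mulr_sumr -big_split.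
  by apply: eq_bigr => i _ /=; rewrite mulrDl !mulrA.
by apply: cvgD; apply: cvgMr; exact: psum_cvg.
Qed.

Lemma entire_lin c d a b : entire a -> entire b -> entire (fun n => c * a n + d * b n).
Proof. by move=> ea eb x; apply/cvg_ex; eexists; exact: psum_lin_cvg. Qed.

Lemma psum_lin c d a b x : entire a -> entire b ->
  psum (fun n => c * a n + d * b n) x = c * psum a x + d * psum b x.
Proof. by move=> ea eb; apply: (cvg_lim (@Rhausdorff R)); exact: psum_lin_cvg. Qed.

Lemma entire0 : entire (fun=> 0).
Proof.
move=> x; apply/cvg_ex; exists 0; apply: cvg_near_cst; apply: nearW => n.
by rewrite /pseries /series /= big1 // => i _; rewrite mul0r.
Qed.

Lemma psum_continuous a : entire a -> continuous (psum a).
Proof.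
move=> ea x; apply: differentiable_continuous; apply/derivable1_diffP.
by have [] := psum_is_derive x ea.
Qed.

Lemma psum_eq00 a : entire a -> (forall x, 0 < x -> psum a x = 0) -> a 0%N = 0.
Proof.
move=> ea a0; have pa0 : psum a 0 = a 0%N by rewrite psum_tail // mul0r addr0.
rewrite -pa0.
have c1 : psum a x @[x --> 0^'+] --> psum a 0.
  by apply: cvg_at_right_filter; exact: psum_continuous.
have c2 : psum a x @[x --> 0^'+] --> (0 : R).
  apply: cvg_near_cst; near=> x; apply: a0; near: x; exact: nbhs_right_gt.
exact: (cvg_unique _ c1 c2).
Unshelve. all: by end_near.
Qed.

(** The constant term vanishes by continuity at 0 from the right; dividing the rest by x leaves a
    series of the same kind. *)
Lemma psum_eq0 a : entire a -> (forall x, 0 < x -> psum a x = 0) -> forall n, a n = 0.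
Proof.
move=> ea a0 n; elim: n a ea a0 => [|n IHn] a ea a0; last first.
  apply: (IHn (fun i => a i.+1)); first exact: entire_tail.
  move=> x x0; have := a0 x x0; rewrite psum_tail // (psum_eq00 ea a0) add0r => /eqP.
  by rewrite mulf_eq0 gt_eqF //= => /eqP.
exact: psum_eq00.
Qed.

End EntireSeries.

Section ComplexSeries.
Variable R : realType.
Local Notation C := R[i].
Implicit Types (a b : nat -> C) (x : R).

(** Complex coefficients but a real variable: the radius is real, so two real power series carry all
    the information needed. *)
Definition centire a :=
  entire (fun n => complex.Re (a n)) /\ entire (fun n => complex.Im (a n)).
Definition csum a x : C :=
  (psum (fun n => complex.Re (a n)) x +i* psum (fun n => complex.Im (a n)) x)%C.
Definition cdiffs a n : C := n.+1%:R * a n.+1.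

Lemma complexE2 (z w : C) :
  complex.Re z = complex.Re w -> complex.Im z = complex.Im w -> z = w.
Proof. by case: z w => ? ? [? ?] /= -> ->. Qed.

Lemma ReRM (r : R) (z : C) : complex.Re (r%:C%C * z) = r * complex.Re z.
Proof. by case: z => u v /=; rewrite mul0r subr0. Qed.
Lemma ImRM (r : R) (z : C) : complex.Im (r%:C%C * z) = r * complex.Im z.
Proof. by case: z => u v /=; rewrite mul0r addr0. Qed.
Lemma natC n : n%:R = (n%:R : R)%:C%C :> C.
Proof. by rewrite rmorph_nat. Qed.

Lemma Re_cdiffs a :
  (fun n => complex.Re (cdiffs a n)) = pseries_diffs (fun n => complex.Re (a n)).
Proof. by apply/funext => n; rewrite /cdiffs natC ReRM. Qed.
Lemma Im_cdiffs a :
  (fun n => complex.Im (cdiffs a n)) = pseries_diffs (fun n => complex.Im (a n)).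
Proof. by apply/funext => n; rewrite /cdiffs natC ImRM. Qed.

Lemma centire_diffs a : centire a -> centire (cdiffs a).
Proof. by move=> [ra ia]; rewrite /centire Re_cdiffs Im_cdiffs; split; exact: entire_diffs. Qed.

Lemma csum_is_derive_Re a x : centire a ->
  is_derive x 1 (fun r => complex.Re (csum a r)) (complex.Re (csum (cdiffs a) x)).
Proof. by move=> [ra _] /=; rewrite Re_cdiffs; exact: psum_is_derive. Qed.
Lemma csum_is_derive_Im a x : centire a ->
  is_derive x 1 (fun r => complex.Im (csum a r)) (complex.Im (csum (cdiffs a) x)).
Proof. by move=> [_ ia] /=; rewrite Im_cdiffs; exact: psum_is_derive. Qed.

Lemma csum_tail a x : centire a ->
  csum a x = a 0%N + x%:C%C * csum (fun n => a n.+1) x.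
Proof.
move=> [ra ia]; apply: complexE2.
  by rewrite Defs.ReD ReRM /= psum_tail.
by rewrite Defs.ImD ImRM /= psum_tail.
Qed.

Lemma centire_tail a : centire a -> centire (fun n => a n.+1).
Proof. by move=> [ra ia]; split; [exact: (entire_tail ra) | exact: (entire_tail ia)]. Qed.

Lemma centire_of_tail a : centire (fun n => a n.+1) -> centire a.
Proof. by move=> [ra ia]; split; [exact: entire_of_tail ra | exact: entire_of_tail ia]. Qed.

Lemma centire0 : centire (fun=> 0).
Proof. by split; exact: entire0. Qed.

Lemma csum0 x : csum (fun=> 0) x = 0.
Proof.
have p0 : psum (fun=> 0 : R) x = 0.
  have := @psum_lin R 0 0 _ _ x (@entire0 R) (@entire0 R); rewrite !mul0r addr0 => {2}<-.
  by congr psum; apply/funext => n; rewrite mul0r addr0.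
by apply: complexE2; rewrite /= p0.
Qed.

Lemma entireD (a b : nat -> R) : entire a -> entire b -> entire (fun n => a n + b n).
Proof.
move=> ea eb; have := entire_lin (c:=1) (d:=1) ea eb.
by congr entire; apply/funext => n; rewrite !mul1r.
Qed.

Lemma psumD (a b : nat -> R) x : entire a -> entire b ->
  psum (fun n => a n + b n) x = psum a x + psum b x.
Proof.
move=> ea eb; have := psum_lin 1 1 x ea eb; rewrite !mul1r => <-.
by congr psum; apply/funext => n; rewrite !mul1r.
Qed.

Lemma centireD a b : centire a -> centire b -> centire (fun n => a n + b n).
Proof.
move=> [ra ia] [rb ib]; split.
  by under eq_fun do rewrite Defs.ReD; exact: entireD.
by under eq_fun do rewrite Defs.ImD; exact: entireD.
Qed.

Lemma csumD a b x : centire a -> centire b ->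
  csum (fun n => a n + b n) x = csum a x + csum b x.
Proof.
move=> [ra ia] [rb ib]; apply: complexE2; rewrite /csum ?Defs.ReD ?Defs.ImD /=.
  by under eq_fun do rewrite Defs.ReD; rewrite psumD.
by under eq_fun do rewrite Defs.ImD; rewrite psumD.
Qed.

Lemma centireZ (c : C) a : centire a -> centire (fun n => c * a n).
Proof.
move=> [ra ia]; split.
  under eq_fun do rewrite Defs.ReM -mulNr; exact: entire_lin.
under eq_fun do rewrite Defs.ImM; exact: entire_lin.
Qed.

Lemma csumZ (c : C) a x : centire a -> csum (fun n => c * a n) x = c * csum a x.
Proof.
move=> [ra ia]; apply: complexE2; rewrite /csum ?Defs.ReM ?Defs.ImM /=.
  by under eq_fun do rewrite Defs.ReM -mulNr; rewrite psum_lin // mulNr.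
by under eq_fun do rewrite Defs.ImM; rewrite psum_lin.
Qed.

Lemma csum_eq0 a : centire a -> (forall x, 0 < x -> csum a x = 0) -> forall n, a n = 0.
Proof.
move=> [ra ia] a0 n; apply: complexE2.
  by apply: (psum_eq0 ra) => x /a0 [].
by apply: (psum_eq0 ia) => x /a0 [].
Qed.

Lemma centire_sum (I : Type) (s : seq I) (a : I -> nat -> C) :
  (forall i, centire (a i)) -> centire (fun n => \sum_(i <- s) a i n).
Proof.
move=> ea; elim: s => [|i s IHs].
  by under eq_fun do rewrite big_nil; exact: centire0.
by under eq_fun do rewrite big_cons; exact: centireD.
Qed.

Lemma csum_sum (I : Type) (s : seq I) (a : I -> nat -> C) x :
  (forall i, centire (a i)) ->
  csum (fun n => \sum_(i <- s) a i n) x = \sum_(i <- s) csum (a i) x.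
Proof.
move=> ea; elim: s => [|i s IHs].
  by under eq_fun do rewrite big_nil; rewrite big_nil csum0.
under eq_fun do rewrite big_cons; rewrite csumD ?big_cons ?IHs //.
exact: centire_sum.
Qed.

Lemma Re_scale (r x : R) a :
  pseries (fun n => complex.Re (r%:C%C ^+ n * a n)) x =
  pseries (fun n => complex.Re (a n)) (r * x).
Proof.
apply/funext => n; apply: eq_bigr => i _ /=.
by rewrite -rmorphXn ReRM exprMn; ring.
Qed.

Lemma Im_scale (r x : R) a :
  pseries (fun n => complex.Im (r%:C%C ^+ n * a n)) x =
  pseries (fun n => complex.Im (a n)) (r * x).
Proof.
apply/funext => n; apply: eq_bigr => i _ /=.
by rewrite -rmorphXn ImRM exprMn; ring.
Qed.

Lemma centire_scale (r : R) a : centire a -> centire (fun n => r%:C%C ^+ n * a n).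
Proof.
by move=> [ra ia]; split=> x; [rewrite Re_scale; exact: (ra _) | rewrite Im_scale; exact: (ia _)].
Qed.

Lemma csum_scale (r x : R) a : csum (fun n => r%:C%C ^+ n * a n) x = csum a (r * x).
Proof. by rewrite /csum /psum Re_scale Im_scale. Qed.

Lemma ReIm_le_norm (z : C) (e : R) : `|z| < e%:C%C ->
  `|complex.Re z| < e /\ `|complex.Im z| < e.
Proof.
case: z => u v; rewrite normc_def /= ltcR => uve.
by split; apply: le_lt_trans uve; rewrite -sqrtr_sqr ler_wsqrtr //= ?lerDl ?lerDr ?sqr_ge0.
Qed.

(* The topology of [R[i]] as a numeric field is the one of the modulus. *)
Lemma cvg_ReIm (u : nat -> (C : numFieldType)) (l : (C : numFieldType)) :
  u @ \oo --> l -> (fun n => complex.Re (u n)) @ \oo --> complex.Re l /\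
                   (fun n => complex.Im (u n)) @ \oo --> complex.Im l.
Proof.
move=> ul.
have E (e : R) : 0 < e -> \forall n \near \oo, `|l - u n| < e%:C%C.
  by move=> e0; move/cvgrPdist_lt: ul; apply; rewrite ltcR.
by split; apply/cvgrPdist_lt => e /E; apply: filterS => n /ReIm_le_norm []; rewrite !raddfB.
Qed.

Lemma series_ReIm (a : nat -> C) (x : R) n :
  series (fun n => a n * x%:C%C ^+ n) n =
  (pseries (fun n => complex.Re (a n)) x n +i* pseries (fun n => complex.Im (a n)) x n)%C.
Proof.
rewrite /pseries /series /=; elim: n => [|n IHn]; first by rewrite !big_geq.
rewrite !big_nat_recr //= IHn; apply: complexE2.
  by rewrite Defs.ReD -rmorphXn mulrC ReRM /= mulrC.
by rewrite Defs.ImD -rmorphXn mulrC ImRM /= mulrC.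
Qed.

Lemma centire_of_cvg (a : nat -> (C : numFieldType)) :
  (forall z : C, cvgn (series (fun n => a n * z ^+ n))) -> centire a.
Proof.
by move=> ca; split=> x; have /cvg_ReIm[cr ci] := ca x%:C%C; apply/cvg_ex;
  [exists (complex.Re (limn (series (fun n => a n * x%:C%C ^+ n))))
  |exists (complex.Im (limn (series (fun n => a n * x%:C%C ^+ n))))];
  [move: cr | move: ci]; under eq_fun do rewrite series_ReIm.
Qed.

Lemma csum_of_cvg (a : nat -> (C : numFieldType)) (x : R) (l : (C : numFieldType)) :
  series (fun n => a n * x%:C%C ^+ n) @ \oo --> l -> l = csum a x.
Proof.
move=> /cvg_ReIm[cr ci]; move: cr ci.
under eq_fun do rewrite series_ReIm; move=> /= cr.
under eq_fun do rewrite series_ReIm; move=> /= ci.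
by apply: complexE2; rewrite /csum /=; apply/esym/(cvg_lim (@Rhausdorff R)).
Qed.

End ComplexSeries.

(** * The recurrence of the radial equation and its contiguity relations *)

Section Frobenius.
Variables (K : numFieldType) (c : K).

(* Recurrence for the coefficients of [F_l / r ^ l], where [c] is [gamma]. *)
Definition frobenius (l : nat) (lam : K) (g : nat -> K) : Prop :=
  l.*2.+2%:R * g 1%N = - (2%:R * c) * g 0%N /\
  forall n, (n.+2 * (n + l.*2.+3))%:R * g n.+2 = - (2%:R * c) * g n.+1 - lam * g n.

(** The leading factors 2 l + 2 and (n + 2) (n + 2 l + 3) never vanish, so the first term determines
    the sequence. *)
Lemma frobenius_uniq l lam g h : frobenius l lam g -> frobenius l lam h ->
  g 0%N = h 0%N -> g =1 h.
Proof.
move=> [g1 gS] [h1 hS] gh0 n.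
suff [] : g n = h n /\ g n.+1 = h n.+1 by [].
elim: n => [|n [IH1 IH2]]; split=> //.
  have := h1; rewrite -gh0 -g1 => /mulfI; rewrite pnatr_eq0 => e; exact/esym/e.
have := hS n; rewrite -IH1 -IH2 -gS => /mulfI; rewrite pnatr_eq0 muln_eq0 addnS => e.
exact/esym/e.
Qed.

Lemma frobeniusZ l lam b g : frobenius l lam g -> frobenius l lam (fun n => b * g n).
Proof.
by move=> [g1 gS]; split=> [|m]; rewrite mulrCA ?g1 ?gS; ring.
Qed.

(** Turns a consequence of three linear relations into a certificate for [ring]: the multipliers
    [c1], [c2], [c3] are supplied by hand. *)
Lemma lincomb (x y a1 b1 a2 b2 a3 b3 c1 c2 c3 : K) :
  a1 = b1 -> a2 = b2 -> a3 = b3 ->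
  x - y = c1 * (a1 - b1) + c2 * (a2 - b2) + c3 * (a3 - b3) -> x = y.
Proof. by move=> -> -> -> /eqP; rewrite !subrr !mulr0 !addr0 subr_eq0 => /eqP. Qed.

(** The new sequence consists of the coefficients of ((l + 1) G' + c G) / r: one index shift comes
    from the derivative, the other from the division, which is possible since the constant term
    vanishes by the first relation for [g]. *)
Lemma frobenius_raise l lam g : frobenius l lam g ->
  frobenius l.+1 lam (fun n => l.+1%:R * (n.+2%:R * g n.+2) + c * g n.+1).
Proof.
move=> [g1 gS]; split=> [|m].
  (* The certificate involves lambda / 2; naming it keeps the identity free of divisions. *)
  have [m lamE] : exists m, lam = 2%:R * m.
    by exists (lam / 2%:R); rewrite mulrC divfK ?pnatr_eq0.
  apply: (lincomb (c1 := l.+1%:R) (c2 := c) (c3 := - m) (gS 1%N) (gS 0%N) g1).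
  by rewrite lamE -!muln2; ring.
apply: (lincomb (c1 := (l.+1 * m.+2)%:R) (c2 := c) (c3 := 0) (gS m.+2) (gS m.+1) g1).
by rewrite -!muln2; ring.
Qed.

(** The new sequence consists of the coefficients of (l + 1) (r G' + (2 l + 3) G) - c r G. *)
Lemma frobenius_lower l lam g : frobenius l.+1 lam g ->
  frobenius l lam (fun n => l.+1%:R * ((n + l.*2.+3)%:R * g n) -
    c * (if n is m.+1 then g m else 0)).
Proof.
move=> [g1 gS]; split=> [|[|m]] /=.
- apply: (lincomb (c1 := (l.*2.+2 * l.+1)%:R) (c2 := 0) (c3 := 0) g1 g1 g1).
  by rewrite -!muln2; ring.
- apply: (lincomb (c1 := (l.+1 * l.*2.+3)%:R) (c2 := - c) (c3 := 0) (gS 0%N) g1 g1).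
  by rewrite -!muln2; ring.
apply: (lincomb (c1 := (l.+1 * (m.+1 + l.*2.+3))%:R) (c2 := - c) (c3 := 0)
  (gS m.+1) (gS m) g1).
by rewrite -!muln2; ring.
Qed.

End Frobenius.

Section RadialSolutions.
Variables (R : realType) (gamma : R).
Local Notation C := R[i].
Local Notation g2 := (2%:R * gamma%:C%C : C).

Definition shift_seq (a : nat -> C) n := if n is m.+1 then a m else 0.

Lemma centire_shift a : centire a -> centire (shift_seq a).
Proof. by move=> ea; apply: centire_of_tail. Qed.

Lemma csum_shift a x : centire a -> csum (shift_seq a) x = x%:C%C * csum a x.
Proof. by move=> ea; rewrite csum_tail ?add0r //; exact: centire_shift. Qed.

Local Notation frobenius := (frobenius gamma%:C%C).

(** Two consecutive coefficients of the normalised solution, carried together because the recurrence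
    has two steps. The indeterminate of [{poly C}] is lambda. *)
Fixpoint radial_pair (l n : nat) : {poly C} * {poly C} :=
  if n is m.+1 then
    let: (a, b) := radial_pair l m in
    (b, - ((m.+2 * (m + l.*2.+3))%:R)^-1 *: (g2 *: b + 'X * a))
  else (1, (- g2 / l.*2.+2%:R)%:P).

Definition radial_coef l n := (radial_pair l n).1.

Lemma radial_pairE l n : radial_pair l n = (radial_coef l n, radial_coef l n.+1).
Proof. by rewrite /radial_coef /=; case: (radial_pair l n). Qed.

Definition radial l lam n := (radial_coef l n).[lam].

Lemma radial_frobenius l lam : frobenius l lam (radial l lam).
Proof.
rewrite /radial; split=> [|n].
  rewrite /radial_coef /= !hornerE /=.
  by rewrite mulrC mulKf ?pnatr_eq0.
rewrite /radial_coef /= radial_pairE /= !hornerE /=.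
rewrite mulrN mulfV ?pnatr_eq0 ?muln_eq0 ?addnS //; ring.
Qed.

Lemma radial0 l lam : radial l lam 0 = 1.
Proof. by rewrite /radial hornerC. Qed.

(** Five terms suffice for the radial equation; shorter relations are padded with zero
    multipliers. *)
Lemma csum_comb (s1 s2 s3 s4 s5 : nat -> C) (c2 c3 c4 c5 : C) :
  centire s1 -> centire s2 -> centire s3 -> centire s4 -> centire s5 ->
  let s n := s1 n + (c2 * s2 n + (c3 * s3 n + (c4 * s4 n + c5 * s5 n))) in
  centire s /\ forall x, csum s x =
  csum s1 x + (c2 * csum s2 x + (c3 * csum s3 x + (c4 * csum s4 x + c5 * csum s5 x))).
Proof.
move=> e1 e2 e3 e4 e5 s.
have e45 := centireD (centireZ c4 e4) (centireZ c5 e5).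
have e345 := centireD (centireZ c3 e3) e45; have e25 := centireD (centireZ c2 e2) e345.
split=> [|x]; first exact: centireD.
rewrite /s (csumD _ e1 e25) (csumD _ (centireZ c2 e2) e345) (csumD _ (centireZ c3 e3) e45).
by rewrite (csumD _ (centireZ c4 e4) (centireZ c5 e5)) !csumZ.
Qed.

Section OneSolution.
Variables (l : nat) (lam : C).

Lemma cderive_csum (psi : R -> C) a : centire a ->
  (forall r, 0 < r -> psi r = csum a r) ->
  forall r, 0 < r -> cderive psi r = csum (cdiffs a) r.
Proof.
move=> ea pa r r0; apply: complexE2.
  transitivity ('D_1 (fun t => complex.Re (psi t)) r); first by rewrite /cderive /= derive1E.
  rewrite -[RHS](@derive_val _ _ _ _ _ _ _ (csum_is_derive_Re r ea)).
  apply: near_eq_derive; near=> t; rewrite pa //; near: t; exact: lt_nbhsr.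
transitivity ('D_1 (fun t => complex.Im (psi t)) r); first by rewrite /cderive /= derive1E.
rewrite -[RHS](@derive_val _ _ _ _ _ _ _ (csum_is_derive_Im r ea)).
apply: near_eq_derive; near=> t; rewrite pa //; near: t; exact: lt_nbhsr.
Unshelve. all: by end_near. Qed.

(** In degree N the equation has the indicial factor N (N + 1) - l (l + 1) = (N - l) (N + l + 1),
    which for N = n + l + 2 is the factor (n + 2) (n + 2 l + 3) of the recurrence. *)
Lemma frobenius_of_ode (psi : R -> C) a : centire a ->
  (forall r, 0 < r -> psi r = csum a r) ->
  (forall r : R, 0 < r ->
     (r ^+ 2)%:C%C * cderive (cderive psi) r + (2 * r)%:C%C * cderive psi r
     - (l * l.+1)%N%:R * psi r + (2 * gamma * r)%:C%C * psi r
     + lam * (r ^+ 2)%:C%C * psi r = 0) ->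
  (forall k, (k < l)%N -> a k = 0) -> frobenius l lam (fun n => a (n + l)%N).
Proof.
move=> ea pa ode al.
have ea1 := centire_diffs ea; have ea2 := centire_diffs ea1.
(* The coefficient of r ^ n in the left-hand side of the equation; [shift_seq] is multiplication by
   r. *)
pose e n := shift_seq (shift_seq (cdiffs (cdiffs a))) n +
   (2 * shift_seq (cdiffs a) n + (- (l * l.+1)%N%:R * a n +
   (g2 * shift_seq a n + lam * shift_seq (shift_seq a) n))).
have e0 n : e n = 0.
  have es := centire_shift ea; have es1 := centire_shift ea1.
  have [ee se] := csum_comb (2) (- (l * l.+1)%N%:R) g2 lam (centire_shift (centire_shift ea2))
    es1 ea es (centire_shift es).
  apply: (csum_eq0 ee) => r r0; rewrite se !csum_shift //; do ?exact: centire_shift.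
  rewrite -[RHS](ode r r0) (cderive_csum ea1) // => [|t t0]; last exact: cderive_csum.
  rewrite (cderive_csum ea) // pa // expr2 !rmorphM /= rmorph_nat; ring.
have eq0 (x y : C) : x - y = 0 -> x = y by move/eqP; rewrite subr_eq0 => /eqP.
rewrite {}/e in e0.
split.
  case: l al e0 => [|k] al e0; apply: eq0.
    rewrite -(e0 1%N) /= /cdiffs !addn0 double0 mul0n; ring.
  rewrite -(e0 k.+2) /= /cdiffs (al k) // addnC addnS addn0 add0n -!muln2; ring.
move=> n; apply: eq0; rewrite -(e0 (n + l).+2) /= /cdiffs !addSn -muln2; ring.
Qed.

End OneSolution.

Lemma csum_prefix l (a : nat -> C) r : centire a -> (forall k, (k < l)%N -> a k = 0) ->
  centire (fun n => a (n + l)%N) /\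
  csum a r = r%:C%C ^+ l * csum (fun n => a (n + l)%N) r.
Proof.
elim: l a => [|l IHl] a ea al.
  by under eq_fun do rewrite addn0; rewrite mul1r.
have [|//|e1 e2] := IHl (fun n => a n.+1); first exact: centire_tail.
  by move=> k kl; apply: al.
under eq_fun do rewrite addnS; split=> //.
by rewrite csum_tail // al // add0r e2 exprS mulrA.
Qed.

(** The polynomial q_l: the term of index 0 of the raised sequence, to be compared with the first
    term 1 of [radial l.+1]. *)
Definition raise_coef l : {poly C} :=
  l.+1.*2%:R *: radial_coef l 2 + gamma%:C%C *: radial_coef l 1.

Lemma radial_raise l lam n :
  l.+1%:R * (n.+2%:R * radial l lam n.+2) + gamma%:C%C * radial l lam n.+1 =
  (raise_coef l).[lam] * radial l.+1 lam n.
Proof.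
have hr := frobeniusZ (raise_coef l).[lam] (radial_frobenius l.+1 lam).
apply: (frobenius_uniq (frobenius_raise (radial_frobenius l lam)) hr).
rewrite radial0 mulr1 /raise_coef /radial.
move: (radial_coef l 2) (radial_coef l 1) => p q.
by rewrite hornerD !hornerZ -muln2 natrM mulrA.
Qed.

(** Both sides solve the recurrence of degree l, and the constant is the value of the left-hand side
    at n = 0. *)
Lemma radial_lower l lam n :
  l.+1%:R * ((n + l.*2.+3)%:R * radial l.+1 lam n) -
    gamma%:C%C * shift_seq (radial l.+1 lam) n =
  (l.+1 * l.*2.+3)%:R * radial l lam n.
Proof.
have hr := frobeniusZ (l.+1 * l.*2.+3)%:R (radial_frobenius l lam).
apply: (frobenius_uniq (frobenius_lower (radial_frobenius l.+1 lam)) hr).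
by rewrite !radial0 mulr0 subr0 !mulr1 add0n natrM.
Qed.

Section RadialFunctions.
Variables (l : nat) (lam : C).
Hypothesis ent : forall l, centire (radial l lam).
Let G l := csum (radial l lam).
Let G' l := csum (cdiffs (radial l lam)).
Let G'' l := csum (cdiffs (cdiffs (radial l lam))).

Lemma csum_eq a b x : a =1 b -> csum a x = csum b x :> C.
Proof. by move=> /funext ->. Qed.

Lemma radial_ode x : x%:C%C * G'' l x + l.*2.+2%:R * G' l x +
  (2 * gamma%:C%C + lam * x%:C%C) * G l x = 0.
Proof.
have [g1 gS] := radial_frobenius l lam.
have e0 := ent l; have e1 := centire_diffs e0; have e2 := centire_diffs e1.
have [ee se] := csum_comb l.*2.+2%:R g2 lam 0 (centire_shift e2) e1 e0 (centire_shift e0) e0.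
rewrite -(csum0 x) -[RHS](@csum_eq (fun n => shift_seq (cdiffs (cdiffs (radial l lam))) n +
    (l.*2.+2%:R * cdiffs (radial l lam) n + (g2 * radial l lam n +
    (lam * shift_seq (radial l lam) n + 0 * radial l lam n))))).
  by rewrite se !csum_shift // /G'' /G' /G; ring.
move=> [|n]; rewrite /cdiffs /=.
  by apply: (lincomb (c1 := 1) (c2 := 0) (c3 := 0) g1 g1 g1); ring.
apply: (lincomb (c1 := 1) (c2 := 0) (c3 := 0) (gS n) g1 g1).
by rewrite -!muln2; ring.
Qed.

Lemma csum_raise x : l.+1%:R * G' l x + gamma%:C%C * G l x =
  (raise_coef l).[lam] * (x%:C%C * G l.+1 x).
Proof.
have [g1 gS] := radial_frobenius l lam.
have e0 := ent l; have e1 := centire_diffs e0.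
have [ee se] := csum_comb l.+1%:R 0 0 0 (centireZ gamma%:C%C e0) e1 e0 e0 e0.
transitivity (csum (fun n => gamma%:C%C * radial l lam n + (l.+1%:R * cdiffs (radial l lam) n +
   (0 * radial l lam n + (0 * radial l lam n + 0 * radial l lam n)))) x).
  by rewrite se csumZ // /G /G'; ring.
rewrite /G -csum_shift // -csumZ; last exact: centire_shift.
apply: csum_eq => -[|n]; rewrite /cdiffs /=.
  apply: (@mulfI _ 2%:R); first by rewrite pnatr_eq0.
  apply: (lincomb (c1 := 1) (c2 := 0) (c3 := 0) g1 g1 g1).
  by rewrite -!muln2; ring.
by rewrite -radial_raise; ring.
Qed.

Lemma csum_lower x : l.+1%:R * (x%:C%C * G' l.+1 x + l.*2.+3%:R * G l.+1 x) -
  gamma%:C%C * (x%:C%C * G l.+1 x) = (l.+1 * l.*2.+3)%:R * G l x.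
Proof.
have e0 := ent l.+1; have e1 := centire_diffs e0.
have [ee se] := csum_comb (l.+1 * l.*2.+3)%:R (- gamma%:C%C) 0 0
   (centireZ l.+1%:R (centire_shift e1)) e0 (centire_shift e0) e0 e0.
transitivity (csum (fun n => l.+1%:R * shift_seq (cdiffs (radial l.+1 lam)) n +
   ((l.+1 * l.*2.+3)%:R * radial l.+1 lam n + (- gamma%:C%C * shift_seq (radial l.+1 lam) n +
   (0 * radial l.+1 lam n + 0 * radial l.+1 lam n)))) x).
  by rewrite se csumZ ?csum_shift //; [rewrite /G /G'; ring | exact: centire_shift].
rewrite /G -csumZ //; apply: csum_eq => n; rewrite -radial_lower.
by case: n => [|n]; rewrite /cdiffs /=; ring.
Qed.

End RadialFunctions.

Variable F : nat -> C -> R -> C.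
Hypothesis F_regular : forall l lam, is_regular_solution gamma l lam (F l lam).

(** The equation determines the Taylor coefficients of [F l lam] from the leading one. Convergence
    of the series of [radial] is therefore inherited from that of [F] and needs no estimate. *)
Lemma regular_series l lam : centire (radial l lam) /\
  forall r, 0 < r -> F l lam r = r%:C%C ^+ l * csum (radial l lam) r.
Proof.
have [ode [a [ca Fa al0 al1]]] := F_regular l lam.
have ea : centire a by exact: centire_of_cvg.
have Fc r : 0 < r -> F l lam r = csum a r by move=> /Fa /csum_of_cvg.
have fb := frobenius_of_ode ea Fc ode al0.
have eb : (fun n => a (n + l)%N) = radial l lam.
  by apply/funext; apply: (frobenius_uniq fb (radial_frobenius l lam)); rewrite radial0 add0n.
split=> [|r r0]; first by rewrite -eb; have [] := csum_prefix 0 ea al0.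
by rewrite Fc // -eb; have [_ ->] := csum_prefix r ea al0.
Qed.

End RadialSolutions.

(** * Smooth functions *)

Local Notation coord := Defs.coord.
Local Notation radius := Defs.radius.

Section RadialSmooth.
Variable R : realType.
Local Notation C := R[i].
Implicit Types (x : R30 R) (a : nat -> C).

Definition rfun a : R30 R -> C := fun x => csum a (radius x).

Lemma is_derive_radial (g : R -> R) (dg : R) i x :
  is_derive (radius x) 1 g dg ->
  is_derive (val x) (evec R i) (g \o @enorm R) (dg * (val x i 0 / enorm (val x))).
Proof.
move=> [dg1 dg2]; have [dn1 dn2] := is_derive_enorm x i.
have fn := differentiable_enorm x; have fg : differentiable g (enorm (val x)).
  by apply/derivable1_diffP.
have fgn : differentiable (g \o @enorm R) (val x) by exact: differentiable_comp.
apply: DeriveDef; first exact: diff_derivable.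
rewrite deriveE // diff_comp //= diff1E // -deriveE // dn2 derive1E dg2.
by rewrite /GRing.scale /= mulrC.
Qed.

Lemma ext0_near (f : R30 R -> C) (g : 'cV[R]_3 -> C) x :
  (forall y : R30 R, f y = g (val y)) -> \forall y \near val x, g y = ext0 f y.
Proof.
move=> fg; near=> y; have y0 : y != 0 by near: y; exact: nbhs_R30.
by rewrite /ext0 insubT fg.
Unshelve. all: by end_near. Qed.

Lemma is_pd_rfun a i x : centire a ->
  is_pd i (rfun a) x (rfun (cdiffs a) x * (coord i x * invr_radius x)).
Proof.
move=> ea.
have nE : \forall y \near val x, csum a (enorm y) = ext0 (rfun a) y.
  exact: (@ext0_near (rfun a) (fun y => csum a (enorm y))).
have -> : coord i x * invr_radius x = (val x i 0 / enorm (val x))%:C%C by rewrite rmorphM.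
rewrite mulrC /is_pd ReRM ImRM; split.
  apply: (@near_eq_is_derive _ _ _ ((fun r => complex.Re (csum a r)) \o @enorm R)).
    by apply: filterS nE => y /= e; rewrite /re0 -e.
  by rewrite mulrC; apply: is_derive_radial; exact: csum_is_derive_Re.
apply: (@near_eq_is_derive _ _ _ ((fun r => complex.Im (csum a r)) \o @enorm R)).
  by apply: filterS nE => y /= e; rewrite /im0 -e.
by rewrite mulrC; apply: is_derive_radial; exact: csum_is_derive_Im.
Qed.

Lemma ccontinuous_rfun a : centire a -> ccontinuous (rfun a).
Proof.
move=> ea x; have nE : \forall y \near val x, csum a (enorm y) = ext0 (rfun a) y.
  exact: (@ext0_near (rfun a) (fun y => csum a (enorm y))).
have cn : {for val x, continuous (@enorm R)}.
  exact: differentiable_continuous (differentiable_enorm x).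
split.
  have c : (fun r => complex.Re (csum a r)) \o @enorm R @ val x --> re0 (rfun a) (val x).
    rewrite re0E; apply: continuous_comp => //=; apply: psum_continuous; exact: ea.1.
  suff : re0 (rfun a) @ val x --> re0 (rfun a) (val x) by [].
  have nE' : \forall y \near val x, ((fun r => complex.Re (csum a r)) \o @enorm R) y = re0 (rfun a) y.
  by apply: filterS nE => y /= e; rewrite /re0 -e.
exact: cvg_trans (near_eq_cvg nE') c.
have c : (fun r => complex.Im (csum a r)) \o @enorm R @ val x --> im0 (rfun a) (val x).
  rewrite im0E; apply: continuous_comp => //=; apply: psum_continuous; exact: ea.2.
suff : im0 (rfun a) @ val x --> im0 (rfun a) (val x) by [].
have nE' : \forall y \near val x, ((fun r => complex.Im (csum a r)) \o @enorm R) y = im0 (rfun a) y.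
  by apply: filterS nE => y /= e; rewrite /im0 -e.
exact: cvg_trans (near_eq_cvg nE') c.
Qed.

Lemma Ck_rfun k a : centire a -> Ck k (rfun a).
Proof.
elim: k a => [|k IHk] a ea; first exact: ccontinuous_rfun.
split=> [|i]; first exact: ccontinuous_rfun.
split=> [x|]; first exact: is_pd_derivable (is_pd_rfun i x ea).
have -> : pd i (rfun a) = rfun (cdiffs a) \* (@coord R i \* @invr_radius R).
  by apply/funext => x; rewrite (is_pdE (is_pd_rfun i x ea)).
apply: Ck_mul; first exact/IHk/centire_diffs.
by apply: Ck_mul; [exact: Ck_coord | exact: Ck_invr_radius].
Qed.

Definition peval (P : mpoly 3 C) : R30 R -> C := fun x => meval (fun i => coord i x) P.

Lemma is_pd_peval i P x : is_pd i (peval P) x (peval (mderiv i P) x).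
Proof.
elim/mpoly_gen_ind: P => [c|j|p q IHp IHq|p q IHp IHq].
- rewrite mderivC /peval meval0 (_ : (fun _ => _) = fun=> c); first exact: is_pd_cst.
  by apply/funext => y; rewrite mevalC.
- rewrite mderiv_var /peval (_ : (fun _ => _) = coord j).
    have := is_pd_coord i j x; congr is_pd.
    by case: (i == j); rewrite ?meval1 ?meval0.
  by apply/funext => y; rewrite mevalXU.
- have -> : peval (p + q) = peval p \+ peval q by apply/funext => y; exact: mevalD.
  by rewrite mderivD /peval mevalD; exact: is_pdD.
have -> : peval (p * q) = peval p \* peval q by apply/funext => y; exact: mevalM.
by rewrite mderivM /peval mevalD !mevalM; exact: is_pdM.
Qed.

Lemma Ck_peval k P : Ck k (peval P).
Proof.
elim/mpoly_gen_ind: P => [c|j|p q IHp IHq|p q IHp IHq].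
- have -> : peval (mpolyC 3 c) = fun=> c by apply/funext => y; exact: mevalC.
  exact: Ck_cst.
- have -> : peval (mpolyX C (mnm1 j)) = coord j by apply/funext => y; exact: mevalXU.
  exact: Ck_coord.
- have -> : peval (p + q) = peval p \+ peval q by apply/funext => y; exact: mevalD.
  exact: Ck_add.
have -> : peval (p * q) = peval p \* peval q by apply/funext => y; exact: mevalM.
exact: Ck_mul.
Qed.

Definition spol P : smooth R := mk_smooth (fun k => Ck_peval k P).

Lemma spd_spol i P : spd i (spol P) = spol (mderiv i P).
Proof. by apply: smooth_eq => x; exact: is_pdE (is_pd_peval i P x). Qed.

Definition srad a (ea : centire a) : smooth R := mk_smooth (fun k => Ck_rfun k ea).

Lemma spd_srad i a (ea : centire a) :
  spd i (srad ea) = smul (srad (centire_diffs ea)) (smul (sx R i) (sinvr R)).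
Proof. by apply: smooth_eq => x; exact: is_pdE (is_pd_rfun i x ea). Qed.

Lemma smooth_pderivable i (f : smooth R) x : pderivable i f x.
Proof. by have [_ /(_ i)[]] := smoothP f 1. Qed.

Lemma spdM i (f g : smooth R) : spd i (smul f g) = smul (spd i f) g + smul f (spd i g).
Proof. by apply: smooth_eq => x /=; rewrite pd_mul //; exact: smooth_pderivable. Qed.

Lemma spd_sx i j x : spd i (sx R j) x = (i == j)%:R.
Proof. exact: is_pdE (is_pd_coord i j x). Qed.

Lemma spd_sinvr i : spd i (sinvr R) =
  - smul (sx R i) (smul (sinvr R) (smul (sinvr R) (sinvr R))).
Proof.
apply: smooth_eq => x; rewrite /= (is_pdE (is_pd_invr_radius i x)).
by rewrite !exprS expr0 mulr1.
Qed.

Lemma sum_coord_sqr x : (\sum_i coord i x ^+ 2) * invr_radius x ^+ 2 = 1.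
Proof.
have x0 := enorm_gt0 x.
have -> : \sum_i coord i x ^+ 2 = (enorm (val x) ^+ 2)%:C%C.
  by rewrite enorm_sqr rmorph_sum; apply: eq_bigr => i _; rewrite rmorphXn.
by rewrite /invr_radius /radius -rmorphXn -rmorphM exprVn mulfV // expf_eq0 gt_eqF.
Qed.

Lemma radius_mul_invr x : (radius x)%:C%C * invr_radius x = 1.
Proof. by rewrite -rmorphM mulfV // gt_eqF // enorm_gt0. Qed.

Lemma smoothDE (f g : smooth R) x : (f + g) x = (f x : C) + (g x : C) :> C.
Proof. by []. Qed.
Lemma smoothNE (f : smooth R) x : (- f) x = - (f x : C) :> C. Proof. by []. Qed.
Lemma smoothZE c (f : smooth R) x : (c *: f) x = c * (f x : C) :> C. Proof. by []. Qed.
Lemma smoothME (f g : smooth R) x : smul f g x = (f x : C) * (g x : C) :> C.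
Proof. by []. Qed.
Lemma smooth_sumE (I : Type) (s : seq I) (f : I -> smooth R) x :
  (\sum_(i <- s) f i) x = \sum_(i <- s) (f i x : C) :> C.
Proof. by elim/big_rec2: _ => // i y1 y2 _ <-. Qed.
Lemma spdD i (f g : smooth R) : spd i (f + g) = spd i f + spd i g.
Proof. exact: linearD. Qed.
Lemma spolX i x : spol (mpolyX C (mnm1 i)) x = sx R i x. Proof. exact: mevalXU. Qed.
Lemma spolM P Q x : spol (P * Q) x = (spol P x : C) * (spol Q x : C) :> C.
Proof. exact: mevalM. Qed.
Lemma spolD P Q x : spol (P + Q) x = (spol P x : C) + (spol Q x : C) :> C.
Proof. exact: mevalD. Qed.
Lemma spolB P Q x : spol (P - Q) x = (spol P x : C) - (spol Q x : C) :> C.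
Proof. exact: mevalB. Qed.
Lemma spolZ c P x : spol (c *: P) x = c * (spol P x : C) :> C.
Proof. exact: mevalZ. Qed.
Lemma spol0 x : spol 0 x = 0. Proof. exact: meval0. Qed.
Lemma spol_sum (I : Type) (s : seq I) (f : I -> mpoly 3 C) x :
  spol (\sum_(i <- s) f i) x = \sum_(i <- s) (spol (f i) x : C) :> C.
Proof. exact: raddf_sum. Qed.
Definition smoothE := (smoothDE, smoothNE, smoothZE, smoothME, smooth_sumE).

End RadialSmooth.

(** * Scalar identities behind the operators on waves *)

Section WaveAlgebra.
Variable K : numFieldType.
Implicit Types (d X Y u f p r c n lam : K).

(** In these identities [X], [Y], [Z] stand for coordinates, [u] for 1 / r, [f], [f1], [f2] for the
    radial factor and its derivatives, and [p], [pX], [pXX] and so on for a polynomial and its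
    partial derivatives, all at one point. *)
Lemma ode_invr r u g0 g1 g2 n c lam : r * u = 1 ->
  r * g2 + n * g1 + (2%:R * c + lam * r) * g0 = 0 ->
  g2 = - (u * (n * g1) + (2%:R * c * u + lam) * g0).
Proof.
move=> ru e; apply: (lincomb (c1 := u) (c2 := - (g2 + lam * g0)) (c3 := 0) e ru ru).
ring.
Qed.

Lemma swave1_alg f f1 X u p pi :
  f1 * (X * u) * p + f * pi = X * (u * (f1 * p)) + f * pi.
Proof. ring. Qed.

Lemma swave2_alg d X Y u f f1 f2 p pi pj pij :
  d * (u * (f1 * p)) + X * (- (Y * (u * (u * u))) * (f1 * p) +
    u * (f2 * (Y * u) * p + f1 * pj)) + (Y * (u * (f1 * pi)) + f * pij) =
  d * (u * f1 * p) - X * Y * u ^+ 3 * f1 * p + X * Y * u ^+ 2 * f2 * p +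
    u * f1 * (X * pj + Y * pi) + f * pij.
Proof. ring. Qed.

Lemma rot_alg X Y u f f1 p pX pY :
  X * (Y * (u * (f1 * p)) + f * pY) - Y * (X * (u * (f1 * p)) + f * pX) =
  f * (X * pY - Y * pX).
Proof. ring. Qed.

Lemma laplacian_alg X Y Z u f f1 f2 p pX pY pZ pXX pYY pZZ (l : nat) :
  (X * X + Y * Y + Z * Z) * u ^+ 2 = 1 -> X * pX + Y * pY + Z * pZ = l%:R * p ->
  pXX + pYY + pZZ = 0 ->
  (1 * (u * f1 * p) - X * X * u ^+ 3 * f1 * p + X * X * u ^+ 2 * f2 * p +
    u * f1 * (X * pX + X * pX) + f * pXX) +
  (1 * (u * f1 * p) - Y * Y * u ^+ 3 * f1 * p + Y * Y * u ^+ 2 * f2 * p +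
    u * f1 * (Y * pY + Y * pY) + f * pYY) +
  (1 * (u * f1 * p) - Z * Z * u ^+ 3 * f1 * p + Z * Z * u ^+ 2 * f2 * p +
    u * f1 * (Z * pZ + Z * pZ) + f * pZZ) =
  (f2 + l.*2.+2%:R * u * f1) * p.
Proof.
move=> s e h.
apply: (lincomb (c1 := (f2 - u * f1) * p) (c2 := 2%:R * u * f1) (c3 := f) s e h).
by rewrite -muln2; ring.
Qed.

Lemma opT_alg l2 u f f1 f2 p c lam : f2 = - (u * (l2 * f1) + (2%:R * c * u + lam) * f) ->
  - ((f2 + l2 * u * f1) * p) - 2%:R * c * (u * (f * p)) = lam * (f * p).
Proof. by move=> ->; ring. Qed.

(** The second order part of R_i, a double cross product, equals x_i times the Laplacian minus sum_j
    x_j d_i d_j. *)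
Lemma runge_alg0 X0 X1 X2 d00 d01 d02 d11 d22 :
  X0 * d11 - X1 * d01 - (X2 * d02 - X0 * d22) =
  X0 * (d00 + d11 + d22) - (X0 * d00 + X1 * d01 + X2 * d02).
Proof. ring. Qed.

(* The middle sum is [\sum_j x_j d_0 d_j psi]. *)
Lemma runge_alg1 X Y Z u r f f1 f2 p pX pY pZ pXX pYX pZX (l : nat) :
  (X * X + Y * Y + Z * Z) * u ^+ 2 = 1 -> r * u = 1 ->
  X * pX + Y * pY + Z * pZ = l%:R * p ->
  X * pXX + Y * pYX + Z * pZX = (l%:R - 1) * pX ->
  X * (1 * (u * f1 * p) - X * X * u ^+ 3 * f1 * p + X * X * u ^+ 2 * f2 * p +
    u * f1 * (X * pX + X * pX) + f * pXX) +
  Y * (0 * (u * f1 * p) - Y * X * u ^+ 3 * f1 * p + Y * X * u ^+ 2 * f2 * p +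
    u * f1 * (Y * pX + X * pY) + f * pYX) +
  Z * (0 * (u * f1 * p) - Z * X * u ^+ 3 * f1 * p + Z * X * u ^+ 2 * f2 * p +
    u * f1 * (Z * pX + X * pZ) + f * pZX) =
  X * (f2 * p + l%:R * u * f1 * p) + r * f1 * pX + (l%:R - 1) * f * pX.
Proof.
move=> s ru e e2.
have s' : (X * X + Y * Y + Z * Z) * u = r.
  have u0 : u != 0 by apply: contra_eq_neq ru => ->; rewrite mulr0 eq_sym oner_eq0.
  by apply: (mulIf u0); rewrite ru -s; ring.
apply/eqP; rewrite -subr_eq0; apply/eqP.
transitivity ((X * f2 * p - X * u * f1 * p) * ((X * X + Y * Y + Z * Z) * u ^+ 2 - 1)
  + u * f1 * X * (X * pX + Y * pY + Z * pZ - l%:R * p)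
  + f * (X * pXX + Y * pYX + Z * pZX - (l%:R - 1) * pX)
  + f1 * pX * ((X * X + Y * Y + Z * Z) * u - r)).
  ring.
by rewrite s s' e e2 !subrr !mulr0 !addr0.
Qed.

(** Here [h] is G_(l+1), [a] is q_l(lambda) and [k] is l G_(l-1) [pX]. The lowering relation is
    taken multiplied by [pX], so that it also holds for l = 0, where [pX] vanishes. *)
Lemma runge_alg2 X u r s f f1 f2 p pX c lam h k a (l : nat) : r * u = 1 -> s = r ^+ 2 ->
  f2 = - (u * (l.*2.+2%:R * f1) + (2%:R * c * u + lam) * f) ->
  l.+1%:R * f1 + c * f = a * (r * h) ->
  l%:R * (r * f1 + l.*2.+1%:R * f) * pX - c * (r * f) * pX = l.*2.+1%:R * k ->
  X * ((f2 + l.*2.+2%:R * u * f1) * p) -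
    (X * (f2 * p + l%:R * u * f1 * p) + r * f1 * pX + (l%:R - 1) * f * pX) -
    (X * (u * (f1 * p)) + f * pX) + c * (X * (u * (f * p))) =
  a * (h * (X * p - (l.*2.+1%:R)^-1 * (s * pX))) - k.
Proof.
move=> ru -> f2E hE gE.
have l0 : l.*2.+1%:R != 0 :> K by rewrite pnatr_eq0.
have -> : k = l.*2.+1%:R^-1 * (l%:R * (r * f1 + l.*2.+1%:R * f) * pX - c * (r * f) * pX).
  by rewrite gE mulKf.
have -> : a * (h * (X * p - (l.*2.+1%:R)^-1 * (r ^+ 2 * pX))) =
    (a * (r * h)) * (u * X * p - (l.*2.+1%:R)^-1 * (r * pX)).
  transitivity (a * h * ((r * u) * X * p - (l.*2.+1%:R)^-1 * (r ^+ 2 * pX))); last ring.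
  by rewrite ru mul1r mulrA.
rewrite -hE f2E.
have mw := mulfV l0; move: {l0}(l.*2.+1%:R^-1 : K) mw => w mw.
apply: (lincomb (c1 := pX * (r * f1 + l%:R * f)) (c2 := 0) (c3 := 0) mw mw mw).
by rewrite -!muln2; ring.
Qed.

End WaveAlgebra.

(** * The operators L, T and R on waves *)

Section Waves.
Variables (R : realType) (gamma : R).
Local Notation C := R[i].
Hypothesis ent : forall l lam, centire (radial gamma l lam).
Implicit Types (x : R30 R) (P : mpoly 3 C).

(** When P is homogeneous of degree l this is the wave F_l Y with Y the restriction of P to the
    sphere, since r ^ l P(x / r) = P(x). *)
Definition swave l lam P : smooth R := smul (srad (ent l lam)) (spol P).

Local Notation ent1 l lam := (centire_diffs (ent l lam)).
Local Notation ent2 l lam := (centire_diffs (centire_diffs (ent l lam))).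

Lemma swaveE l lam P x : swave l lam P x = (srad (ent l lam) x : C) * (spol P x : C) :> C.
Proof. by []. Qed.

Lemma swave_linear l lam : linear (swave l lam).
Proof.
move=> c P Q; apply: smooth_eq => x; rewrite smoothDE smoothZE !swaveE spolD spolZ.
by rewrite mulrDr mulrCA.
Qed.

HB.instance Definition _ l lam :=
  GRing.isLinear.Build C (mpoly 3 C) (smooth R) *:%R (swave l lam) (swave_linear l lam).

Lemma spd_swave i l lam P : spd i (swave l lam P) =
  smul (sx R i) (smul (sinvr R) (smul (srad (ent1 l lam)) (spol P))) +
  swave l lam (mderiv i P).
Proof.
rewrite /swave spdM spd_srad spd_spol; apply: smooth_eq => x; rewrite !smoothE.
exact: swave1_alg.
Qed.

Lemma spd2_swave i j l lam P x : spd j (spd i (swave l lam P)) x =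
  (j == i)%:R * ((sinvr R x : C) * (srad (ent1 l lam) x : C) * (spol P x : C))
  - (sx R i x : C) * (sx R j x : C) * (sinvr R x : C) ^+ 3 * (srad (ent1 l lam) x : C) * (spol P x : C)
  + (sx R i x : C) * (sx R j x : C) * (sinvr R x : C) ^+ 2 * (srad (ent2 l lam) x : C) * (spol P x : C)
  + (sinvr R x : C) * (srad (ent1 l lam) x : C) *
    ((sx R i x : C) * (spol (mderiv j P) x : C) + (sx R j x : C) * (spol (mderiv i P) x : C))
  + (srad (ent l lam) x : C) * (spol (mderiv j (mderiv i P)) x : C) :> C.
Proof.
rewrite spd_swave spdD smoothDE spd_swave !(spdM, spd_srad, spd_spol, spd_sinvr).
rewrite !smoothE spd_sx; exact: swave2_alg.
Qed.

(** Rotation fields annihilate radial functions, so [P] is arbitrary here. *)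
Lemma opL_swave i l lam P : opL i (swave l lam P) = swave l lam (rot i P).
Proof.
apply: smooth_eq => x; rewrite /opL 2!spd_swave smoothDE smoothNE !smoothME.
rewrite !smoothDE !smoothME ?swaveE spolB !spolM !spolX.
exact: rot_alg.
Qed.

Section Harmonic.
Variables (l : nat) (lam : C) (P : mpoly 3 C).
Hypotheses (hP : P \is ishomog1 l mdeg) (harm : lapl P = 0).

Lemma euler_spol x :
  \sum_i (sx R i x : C) * (spol (mderiv i P) x : C) = l%:R * (spol P x : C).
Proof.
rewrite -spolZ -(euler_homog hP) spol_sum; apply: eq_bigr => i _.
by rewrite spolM spolX.
Qed.

Lemma euler_spol_mderiv i x :
  \sum_j (sx R j x : C) * (spol (mderiv i (mderiv j P)) x : C) =
  (l%:R - 1) * (spol (mderiv i P) x : C).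
Proof.
rewrite -spolZ.
have -> : (l%:R - 1) *: mderiv i P = euler (mderiv i P).
  case: l hP => [|k] hk; first by rewrite (mderiv_homog0 _ hk) scaler0 linear0.
  by rewrite (euler_homog (mderiv_homog i hk)) -[k.+1]addn1 natrD addrK.
rewrite spol_sum; apply: eq_bigr => j _.
by rewrite spolM spolX mderiv_comm.
Qed.

Lemma lapl_spol x : \sum_i (spol (mderiv i (mderiv i P)) x : C) = 0.
Proof. by rewrite -(spol_sum (index_enum 'I_3)) -/(lapl P) harm spol0. Qed.

Lemma sx_sinvr x : (\sum_i (sx R i x : C) * (sx R i x : C)) * (sinvr R x : C) ^+ 2 = 1.
Proof. by rewrite -(sum_coord_sqr x). Qed.

Lemma radial_ode_invr x : srad (ent2 l lam) x =
  - ((sinvr R x : C) * (l.*2.+2%:R * (srad (ent1 l lam) x : C)) +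
     (2%:R * gamma%:C%C * (sinvr R x : C) + lam) * (srad (ent l lam) x : C)) :> C.
Proof.
have r1 := radius_mul_invr x.
have e := @radial_ode R gamma l lam (fun k => ent k lam) (radius x).
exact: ode_invr r1 e.
Qed.

Lemma laplacian_swave x : \sum_i (spd i (spd i (swave l lam P)) x : C) =
  ((srad (ent2 l lam) x : C) + l.*2.+2%:R * (sinvr R x : C) * (srad (ent1 l lam) x : C)) *
  (spol P x : C).
Proof.
have s2 := sx_sinvr x; have e := euler_spol x; have h := lapl_spol x.
move: s2 e h; rewrite !(sum3 0) !spd2_swave !eqxx.
exact: laplacian_alg.
Qed.

Lemma opT_swave : opT gamma (swave l lam P) = lam *: swave l lam P.
Proof.
apply: smooth_eq => x; rewrite /opT !smoothE laplacian_swave.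
rewrite rmorphM rmorph_nat; exact: opT_alg (radial_ode_invr x).
Qed.

Lemma opR_swave i : opR gamma i (swave l lam P) = 'i%C *:
  ((raise_coef gamma l).[lam] *: swave l.+1 lam (raise (l.*2.+1%:R)^-1 i P) -
   l%:R *: swave l.-1 lam (mderiv i P)).
Proof.
rewrite /opR; congr (_ *: _); apply: smooth_eq => x.
have s2 := sx_sinvr x; have e := euler_spol x; have e2 := euler_spol_mderiv i x.
have r1 : (radius x)%:C%C * (sinvr R x : C) = 1 := radius_mul_invr x.
have o := radial_ode_invr x.
have E : (opL (i + 2) (spd (i + 1) (swave l lam P)) -
    opL (i + 1) (spd (i + 2) (swave l lam P))) x =
    (sx R i x : C) * (\sum_j (spd j (spd j (swave l lam P)) x : C)) -
    \sum_j (sx R j x : C) * (spd i (spd j (swave l lam P)) x : C) :> C.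
  rewrite /opL !ord3E !(sum3 i) !smoothE; exact: runge_alg0.
have E2 : \sum_j (sx R j x : C) * (spd i (spd j (swave l lam P)) x : C) =
  (sx R i x : C) * ((srad (ent2 l lam) x : C) * (spol P x : C)
    + l%:R * (sinvr R x : C) * (srad (ent1 l lam) x : C) * (spol P x : C))
  + (radius x)%:C%C * (srad (ent1 l lam) x : C) * (spol (mderiv i P) x : C)
  + (l%:R - 1) * (srad (ent l lam) x : C) * (spol (mderiv i P) x : C).
  move: s2 e e2; rewrite !(sum3 i) !spd2_swave !ord3_eq !eqxx => s2 e e2.
  exact: runge_alg1 s2 r1 e e2.
rewrite 2!smoothDE E E2 laplacian_swave spd_swave !smoothE /raise spolB spolZ !spolM spolX.
apply: (runge_alg2 _ _ r1 _ o).
- rewrite /rsqr spol_sum -rmorphXn /radius enorm_sqr rmorph_sum; apply: eq_bigr => j _.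
  by rewrite expr2 spolM !spolX -rmorphM -expr2.
- exact: (@csum_raise R gamma l lam (fun k => ent k lam) (radius x)).
case: l hP => [|k] hk; first by rewrite (mderiv_homog0 _ hk) spol0 !mulr0 subrr.
rewrite -mulrBl (@csum_lower R gamma k lam (fun k => ent k lam) (radius x)) natrM.
have cmb (a b g p : C) : a * b * g * p = b * (a * (g * p)) by ring.
exact: cmb.
Qed.

End Harmonic.
End Waves.

(** * Coefficients in lambda *)

Section Homogeneous.
Variables (n : nat) (K : comNzRingType).
Implicit Types (p : mpoly n K).

Lemma meval_homog l p (c : K) (v : 'I_n -> K) : p \is ishomog1 l mdeg ->
  meval (fun i => c * v i) p = c ^+ l * meval v p.
Proof.
move=> /dhomogP hp; rewrite !mevalE mulr_sumr big_seq [RHS]big_seq.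
apply: eq_bigr => m /hp <-; rewrite mulrCA; congr (_ * _).
rewrite /= mdegE -prodrXr -big_split; apply: eq_bigr => i _.
by rewrite exprMn.
Qed.

Lemma mcoeff_pihomog l m p :
  mcoeff m (pihomog mdeg l p) = if mdeg m == l then mcoeff m p else 0.
Proof.
rewrite pihomogE raddf_sum /=.
under eq_bigr do rewrite mcoeffZ mcoeffX.
case: ifP => ml.
  case: (boolP (m \in msupp p)) => mp.
    rewrite big_mkcond (bigD1_seq m) ?msupp_uniq //= ml eqxx mulr1 big1 ?addr0 // => k km.
    by rewrite (negPf km) mulr0 if_same.
  rewrite big_seq_cond big1; last first.
    move=> k /andP[kp _]; case: eqP => [km|_]; last by rewrite mulr0.
    by rewrite -km kp in mp.
  by apply/esym/eqP; rewrite mcoeff_eq0.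
rewrite big1 // => k kl; case: eqP => [km|_]; last by rewrite mulr0.
by rewrite -km kl in ml.
Qed.

Lemma pihomog_ge l p : (mmeasure mdeg p <= l)%N -> pihomog mdeg l p = 0.
Proof.
move=> pl; apply/mpolyP => m; rewrite mcoeff_pihomog mcoeff0; case: eqP => // ml.
rewrite -ml in pl; apply/eqP; rewrite mcoeff_eq0; exact: (mmeasure_mnm_ge (mf := mdeg)).
Qed.

Lemma sum_pihomog N p : (mmeasure mdeg p <= N)%N -> p = \sum_(l < N) pihomog mdeg l p.
Proof. by move=> /(pihomog_partitionE). Qed.

Lemma pihomog_lsubst (B : 'M[K]_n) l p :
  pihomog mdeg l (lsubst B p) = lsubst B (pihomog mdeg l p).
Proof.
pose N := maxn (mmeasure mdeg p) l.+1.
have lN : (l < N)%N by rewrite leq_max leqnn orbT.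
have e : p = \sum_(k < N) pihomog mdeg k p by apply: sum_pihomog; exact: leq_maxl.
rewrite {1}e (linear_sum (lsubst B)) (linear_sum (pihomog mdeg l)) (bigD1 (Ordinal lN)) //=.
rewrite (pihomog_dE (lsubst_homog B (pihomogP _ _ _))) big1 ?addr0 // => k kl.
by rewrite (pihomog_ne0 _ (lsubst_homog _ (pihomogP _ _ _))) //.
Qed.

End Homogeneous.

Lemma map_pihomog n (K A : comNzRingType) (f : {rmorphism K -> A}) l (p : mpoly n K) :
  map_mpoly f (pihomog mdeg l p) = pihomog mdeg l (map_mpoly f p).
Proof.
apply/mpolyP => m; rewrite mcoeff_map_mpoly !mcoeff_pihomog mcoeff_map_mpoly /=.
by case: ifP => // _; exact: rmorph0.
Qed.

Section LaplacianHomog.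
Variables (K : comNzRingType).

(** A coefficient of the Laplacian involves only coefficients of degree higher by 2, which the
    projection keeps or kills together. *)
Lemma lapl_pihomog l (p : mpoly 3 K) : lapl p = 0 -> lapl (pihomog mdeg l p) = 0.
Proof.
move=> hp; apply/mpolyP => m.
have : mcoeff m (lapl p) = 0 by rewrite hp mcoeff0.
rewrite mcoeff0 /lapl !raddf_sum /=.
under eq_bigr do rewrite !mcoeff_deriv.
under [X in _ -> X = _]eq_bigr => i _ do
  rewrite !mcoeff_deriv mcoeff_pihomog !mdegD !mdeg1 -addnA.
case: eqP => [//|_ _]; rewrite big1 // => i _; by rewrite !mul0rn.
Qed.

Lemma laplD (p q : mpoly 3 K) : lapl (p + q) = lapl p + lapl q.
Proof. exact: linearD. Qed.
Lemma laplB (p q : mpoly 3 K) : lapl (p - q) = lapl p - lapl q.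
Proof. exact: linearB. Qed.
Lemma laplZ c (p : mpoly 3 K) : lapl (c *: p) = c *: lapl p.
Proof. exact: linearZ. Qed.
Lemma lapl0 : lapl (0 : mpoly 3 K) = 0.
Proof. exact: linear0. Qed.
Lemma lapl_sum0 (I : Type) (s : seq I) (f : I -> mpoly 3 K) :
  (forall i, lapl (f i) = 0) -> lapl (\sum_(i <- s) f i) = 0.
Proof.
by move=> f0; elim/big_rec: _ => [|i p _ hp]; [exact: lapl0 | rewrite laplD f0 hp addr0].
Qed.

Lemma map_lapl (A : comNzRingType) (f : {rmorphism K -> A}) (p : mpoly 3 K) :
  map_mpoly f (lapl p) = lapl (map_mpoly f p).
Proof. by rewrite /lapl raddf_sum; apply: eq_bigr => i _ /=; rewrite !map_mderiv. Qed.

Lemma map_rot (A : comNzRingType) (f : {rmorphism K -> A}) i (p : mpoly 3 K) :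
  map_mpoly f (rot i p) = rot i (map_mpoly f p).
Proof. by rewrite /rot rmorphB !rmorphM /= !map_mpolyX !map_mderiv. Qed.

End LaplacianHomog.

Section RungeLenz.
Variables (K : comNzRingType) (s : K) (q d : nat -> K).
Implicit Types (p u v : mpoly 3 K).

(** The scalars [s], [q] and [d] are parameters because the same formula is used over C at a fixed
    lambda and over C[lambda]. *)
Definition runge_term l i p :=
  s *: (q l *: raise (d l) i p - l%:R *: mderiv i p).

Lemma runge_term_linear l i : linear (runge_term l i).
Proof.
move=> c u v; rewrite /runge_term raise_linear [mderiv i _]linearP /=.
move: (raise _ i u) (raise _ i v) (mderiv i u) (mderiv i v) => a b a' b'.
rewrite !(scalerDr, scalerN, scalerA) opprD addrACA.
by congr ((_ *: _ - _ *: _) + _); ring.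
Qed.
HB.instance Definition _ l i :=
  GRing.isLinear.Build K (mpoly 3 K) (mpoly 3 K) *:%R (runge_term l i) (runge_term_linear l i).

(* The action of the Runge-Lenz operators on harmonic polynomials, see
   [opR_siota]. *)
Definition runge i u : mpoly 3 K :=
  \sum_(l < mmeasure mdeg u) runge_term l i (pihomog mdeg l u).

Lemma rungeE N i u : (mmeasure mdeg u <= N)%N ->
  runge i u = \sum_(l < N) runge_term l i (pihomog mdeg l u).
Proof.
move=> uN; rewrite /runge (big_ord_widen _ (fun l => runge_term l i (pihomog mdeg l u)) uN).
rewrite big_mkcond; apply: eq_bigr => l _; case: ltnP => // /pihomog_ge ->.
by rewrite linear0.
Qed.

Lemma runge_linear i : linear (runge i).
Proof.
move=> c u v; pose N := maxn (mmeasure mdeg u) (mmeasure mdeg v).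
have uN : (mmeasure mdeg u <= N)%N by exact: leq_maxl.
have vN : (mmeasure mdeg v <= N)%N by exact: leq_maxr.
rewrite (rungeE i uN) (rungeE i vN) (@rungeE N); last first.
  apply: leq_trans (mmeasureD_le _ _ _) _; rewrite geq_max vN andbT.
  exact: leq_trans (mmeasureZ_le _ _ _) uN.
rewrite scaler_sumr -big_split; apply: eq_bigr => l _ /=.
by rewrite !linearP.
Qed.
HB.instance Definition _ i :=
  GRing.isLinear.Build K (mpoly 3 K) (mpoly 3 K) *:%R (runge i) (runge_linear i).

Lemma lapl_runge i u : (forall l, d l * l.*2.+1%:R = 1) -> lapl u = 0 ->
  lapl (runge i u) = 0.
Proof.
move=> dl hu; apply: lapl_sum0 => l; rewrite laplZ laplB !laplZ.
have hl : lapl (pihomog mdeg l u) = 0 by exact: lapl_pihomog.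
rewrite (lapl_raise _ (dl l)) ?pihomogP // lapl_mderiv hl.
by rewrite (linear0 (mderiv i)) !scaler0 subr0 scaler0.
Qed.

Lemma lsubst_runge (B : 'M[K]_3) j u : B *m B^T = 1%:M ->
  lsubst B (runge j u) = \sum_k B k j *: runge k (lsubst B u).
Proof.
move=> BB; rewrite {1}/runge linear_sum /=.
transitivity (\sum_k \sum_(l < mmeasure mdeg u)
    B k j *: runge_term l k (pihomog mdeg l (lsubst B u))); last first.
  by apply: eq_bigr => k _; rewrite (rungeE k (msize_lsubst B u)) scaler_sumr.
rewrite exchange_big; apply: eq_bigr => l _; rewrite pihomog_lsubst /runge_term.
rewrite lsubstZ linearB /= !lsubstZ lsubst_raise // lsubst_mderiv //.
rewrite !scaler_sumr -sumrB scaler_sumr; apply: eq_bigr => k _.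
move: (raise _ k _) (mderiv k _) => a b.
by rewrite !(scalerDr, scalerN, scalerA); congr (_ *: _ - _ *: _); ring.
Qed.

End RungeLenz.

Lemma map_runge (K A : comNzRingType) (f : {rmorphism K -> A}) s q d i (u : mpoly 3 K) :
  map_mpoly f (runge s q d i u) = runge (f s) (f \o q) (f \o d) i (map_mpoly f u).
Proof.
have fZ c (p : mpoly 3 K) : map_mpoly f (c *: p) = f c *: map_mpoly f p.
  exact: map_mpolyZ.
pose N := maxn (mmeasure mdeg u) (mmeasure mdeg (map_mpoly f u)).
rewrite (@rungeE _ s q d N) ?leq_maxl // (@rungeE _ _ _ _ N) ?leq_maxr //.
rewrite raddf_sum; apply: eq_bigr => l _ /=.
rewrite /runge_term fZ rmorphB /= !fZ map_raise map_mderiv rmorph_nat.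
by rewrite map_pihomog.
Qed.

Section LambdaCoefficients.
Variable K : numFieldType.
Local Notation D := {poly K}.

Definition lamconst n : mpoly n K -> mpoly n D := map_mpoly polyC.
Definition lameval n (t : K) : mpoly n D -> mpoly n K := map_mpoly (horner_eval t).
Definition lamcoef n (k : nat) : mpoly n D -> mpoly n K := map_mpoly (coefp k).

Lemma lamconstZ n c (p : mpoly n K) : lamconst (c *: p) = c%:P *: lamconst p.
Proof. exact: map_mpolyZ. Qed.

Lemma lamevalZ n t c (u : mpoly n D) : lameval t (c *: u) = c.[t] *: lameval t u.
Proof. exact: map_mpolyZ. Qed.

Lemma lameval_lamconst n t (p : mpoly n K) : lameval t (lamconst p) = p.
Proof. by apply/mpolyP => m; rewrite !mcoeff_map_mpoly /= /horner_eval hornerC. Qed.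

Lemma mcoeff_lamcoef n k (u : mpoly n D) m : mcoeff m (lamcoef k u) = (mcoeff m u)`_k.
Proof. by rewrite /lamcoef mcoeff_map_mpoly. Qed.

Lemma lameval_eq0 n (u : mpoly n D) : (forall t, lameval t u = 0) -> u = 0.
Proof.
move=> u0; apply/mpolyP => m; rewrite mcoeff0; apply: poly_vanish => t.
by have := congr1 (mcoeff m) (u0 t); rewrite mcoeff_map_mpoly mcoeff0.
Qed.

Definition lambda_size n (u : mpoly n D) := (\max_(m <- msupp u) size (mcoeff m u))%N.

Lemma sum_lamcoef n N (u : mpoly n D) : (lambda_size u <= N)%N ->
  u = \sum_(k < N) 'X^k *: lamconst (lamcoef k u).
Proof.
move=> uN; apply/mpolyP => m; rewrite raddf_sum /=.
under eq_bigr do rewrite mcoeffZ mcoeff_map_mpoly mcoeff_lamcoef mulrC mul_polyC.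
apply/polyP => j; rewrite coef_sum.
under eq_bigr do rewrite coefZ coefXn.
have [jN|Nj] := ltnP j N.
  rewrite (bigD1 (Ordinal jN)) //= eqxx mulr1 big1 ?addr0 // => i ij.
  rewrite eq_sym; case: eqP => [e|_]; last by rewrite mulr0.
  by case/eqP: ij; apply/val_inj.
rewrite big1 => [|i _]; last by rewrite gtn_eqF ?mulr0 // (leq_trans (ltn_ord i)).
case: (boolP (m \in msupp u)) => mu; last by rewrite (memN_msupp_eq0 mu) coef0.
apply: nth_default; apply: leq_trans Nj; apply: leq_trans uN.
by rewrite /lambda_size (big_rem m) //= leq_maxl.
Qed.

Lemma lamevalD n t (u v : mpoly n D) : lameval t (u + v) = lameval t u + lameval t v.
Proof. exact: raddfD. Qed.
Lemma lamevalB n t (u v : mpoly n D) : lameval t (u - v) = lameval t u - lameval t v.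
Proof. exact: raddfB. Qed.
Lemma lameval0 n t : lameval t (0 : mpoly n D) = 0.
Proof. exact: raddf0. Qed.
Lemma lamconst0 n : lamconst (0 : mpoly n K) = 0.
Proof. exact: raddf0. Qed.

Lemma lapl_lamconst (p : mpoly 3 K) : lapl (lamconst p) = lamconst (lapl p).
Proof. by rewrite /lamconst map_lapl. Qed.

Lemma lapl_lameval t (u : mpoly 3 D) : lapl (lameval t u) = lameval t (lapl u).
Proof. by rewrite /lameval map_lapl. Qed.

Lemma lapl_lamcoef k (u : mpoly 3 D) : lapl (lamcoef k u) = lamcoef k (lapl u).
Proof.
apply/mpolyP => m; rewrite mcoeff_lamcoef /lapl !raddf_sum /= coef_sum.
by apply: eq_bigr => i _; rewrite !mcoeff_deriv mcoeff_lamcoef !coefMn.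
Qed.

(** The Laplacian acts separately on the coefficient of each power of lambda and preserves
    harmonicity of homogeneous components, so constant homogeneous harmonic polynomials generate. *)
Lemma harmonic_ind (Q : mpoly 3 D -> Prop) : Q 0 ->
  (forall u v, Q u -> Q v -> Q (u + v)) -> (forall c u, Q u -> Q (c *: u)) ->
  (forall l p, p \is ishomog1 l mdeg -> lapl p = 0 -> Q (lamconst p)) ->
  forall u, lapl u = 0 -> Q u.
Proof.
move=> Q0 QD QZ QP u hu; rewrite (sum_lamcoef (leqnn (lambda_size u))).
apply: (big_ind Q Q0 QD) => k _; apply: (QZ).
have hk : lapl (lamcoef k u) = 0.
  rewrite lapl_lamcoef hu; apply/mpolyP => m.
  by rewrite mcoeff_lamcoef !mcoeff0 coef0.
rewrite (sum_pihomog (leqnn (mmeasure mdeg (lamcoef k u)))) /lamconst raddf_sum.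
apply: (big_ind Q Q0 QD) => l _; apply: QP (pihomogP _ _ _) _.
exact: lapl_pihomog.
Qed.

Lemma lameval_runge t s q d i (u : mpoly 3 D) :
  lameval t (runge s%:P q (polyC \o d) i u) =
  runge s (fun l => (q l).[t]) d i (lameval t u).
Proof.
rewrite /lameval map_runge; congr (runge _ _ _ _ _); first exact: hornerC.
by apply/funext => l; exact: hornerC.
Qed.

Lemma lameval_rot t i (u : mpoly 3 D) : lameval t (rot i u) = rot i (lameval t u).
Proof. exact: map_rot. Qed.

End LambdaCoefficients.

Section Iota.
Variables (R : realType) (gamma : R).
Local Notation C := R[i].
Local Notation D := {poly C}.
Hypothesis ent : forall l lam, centire (radial gamma l lam).

(* [siota lam P] multiplies the component of degree [l] of [P] by the radial
   factor [F_l / r ^ l]. *)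
Definition siota (lam : C) (P : mpoly 3 C) : smooth R :=
  \sum_(l < mmeasure mdeg P) swave ent l lam (pihomog mdeg l P).

Lemma siotaE N lam P : (mmeasure mdeg P <= N)%N ->
  siota lam P = \sum_(l < N) swave ent l lam (pihomog mdeg l P).
Proof.
move=> PN; rewrite /siota (big_ord_widen _ (fun l => swave ent l lam (pihomog mdeg l P)) PN).
rewrite big_mkcond; apply: eq_bigr => i _; case: ltnP => // /pihomog_ge ->.
by rewrite linear0.
Qed.

Lemma siota_linear lam : linear (siota lam).
Proof.
move=> c P Q; pose N := maxn (mmeasure mdeg P) (mmeasure mdeg Q).
have PN : (mmeasure mdeg P <= N)%N by exact: leq_maxl.
have QN : (mmeasure mdeg Q <= N)%N by exact: leq_maxr.
rewrite (@siotaE N lam P) // (@siotaE N lam Q) // (@siotaE N); last first.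
  apply: leq_trans (mmeasureD_le _ _ _) _; rewrite geq_max QN andbT.
  exact: leq_trans (mmeasureZ_le _ _ _) PN.
rewrite scaler_sumr -big_split; apply: eq_bigr => l _ /=.
by rewrite !linearP.
Qed.

HB.instance Definition _ lam :=
  GRing.isLinear.Build C (mpoly 3 C) (smooth R) *:%R (siota lam) (siota_linear lam).

Lemma siotaD lam P Q : siota lam (P + Q) = siota lam P + siota lam Q.
Proof. exact: linearD. Qed.
Lemma siotaZ lam c P : siota lam (c *: P) = c *: siota lam P.
Proof. exact: linearZ. Qed.
Lemma siota_homog l lam P : P \is ishomog1 l mdeg -> siota lam P = swave ent l lam P.
Proof.
move=> hP; have [->|P0] := eqVneq P 0; first by rewrite !linear0.
have lP : (l < mmeasure mdeg P)%N.
  have : msupp P != [::] by rewrite msupp_eq0.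
  case E : (msupp P) => [//|m s] _.
  have mP : m \in msupp P by rewrite E mem_head.
  by have /dhomogP/(_ _ mP) /= <- := hP; exact: mmeasure_mnm_lt mP.
rewrite /siota (bigD1 (Ordinal lP)) //= pihomog_dE // big1 ?addr0 // => k kl.
rewrite (pihomog_ne0 _ hP) ?linear0 //.
by apply: contra kl => /eqP e; apply/eqP/val_inj.
Qed.

Lemma centire_iter_shift l (a : nat -> C) : centire a -> centire (iter l (@shift_seq R) a).
Proof. by move=> ea; elim: l => //= l; exact: centire_shift. Qed.

Lemma csum_iter_shift l (a : nat -> C) s : centire a ->
  csum (iter l (@shift_seq R) a) s = s%:C%C ^+ l * csum a s.
Proof.
move=> ea; elim: l => [|l IHl]; first by rewrite mul1r.
by rewrite iterS csum_shift ?IHl ?exprS ?mulrA //; exact: centire_iter_shift.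
Qed.

Lemma iter_shiftE l (a : nat -> C) n :
  iter l (@shift_seq R) a n = if (n < l)%N then 0 else a (n - l)%N.
Proof. by elim: l n => [|l IHl] [|n] //=; rewrite ?IHl. Qed.

Definition scale_pt (s : R) (s0 : 0 < s) (y : R30 R) : R30 R.
Proof.
exists (s *: val y).
by rewrite scaler_eq0 negb_or gt_eqF //=; exact: (valP y).
Defined.

(** On the ray s y the function is sum_l s ^ l P_l(y) G_l(s |y|), a power series in s that vanishes
    for s > 0. As G_l(0) = 1, the relations between the values P_l(y) given by its coefficients are
    triangular. *)
Lemma siota_inj lam P : siota lam P = 0 -> P = 0.
Proof.
move=> P0; pose N := mmeasure mdeg P.
suff PN : forall l, (l < N)%N -> pihomog mdeg l P = 0.
  by rewrite (@sum_pihomog _ _ N P) // big1 // => l _; exact: PN.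
pose p l (y : R30 R) := peval (pihomog mdeg l P) y.
pose b l (y : R30 R) : nat -> C :=
  iter l (@shift_seq R) (fun n => (Defs.radius y)%:C%C ^+ n * radial gamma l lam n).
have eb l y : centire (b l y) by exact/centire_iter_shift/centire_scale.
have key y n : \sum_(l < N) p l y * b l y n = 0.
  apply: (@csum_eq0 _ (fun n => \sum_(l < N) p l y * b l y n)) => [|s s0].
    by apply: centire_sum => l; exact: centireZ.
  rewrite csum_sum => [|l]; last exact: centireZ.
  rewrite -[RHS]/((0 : smooth R) (scale_pt s0 y)) -P0 /siota smooth_sumE.
  apply: eq_bigr => l _; rewrite csumZ // csum_iter_shift; last exact: centire_scale.
  rewrite csum_scale swaveE.
  have -> : spol (pihomog mdeg l P) (scale_pt s0 y) = s%:C%C ^+ l * p l y :> C.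
    rewrite -(meval_homog _ _ (pihomogP _ _ _)); apply: meval_eq => i.
    by rewrite /Defs.coord /= mxE rmorphM.
  have -> : srad (ent l lam) (scale_pt s0 y) =
      csum (radial gamma l lam) (Defs.radius y * s) :> C.
    by rewrite /= /rfun /Defs.radius enormZ ?ltW // mulrC.
  have cmb (a c d : C) : a * (c * d) = d * (c * a) by ring.
  exact: cmb.
(* In the coefficient of s ^ l, degrees above l do not occur and degrees below l vanish by
   induction. *)
have vanish l y : (l < N)%N -> p l y = 0.
  elim/ltn_ind: l => l IHl lN.
  have := key y l; rewrite (bigD1 (Ordinal lN)) //= big1 ?addr0 => [|k kl].
    by rewrite /b iter_shiftE ltnn subnn expr0 mul1r radial0 mulr1.
  have [kll|lk] := ltnP k l; first by rewrite IHl ?mul0r // (ltn_trans kll).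
  rewrite /b iter_shiftE ifT ?mulr0 // ltn_neqAle lk andbT.
  by apply: contra kl => /eqP e; apply/eqP/val_inj.
move=> l lN; apply: mpoly_vanish => k.
pose y : 'cV[R]_3 := \col_i (k i).+1%:R.
have y0 : y != 0.
  by apply/negP => /eqP/colP/(_ 0); rewrite !mxE => /eqP; rewrite pnatr_eq0.
rewrite -(vanish l (exist _ y y0) lN) /p /peval; apply: meval_eq => i.
by rewrite /Defs.coord /= mxE rmorph_nat.
Qed.

End Iota.

(** * The space of regular solutions *)

Section RegularFamily.
Variables (R : realType) (gamma : R) (F : nat -> R[i] -> R -> R[i]).
Local Notation C := R[i].
Local Notation D := {poly C}.
Hypothesis F_regular : forall l lam, is_regular_solution gamma l lam (F l lam).

Lemma radial_entire l lam : centire (radial gamma l lam).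
Proof. by have [] := regular_series F_regular l lam. Qed.

Local Notation ent := radial_entire.
Local Notation siota := (siota ent).
Local Notation swave := (swave ent).

Lemma wave_swave l lam (P : mpoly 3 C) (Y : S2 R -> C) : P \is ishomog1 l mdeg ->
  (forall t : S2 R, Y t = meval (fun i => (val t i 0)%:C%C) P) ->
  wave F l Y lam = siota lam P.
Proof.
move=> hP YP; rewrite (siota_homog _ _ hP); apply/funext => x.
have x0 := enorm_gt0 x.
have Fx := (regular_series F_regular l lam).2 _ x0.
rewrite /wave YP Fx.
have -> : meval (fun i => (val (angular x) i 0)%:C%C) P =
    ((Defs.radius x)^-1)%:C%C ^+ l * spol P x.
  rewrite -(meval_homog _ _ hP); apply: meval_eq => i.
  by rewrite /= mxE rmorphM.
have r1 : (Defs.radius x)%:C%C ^+ l * ((Defs.radius x)^-1)%:C%C ^+ l = 1 :> C.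
  by rewrite -exprMn -rmorphM mulfV ?gt_eqF // rmorph1 expr1n.
have cmb (a b c d : C) : a * b = 1 -> a * c * (b * d) = c * d.
  by move=> e; rewrite mulrACA e mul1r.
exact: cmb.
Qed.

Lemma wave_smooth l (Y : S2 R -> C) lam : spherical_harmonic l Y -> is_smooth (wave F l Y lam).
Proof. by move=> [P [hP _ YP]]; rewrite (wave_swave lam hP YP); exact: smoothP. Qed.

Definition embed (u : mpoly 3 D) : sections_on_R30 R := fun lam => siota lam (lameval lam u).

Lemma embed_linear : linear embed.
Proof.
move=> c u v; apply/funext => lam; apply/funext => x.
by rewrite /embed lamevalD lamevalZ siotaD siotaZ.
Qed.

HB.instance Definition _ :=
  GRing.isLinear.Build D (mpoly 3 D) (sections_on_R30 R) *:%R embed embed_linear.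

Lemma embedD u v : embed (u + v) = embed u + embed v. Proof. exact: linearD. Qed.
Lemma embedB u v : embed (u - v) = embed u - embed v. Proof. exact: linearB. Qed.
Lemma embedZ c u : embed (c *: u) = c *: embed u. Proof. exact: linearZ. Qed.
Lemma embed0 : embed 0 = 0. Proof. exact: linear0. Qed.
Lemma embed_sum (I : Type) (s : seq I) (f : I -> mpoly 3 D) :
  embed (\sum_(i <- s) f i) = \sum_(i <- s) embed (f i).
Proof. exact: linear_sum. Qed.

Lemma embed_inj u : embed u = 0 -> u = 0.
Proof.
move=> u0; apply: lameval_eq0 => lam; apply: (@siota_inj _ _ ent lam).
by apply: smooth_eq => x; have := congr1 (fun f => f lam x) u0.
Qed.

Lemma poly_wave_embed p l (Y : S2 R -> C) (P : mpoly 3 C) : P \is ishomog1 l mdeg ->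
  (forall t : S2 R, Y t = meval (fun i => (val t i 0)%:C%C) P) ->
  poly_wave F p l Y = embed (p *: lamconst P).
Proof.
move=> hP YP; apply/funext => lam; apply/funext => x.
by rewrite /poly_wave (wave_swave lam hP YP) /embed lamevalZ lameval_lamconst linearZ.
Qed.

Definition harmonic_Y (P : mpoly 3 C) (t : S2 R) : C := meval (fun i => (val t i 0)%:C%C) P.

Lemma embed_regular u : lapl u = 0 -> embed u \in regular_pred F.
Proof.
have [r0 rP] := regular_submod F.
move: u; apply: harmonic_ind => [|u v hu hv|c u hu|l P hP lP].
- by rewrite embed0.
- have e : embed (u + v) = 1 *: embed u + embed v by rewrite scale1r; exact: embedD.
  have h := rP 1 _ _ hu hv.
  by rewrite e; exact: h.
- have e : embed (c *: u) = c *: embed u + 0 by rewrite addr0; exact: embedZ.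
  have h := rP c _ _ hu r0.
  by rewrite e; exact: h.
rewrite inE; exists 1%N, (fun=> 1), (fun=> embed (lamconst P)).
split=> [_|]; last by rewrite big_ord1 scale1r.
exists 1, l, (harmonic_Y P); split; first by exists P.
have h := @poly_wave_embed 1 l (harmonic_Y P) P hP (fun t => erefl).
by rewrite scale1r in h.
Qed.

Lemma regular_embed (Phi : sections_on_R30 R) : Phi \in regular_pred F ->
  exists2 u, lapl u = 0 & Phi = embed u.
Proof.
rewrite inE => -[n [c [e [Se ->]]]].
have Su i : exists u, lapl u = 0 /\ e i = embed u.
  have [p [l [Y [[P [hP lP YP]] ->]]]] := Se i.
  exists (p *: lamconst P); split; last exact: poly_wave_embed.
  by rewrite laplZ lapl_lamconst [lapl P]lP lamconst0 scaler0.
have [u hu] := choice Su.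
exists (\sum_i (c i)%:P *: u i).
  by apply: lapl_sum0 => i; rewrite laplZ (hu i).1 scaler0.
by rewrite embed_sum; apply: eq_bigr => i _; rewrite embedZ (hu i).2.
Qed.

(* The coordinates of a section: the harmonic polynomial, with coefficients in
   [C[lambda]], of which it is the image. *)
Definition coordinates (Phi : regular F) : mpoly 3 D :=
  xget 0 [set u | lapl u = 0 /\ regular_fun Phi = embed u].

Lemma coordinatesP Phi : lapl (coordinates Phi) = 0 /\ regular_fun Phi = embed (coordinates Phi).
Proof.
rewrite /coordinates; case: xgetP => [u _ //|none].
by have [u hu eu] := regular_embed (valP Phi); case: (none u).
Qed.

(** For harmonic [u] the default value is not reached, by [embed_regular]. *)
Definition section_of (u : mpoly 3 D) : regular F := insubd 0 (embed u).

Lemma section_ofE u : lapl u = 0 -> regular_fun (section_of u) = embed u.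
Proof. by move=> hu; rewrite -[LHS]/(val (insubd 0 (embed u) : regular F)) insubdK // embed_regular. Qed.

Lemma embed_eq u v : embed u = embed v -> u = v.
Proof. by move=> e; apply/eqP; rewrite -subr_eq0; apply/eqP/embed_inj; rewrite embedB e subrr. Qed.

Lemma section_ofK u : lapl u = 0 -> coordinates (section_of u) = u.
Proof.
move=> hu; apply: embed_eq; rewrite -(section_ofE hu).
by rewrite (coordinatesP _).2.
Qed.

Lemma regular_eq (Phi Psi : regular F) : coordinates Phi = coordinates Psi -> Phi = Psi.
Proof.
move=> e; apply: val_inj; rewrite -[val Phi]/(regular_fun Phi) -[val Psi]/(regular_fun Psi).
by rewrite (coordinatesP Phi).2 e -(coordinatesP Psi).2.
Qed.

Lemma coordinates_linear : linear coordinates.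
Proof.
move=> c Phi Psi; apply: embed_eq; rewrite embedD embedZ.
by rewrite -!(coordinatesP _).2.
Qed.

HB.instance Definition _ :=
  GRing.isLinear.Build D (regular F) (mpoly 3 D) *:%R coordinates coordinates_linear.

Lemma coordinates_harmonic Phi : lapl (coordinates Phi) = 0.
Proof. by have [] := coordinatesP Phi. Qed.

End RegularFamily.

Section LinearMaps.
Variables (K : comNzRingType) (V W : lmodType K).
Implicit Types (f g : V -> V) (k : V -> W).

Lemma linear_fun0 k : linear k -> k 0 = 0.
Proof. by move=> kl; have := kl (-1) 0 0; rewrite scaler0 addr0 scaleN1r addNr. Qed.

Lemma linear_funD k u v : linear k -> k (u + v) = k u + k v.
Proof. by move=> kl; rewrite -[u in LHS]scale1r kl scale1r. Qed.

Lemma linear_funZ k c u : linear k -> k (c *: u) = c *: k u.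
Proof. by move=> kl; rewrite -[_ *: u]addr0 kl (linear_fun0 kl) addr0. Qed.

Lemma linear_funB k u v : linear k -> k (u - v) = k u - k v.
Proof. by move=> kl; rewrite -[- v]scaleN1r linear_funD // linear_funZ // scaleN1r. Qed.

Lemma linear_fun_sum k n (v : 'I_n -> V) : linear k -> k (\sum_i v i) = \sum_i k (v i).
Proof.
move=> kl; apply: (big_morph k _ (linear_fun0 kl)) => u w; exact: linear_funD.
Qed.

Lemma linear_fun_comb k s q l a b : linear k ->
  k (s *: (q *: a - l *: b)) = s *: (q *: k a - l *: k b).
Proof. by move=> kl; rewrite linear_funZ // linear_funB // !linear_funZ. Qed.

Lemma linear_comp f g : linear f -> linear g -> linear (fun v => f (g v)).
Proof. by move=> fl gl c u v; rewrite gl fl. Qed.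

Lemma linear_add f g : linear f -> linear g -> linear (fun v => f v + g v).
Proof. by move=> fl gl c u v; rewrite gl fl scalerDr addrACA. Qed.

Lemma linear_scale a f : linear f -> linear (fun v => a *: f v).
Proof. by move=> fl c u v; rewrite fl scalerDr !scalerA mulrC. Qed.

Lemma linear_sub f g : linear f -> linear g -> linear (fun v => f v - g v).
Proof. by move=> fl gl c u v; rewrite gl fl scalerBr opprD addrACA. Qed.

End LinearMaps.

(** * Operators acting on all fibres by one map over C[lambda] *)

Section Fibres.
Variables (K : numFieldType) (S : lmodType K) (sio : K -> mpoly 3 K -> S).
Local Notation D := {poly K}.
Hypothesis sio_linear : forall lam, linear (sio lam).
Hypothesis sio_inj : forall lam P, sio lam P = 0 -> P = 0.
Variable T : {linear S -> S}.
Hypothesis T_sio : forall lam P, lapl P = 0 -> T (sio lam P) = lam *: sio lam P.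

(* [X] acts on the fibre of the family at every [lambda] through the same map
   [h] of harmonic polynomials over [C[lambda]]. *)
Definition acts_by (X : S -> S) (h : mpoly 3 D -> mpoly 3 D) : Prop :=
  linear h /\ forall u, lapl u = 0 -> lapl (h u) = 0 /\
    forall lam, X (sio lam (lameval lam u)) = sio lam (lameval lam (h u)).

Lemma sioD lam P Q : sio lam (P + Q) = sio lam P + sio lam Q.
Proof. exact: linear_funD. Qed.

Lemma sio0 lam : sio lam 0 = 0.
Proof. exact: linear_fun0. Qed.

Lemma sioZ lam c P : sio lam (c *: P) = c *: sio lam P.
Proof. exact: linear_funZ. Qed.

Lemma sioB lam P Q : sio lam (P - Q) = sio lam P - sio lam Q.
Proof. exact: linear_funB. Qed.

(** On the fibre at lambda the operator T is the scalar lambda, so a coefficient in C[T] becomes the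
    corresponding polynomial in lambda. *)
Lemma poly_act_sio lam p P : lapl P = 0 -> poly_act T p (sio lam P) = p.[lam] *: sio lam P.
Proof.
move=> hP; have iterT i : iter i T (sio lam P) = lam ^+ i *: sio lam P.
  elim: i => [|i IHi]; first by rewrite scale1r.
  by rewrite iterS IHi linearZ /= T_sio // scalerA -exprSr.
rewrite /poly_act horner_coef scaler_suml; apply: eq_bigr => i _.
by rewrite iterT scalerA.
Qed.

Lemma acts_by0 : acts_by (fun=> 0) (fun=> 0).
Proof.
split=> [c u v|u _]; first by rewrite scaler0 addr0.
by split=> [|lam]; rewrite ?lapl0 // lameval0 sio0.
Qed.

Lemma acts_by_comb p X Y h k : acts_by X h -> acts_by Y k ->
  acts_by (fun f => poly_act T p (X f) + Y f) (fun u => p *: h u + k u).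
Proof.
move=> [hl hX] [kl kY]; split=> [c u v|u u0].
  by rewrite hl kl !scalerDr !scalerA [p * c]mulrC addrACA.
have [h0 eh] := hX u u0; have [k0 ek] := kY u u0; split=> [|lam].
  by rewrite laplD laplZ h0 k0 scaler0 addr0.
by rewrite eh ek poly_act_sio ?lapl_lameval ?h0 ?lameval0 // lamevalD lamevalZ sioD sioZ.
Qed.

Lemma acts_by_comm X Y h k : acts_by X h -> acts_by Y k ->
  acts_by (fun f => X (Y f) - Y (X f)) (fun u => h (k u) - k (h u)).
Proof.
move=> [hl hX] [kl kY]; split=> [c u v|u u0].
  by rewrite kl hl hl kl opprD addrACA scalerBr.
have [h0 eh] := hX u u0; have [k0 ek] := kY u u0.
have [hk0 ehk] := hX _ k0; have [kh0 ekh] := kY _ h0.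
split=> [|lam]; first by rewrite laplB hk0 kh0 subr0.
by rewrite ek ehk eh ekh lamevalB sioB.
Qed.

(** Injectivity on every fibre gives uniqueness, which transfers identities between operators to
    identities between the chosen maps. *)
Lemma acts_by_uniq X h k u : acts_by X h -> acts_by X k -> lapl u = 0 -> h u = k u.
Proof.
move=> [_ hX] [_ kX] u0; have [_ eh] := hX u u0; have [_ ek] := kX u u0.
apply/eqP; rewrite -subr_eq0; apply/eqP/lameval_eq0 => lam; apply: (sio_inj (lam := lam)).
by rewrite lamevalB sioB -eh -ek subrr.
Qed.

End Fibres.

Section FibreOperators.
Variables (R : realType) (gamma : R).
Local Notation C := R[i].
Hypothesis ent : forall l lam, centire (radial gamma l lam).
Local Notation siota := (siota ent).

Definition raise_scalar (l : nat) : C := (l.*2.+1%:R)^-1.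

Definition gen_runge i : mpoly 3 {poly C} -> mpoly 3 {poly C} :=
  runge ('i%C)%:P (raise_coef gamma) (polyC \o raise_scalar) i.

Lemma smul_spd_linear j k : linear (fun f => smul (sx R j) (spd k f)).
Proof. exact: (linear_comp (@smul_linear R (sx R j)) (@spd_linear R k)). Qed.

Lemma opL_linear i : linear (@opL R i).
Proof. exact: (linear_sub (smul_spd_linear (i + 1) (i + 2)) (smul_spd_linear (i + 2) (i + 1))). Qed.

Lemma opR_linear i : linear (@opR R gamma i).
Proof.
have l1 := linear_sub (linear_comp (@opL_linear (i + 2)) (@spd_linear R (i + 1)))
  (linear_comp (@opL_linear (i + 1)) (@spd_linear R (i + 2))).
have l2 := linear_scale gamma%:C%C (linear_comp (@smul_linear R (sx R i)) (@smul_linear R (sinvr R))).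
have l3 := linear_scale 'i%C (linear_add (linear_sub l1 (@spd_linear R i)) l2).
exact: l3.
Qed.

Lemma opT_siota lam (P : mpoly 3 C) : lapl P = 0 -> opT gamma (siota lam P) = lam *: siota lam P.
Proof.
move=> hP; rewrite {1}/siota (linear_sum (opT gamma)) scaler_sumr; apply: eq_bigr => l _ /=.
apply: opT_swave (pihomogP _ _ _) _; exact: lapl_pihomog.
Qed.

Lemma opL_siota i lam (P : mpoly 3 C) : opL i (siota lam P) = siota lam (rot i P).
Proof.
have -> : rot i P = \sum_(l < mmeasure mdeg P) rot i (pihomog mdeg l P).
  by rewrite {1}(sum_pihomog (leqnn (mmeasure mdeg P))); exact: linear_sum.
rewrite {1}/siota (linear_fun_sum _ (opL_linear i)) [RHS]linear_sum; apply: eq_bigr => l _.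
rewrite opL_swave; apply/esym/(siota_homog ent).
exact/rot_homog/pihomogP.
Qed.

Lemma opR_siota i lam (P : mpoly 3 C) : lapl P = 0 ->
  opR gamma i (siota lam P) =
  siota lam (runge 'i%C (fun l => (raise_coef gamma l).[lam]) raise_scalar i P).
Proof.
move=> hP; rewrite {1}/siota (linear_fun_sum _ (opR_linear i)) [RHS]linear_sum; apply: eq_bigr => l _.
have hl := pihomogP mdeg l P.
rewrite (opR_swave ent lam hl (lapl_pihomog _ hP) i).
apply/esym; have e := linear_fun_comb 'i%C (raise_coef gamma l).[lam] l%:R
  (raise (raise_scalar l) i (pihomog mdeg l P)) (mderiv i (pihomog mdeg l P)) (siota_linear ent lam).
apply: (etrans e); congr (_ *: (_ *: _ - _)).
  exact: siota_homog (raise_homog _ _ hl).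
move: {e} hl; case: (nat_of_ord l) => [|k] hl; first by rewrite !scale0r.
by congr (_ *: _); exact: siota_homog (mderiv_homog _ hl).
Qed.

Lemma gen_runge_harmonic i u : lapl u = 0 -> lapl (gen_runge i u) = 0.
Proof.
apply: lapl_runge => l.
by rewrite /= -[X in _ * X](rmorph_nat polyC) -polyCM mulVf // pnatr_eq0.
Qed.

Lemma lameval_gen_runge i lam u : lameval lam (gen_runge i u) =
  runge 'i%C (fun l => (raise_coef gamma l).[lam]) raise_scalar i (lameval lam u).
Proof. exact: lameval_runge. Qed.

Local Notation acts := (acts_by siota).

Lemma opL_acts i : acts (@opL R i) (rot i).
Proof.
split=> [|u u0]; first exact: rot_linear.
split=> [|lam]; first by rewrite lapl_rot u0 linear0.
by rewrite opL_siota lameval_rot.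
Qed.

Lemma opR_acts i : acts (@opR R gamma i) (gen_runge i).
Proof.
split=> [|u u0]; first exact: runge_linear.
split=> [|lam]; first exact: gen_runge_harmonic.
rewrite opR_siota; last by rewrite lapl_lameval u0 lameval0.
by rewrite lameval_gen_runge.
Qed.

End FibreOperators.

(** * Orthogonal group action *)

(** The number of l < N with f l a root is bounded by the size of p; once N attains the maximal
    number, no further root occurs. *)
Lemma root_bound (K : idomainType) (p : {poly K}) (f : nat -> K) : p != 0 -> injective f ->
  exists N, forall l, (N <= l)%N -> ~~ root p (f l).
Proof.
move=> p0 f_inj.
pose P k := `[< exists N, size [seq l <- iota 0 N | root p (f l)] = k >].
have P0 : exists k, P k by exists 0%N; apply/asboolP; exists 0%N.
have Pp k : P k -> (k <= size p)%N.
  move=> /asboolP[N <-]; rewrite -(size_map f).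
  apply/ltnW/max_poly_roots => //; last first.
    by rewrite map_inj_uniq // filter_uniq ?iota_uniq.
  by apply/allP => x /mapP[l]; rewrite mem_filter => /andP[pl _] ->.
case: (ex_maxnP P0 Pp) => k /asboolP[N Nk] kmax.
exists N => l Nl; apply/negP => pl.
have : P (size [seq l <- iota 0 l.+1 | root p (f l)]) by apply/asboolP; exists l.+1.
move/kmax; rewrite -Nk -addn1 iotaD filter_cat size_cat /= add0n pl addn1.
rewrite -(subnKC Nl) iotaD filter_cat size_cat.
by rewrite -addnS -{2}[size _]addn0 leq_add2l.
Qed.

Section OrthogonalAction.
Variable K : numFieldType.
Local Notation D := {poly K}.
Implicit Types (A B : 'M[K]_3).

Lemma det_orth A : A *m A^T = 1%:M -> \det A * \det A = 1.
Proof. by move=> /(congr1 determinant); rewrite det_mulmx det_tr det1. Qed.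

Lemma det_orthV A : A *m A^T = 1%:M -> (\det A)^-1 = \det A.
Proof.
move=> /det_orth d2; have d0 : \det A != 0.
  by apply: contra_eq_neq d2 => ->; rewrite mul0r eq_sym oner_neq0.
by apply: (mulfI d0); rewrite divff.
Qed.

(* For orthogonal [A] this is the rotation [(det A)^-1 A]. *)
Definition rotmx A : 'M[K]_3 := \det A *: A.

Lemma rotmx_orth A : A *m A^T = 1%:M -> rotmx A *m (rotmx A)^T = 1%:M.
Proof.
move=> hA; rewrite /rotmx linearZ /= -scalemxAl -scalemxAr scalerA hA.
by rewrite (det_orth hA) scale1r.
Qed.

Lemma det_rotmx A : A *m A^T = 1%:M -> \det (rotmx A) = 1.
Proof.
by move=> /det_orth d2; rewrite /rotmx detZ !exprS expr0 mulr1 d2 mulr1 d2.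
Qed.

Lemma rotmxM A B : rotmx (A *m B) = rotmx A *m rotmx B.
Proof. by rewrite /rotmx det_mulmx -scalemxAl -scalemxAr scalerA. Qed.

Lemma rotmx1 : rotmx 1%:M = 1%:M.
Proof. by rewrite /rotmx det1 scale1r. Qed.

Definition rotpmx A : 'M[D]_3 := map_mx polyC (rotmx A).

Lemma rotpmx_orth A : A *m A^T = 1%:M -> rotpmx A *m (rotpmx A)^T = 1%:M.
Proof.
by move=> /rotmx_orth h; rewrite /rotpmx map_trmx -map_mxM h map_mx1.
Qed.

Lemma det_rotpmx A : A *m A^T = 1%:M -> \det (rotpmx A) = 1.
Proof. by move=> /det_rotmx h; rewrite /rotpmx det_map_mx h. Qed.

(** A C[lambda]-linear map that is defined over the constants acts separately on the coefficient of
    each power of lambda. *)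
Lemma lamcoef_commute n (h : {linear mpoly n D -> mpoly n D})
    (h0 : {linear mpoly n K -> mpoly n K}) k u :
  (forall p, h (lamconst p) = lamconst (h0 p)) -> lamcoef k (h u) = h0 (lamcoef k u).
Proof.
move=> hh; rewrite {1}(sum_lamcoef (leqnn (lambda_size u))) linear_sum /=.
apply/mpolyP => m; rewrite mcoeff_lamcoef raddf_sum coef_sum /=.
have ec j : (mcoeff m (h ('X^j *: lamconst (lamcoef j u))))`_k =
   if k == j then mcoeff m (h0 (lamcoef j u)) else 0.
  rewrite linearZ /= hh mcoeffZ mcoeff_map_mpoly mulrC mul_polyC coefZ coefXn.
  by case: eqP; rewrite ?mulr1 ?mulr0.
under eq_bigr do rewrite ec.
have [kL|Lk] := ltnP k (lambda_size u).
  rewrite (bigD1 (Ordinal kL)) //= eqxx big1 ?addr0 // => j jk.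
  by case: eqP => // e; case/eqP: jk; apply/val_inj.
rewrite big1 => [|j _]; last by rewrite gtn_eqF // (leq_trans (ltn_ord j)).
have -> : lamcoef k u = 0; last by rewrite linear0 mcoeff0.
apply/mpolyP => m'; rewrite mcoeff_lamcoef mcoeff0.
case: (boolP (m' \in msupp u)) => mu; last by rewrite (memN_msupp_eq0 mu) coef0.
apply: nth_default; apply: leq_trans Lk.
by rewrite /lambda_size (big_rem m') //= leq_maxl.
Qed.

Lemma lamcoef_lsubst n (B : 'M[K]_n) k (u : mpoly n D) :
  lamcoef k (lsubst (map_mx polyC B) u) = lsubst B (lamcoef k u).
Proof. by apply: lamcoef_commute => p; rewrite /lamconst /= map_lsubst. Qed.

Lemma lamcoef_rot k i (u : mpoly 3 D) : lamcoef k (rot i u) = rot i (lamcoef k u).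
Proof. by apply: lamcoef_commute => p; rewrite /lamconst /= map_rot. Qed.

Lemma lamcoefC_scale n k c (u : mpoly n D) : lamcoef k (c%:P *: u) = c *: lamcoef k u.
Proof. by apply/mpolyP => m; rewrite mcoeff_lamcoef !mcoeffZ mcoeff_lamcoef coefCM. Qed.

Lemma lamcoef_sum n k (I : Type) (s : seq I) (f : I -> mpoly n D) :
  lamcoef k (\sum_(i <- s) f i) = \sum_(i <- s) lamcoef k (f i).
Proof.
apply/mpolyP => m; rewrite mcoeff_lamcoef !raddf_sum coef_sum /=.
by apply: eq_bigr => i _; rewrite mcoeff_lamcoef.
Qed.

Lemma lamcoef_eq n (u v : mpoly n D) : (forall k, lamcoef k u = lamcoef k v) -> u = v.
Proof.
move=> e; apply/mpolyP => m; apply/polyP => k.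
by rewrite -!mcoeff_lamcoef e.
Qed.

Lemma lamcoefN n k (u : mpoly n D) : lamcoef k (- u) = - lamcoef k u.
Proof. by apply/mpolyP => m; rewrite mcoeffN !mcoeff_lamcoef mcoeffN coefN. Qed.

Definition mxdiff (c : mpoly (3 * 3) K) (xi : 'M[K]_3) : K :=
  \sum_k mxvec xi 0 k * meval (mxvec 1%:M 0) (mderiv k c).

(** The difference of the two sides is linear in xi, so nilpotent xi suffice. For these the curve
    [mxexp xi] lies in the group, and evaluation at points reduces the claim to
    [deriv_lsubst_mxexp]. *)
Lemma infinitesimal_rot (s : K) p n (b : 'I_n -> mpoly 3 K) (c : 'I_n -> mpoly (3 * 3) K) :
  s ^+ 2 = -1 ->
  (forall A, A *m A^T = 1%:M ->
     lsubst (rotmx A) p = \sum_i meval (mxvec A 0) (c i) *: b i) ->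
  forall xi : 'M[K]_3, xi^T = - xi ->
  - \sum_i xi (i + 2) (i + 1) *: rot i p = \sum_i mxdiff (c i) xi *: b i.
Proof.
move=> s2 hp.
pose Z (xi : 'M[K]_3) :=
  - \sum_i xi (i + 2) (i + 1) *: rot i p - \sum_i mxdiff (c i) xi *: b i.
have Zl : linear Z.
  move=> a x y; rewrite /Z scalerBr scalerN !scaler_sumr addrACA -!opprD -!big_split /=.
  congr (- (_ + _)); apply: eq_bigr => i _.
    by rewrite !mxE scalerDl scalerA.
  rewrite scalerA -scalerDl; congr (_ *: _).
  rewrite /mxdiff mulr_sumr -big_split; apply: eq_bigr => k _ /=.
  by rewrite linearP !mxE mulrDl mulrA.
move=> xi xiT; apply/eqP; rewrite -subr_eq0; apply/eqP.
apply: (linear_so3_ind s2 Zl) xiT => {}xi xiT xi3.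
apply: mpoly_vanish => k; set y := (fun i => _).
have mS m (f : 'I_m -> K) (q : 'I_m -> mpoly 3 K) :
    meval y (\sum_i f i *: q i) = \sum_i f i * meval y (q i).
  by rewrite raddf_sum; apply: eq_bigr => i _; rewrite /= mevalZ.
have h t : meval y (lsubst (mxexp xi t) p) =
    \sum_i meval (mxvec (mxexp xi t) 0) (c i) * meval y (b i).
  rewrite -mS; have := hp _ (mxexp_orthogonal xiT xi3 t).
  by rewrite /rotmx (det_mxexp xiT xi3) scale1r => ->.
rewrite /Z mevalB mevalN !mS; apply/eqP; rewrite subr_eq0; apply/eqP.
exact: (deriv_lsubst_mxexp (b := fun i => meval y (b i)) xiT h).
Qed.

Lemma infinitesimal_rotD (s : K) u n (b : 'I_n -> mpoly 3 D) (c : 'I_n -> mpoly (3 * 3) K) :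
  s ^+ 2 = -1 ->
  (forall A, A *m A^T = 1%:M ->
     lsubst (rotpmx A) u = \sum_i (meval (mxvec A 0) (c i))%:P *: b i) ->
  forall xi : 'M[K]_3, xi^T = - xi ->
  - \sum_i (xi (i + 2) (i + 1))%:P *: rot i u = \sum_i (mxdiff (c i) xi)%:P *: b i.
Proof.
move=> s2 hu xi xiT; apply: lamcoef_eq => k.
rewrite lamcoefN !lamcoef_sum.
transitivity (- \sum_i xi (i + 2) (i + 1) *: rot i (lamcoef k u)).
  by congr (- _); apply: eq_bigr => i _; rewrite lamcoefC_scale lamcoef_rot.
rewrite (@infinitesimal_rot s _ n (fun i => lamcoef k (b i)) c) // => [|A hA].
  by apply: eq_bigr => i _; rewrite lamcoefC_scale.
rewrite -lamcoef_lsubst [lsubst _ u]hu // lamcoef_sum.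
by apply: eq_bigr => i _; rewrite lamcoefC_scale.
Qed.

End OrthogonalAction.

Lemma reindex_enum_val (I : finType) (V : zmodType) (f : I -> V) :
  \sum_x f x = \sum_(i < #|I|) f (enum_val i).
Proof.
by rewrite (reindex (fun i : 'I_#|I| => enum_val i)) //; apply/onW_bij/enum_val_bij.
Qed.

Section GenericRotation.
Variable K : numFieldType.

(** [rotmx] of the generic matrix. Using the determinant, which equals its inverse on O(3), keeps
    the entries polynomial, and the coefficients of the substituted polynomial are the matrix
    coefficients of the action. *)
Definition genrot : 'M[mpoly (3 * 3) K]_3 :=
  let X : 'M[mpoly (3 * 3) K]_3 := \matrix_(i, j) mpolyX K (mnm1 (mxvec_index i j)) in
  \det X *: X.

Lemma mcoeff_lsubst_rotmx (A : 'M[K]_3) m (p : mpoly 3 K) :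
  mcoeff m (lsubst (rotmx A) p) =
  meval (mxvec A 0) (mcoeff m (lsubst genrot (map_mpoly (@mpolyC (3 * 3) K) p))).
Proof.
pose f : {rmorphism mpoly (3 * 3) K -> K} := meval (mxvec A 0).
rewrite -[RHS]/(f _) -mcoeff_map_mpoly map_lsubst.
have -> : map_mx f genrot = rotmx A.
  rewrite /genrot map_mxZ -det_map_mx.
  have -> : map_mx f (\matrix_(i, j) mpolyX K (mnm1 (mxvec_index i j))) = A.
    by apply/matrixP => i j; rewrite !mxE /f /= mevalXU mxvecE.
  by [].
congr (mcoeff m (lsubst _ _)); apply/mpolyP => k.
by rewrite !mcoeff_map_mpoly /f /= mevalC.
Qed.

End GenericRotation.

Lemma dependent_choice (T U : nat -> nat -> Type)
    (P : forall l k, T l k -> U l k -> Prop) :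
  (forall l, exists k (h : T l k) (w : U l k), P l k h w) ->
  exists (k : nat -> nat) (h : forall l, T l (k l)) (w : forall l, U l (k l)),
    forall l, P l (k l) (h l) (w l).
Proof.
move=> hP; pose k l := projT1 (cid (hP l)).
have /(_ _)/cid hk l : exists (h : T l (k l)) (w : U l (k l)), P l (k l) h w.
  exact: projT2 (cid (hP l)).
pose h l := projT1 (hk l); have /(_ _)/cid hw l := projT2 (hk l).
by exists k, h, (fun l => projT1 (hw l)) => l; exact: projT2 (hw l).
Qed.

(** * Modules identified with harmonic polynomials over C[lambda] by [co], with inverse [se] *)

Section HarmonicModule.
Variables (K : numFieldType) (M : lmodType {poly K}).
Local Notation D := {poly K}.
Variables (co : M -> mpoly 3 D) (se : mpoly 3 D -> M).
Hypothesis co_linear : linear co.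
Hypothesis co_harmonic : forall v, lapl (co v) = 0.
Hypothesis co_se : forall u, lapl u = 0 -> co (se u) = u.
Hypothesis co_inj : injective co.
Implicit Types (A B : 'M[K]_3) (p h : mpoly 3 K) (u : mpoly 3 D) (v w : M).

Definition orth_act A v : M := se (lsubst (rotpmx A) (co v)).

Lemma coD v w : co (v + w) = co v + co w. Proof. exact: linear_funD. Qed.
Lemma coZ c v : co (c *: v) = c *: co v. Proof. exact: linear_funZ. Qed.
Lemma co0 : co 0 = 0. Proof. exact: linear_fun0. Qed.
Lemma co_sum n (v : 'I_n -> M) : co (\sum_i v i) = \sum_i co (v i).
Proof. exact: linear_fun_sum. Qed.

Lemma co_orth_act A v : A *m A^T = 1%:M -> co (orth_act A v) = lsubst (rotpmx A) (co v).
Proof.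
move=> hA; apply: co_se.
by rewrite lapl_lsubst ?rotpmx_orth // co_harmonic linear0.
Qed.

Lemma orth_act_linear A : A *m A^T = 1%:M -> linear (orth_act A).
Proof.
move=> hA c v w; apply: co_inj.
apply: (etrans (co_orth_act _ hA)); apply/esym/(etrans (co_linear _ _ _))/esym.
apply: (etrans (congr1 _ (co_linear c v w))); rewrite linearP.
congr (_ *: _ + _); apply/esym; [exact: (co_orth_act v hA)|exact: (co_orth_act w hA)].
Qed.

Lemma orth_act1 v : orth_act 1%:M v = v.
Proof.
apply: co_inj; rewrite co_orth_act ?trmx1 ?mulmx1 //.
by rewrite /rotpmx rotmx1 map_mx1 lsubst1.
Qed.

Lemma orth_actM A B v : A *m A^T = 1%:M -> B *m B^T = 1%:M ->
  orth_act (A *m B) v = orth_act A (orth_act B v).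
Proof.
move=> hA hB; apply: co_inj.
have hAB : (A *m B) *m (A *m B)^T = 1%:M.
  by rewrite trmx_mul mulmxA -(mulmxA A) hB mulmx1.
apply: (etrans (co_orth_act v hAB)); apply/esym/(etrans (co_orth_act (orth_act B v) hA)).
rewrite (co_orth_act v hB) /rotpmx rotmxM map_mxM; exact/esym/lsubst_mulmx.
Qed.

Lemma lin_span0 (S : set M) : lin_span S 0.
Proof. by exists 0%N, (fun=> 0), (fun=> 0); rewrite big_ord0; split=> // -[]. Qed.

Lemma lin_span_comb (S : set M) c v w : lin_span S v -> lin_span S w -> lin_span S (c *: v + w).
Proof.
move=> Sv Sw; have [_ h] := lin_spanP S.
have /asboolP := h c v w (asboolT Sv) (asboolT Sw); exact.
Qed.

Lemma lin_span_sum (S : set M) n (c : 'I_n -> D) (v : 'I_n -> M) :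
  (forall i, lin_span S (v i)) -> lin_span S (\sum_i c i *: v i).
Proof.
move=> Sv; elim/big_rec: _ => [|i w _ Sw]; [exact: lin_span0 | exact: lin_span_comb].
Qed.

Lemma lapl_lamconst0 p : lapl p = 0 -> lapl (lamconst p) = 0.
Proof. by move=> h0; rewrite lapl_lamconst h0 lamconst0. Qed.

Lemma dual_lamconst N k (w : bmultinom 3 N -> K) (c : 'I_k -> D) (p : 'I_k -> mpoly 3 K) :
  \sum_(m : bmultinom 3 N) (w m)%:P * mcoeff m (\sum_j c j *: lamconst (p j)) =
  \sum_j c j * (\sum_m w m * mcoeff m (p j))%:P.
Proof.
transitivity (\sum_(m : bmultinom 3 N) \sum_j c j * (w m * mcoeff m (p j))%:P).
  apply: eq_bigr => m _; rewrite raddf_sum mulr_sumr; apply: eq_bigr => j _ /=.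
  by rewrite mcoeffZ mcoeff_map_mpoly rmorphM /= mulrCA.
rewrite exchange_big; apply: eq_bigr => j _ /=.
by rewrite rmorph_sum mulr_sumr.
Qed.

(** Functionals dual to a family over K extend linearly to C[lambda], hence independence
    persists. *)
Lemma constant_indep N k (h : 'I_k -> mpoly 3 K) (w : 'I_k -> bmultinom 3 N -> K) :
  (forall i j, \sum_m w i m * mcoeff m (h j) = (i == j)%:R) ->
  forall c : 'I_k -> D, \sum_i c i *: lamconst (h i) = 0 -> forall i, c i = 0.
Proof.
move=> wh c c0 i; have := dual_lamconst (w i) c h.
rewrite c0 big1 => [|m _]; last by rewrite mcoeff0 mulr0.
have -> : \sum_j c j * (\sum_m w i m * mcoeff m (h j))%:P = \sum_j c j * (i == j)%:R%:P.
  by apply: eq_bigr => j _; rewrite wh.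
rewrite (bigD1 i) //= eqxx mulr1 big1 ?addr0 => [//|j ji].
by rewrite eq_sym (negPf ji) mulr0.
Qed.

Lemma lamconst_sum k (c : 'I_k -> K) (h : 'I_k -> mpoly 3 K) :
  lamconst (\sum_i c i *: h i) = \sum_i (c i)%:P *: lamconst (h i).
Proof. by rewrite /lamconst raddf_sum; apply: eq_bigr => i _ /=; exact: map_mpolyZ. Qed.

Lemma co_ind (Q : M -> Prop) : Q 0 ->
  (forall v w, Q v -> Q w -> Q (v + w)) -> (forall c v, Q v -> Q (c *: v)) ->
  (forall l p, p \is ishomog1 l mdeg -> lapl p = 0 -> Q (se (lamconst p))) ->
  forall v, Q v.
Proof.
move=> Q0 QD QZ QP v.
suff [w [/co_inj-> //]] : exists w, co w = co v /\ Q w.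
have := co_harmonic v; move: (co v).
apply: harmonic_ind => [|u u' [w [<- Qw]] [w' [<- Qw']]|c u [w [<- Qw]]|l p hp lp].
- by exists 0; rewrite co0.
- by exists (w + w'); rewrite coD; split=> //; exact: QD.
- by exists (c *: w); rewrite coZ; split=> //; exact: QZ.
by exists (se (lamconst p)); rewrite co_se ?lapl_lamconst0 //; split=> //; exact: QP hp lp.
Qed.

Lemma lin_indepN k (e : 'I_k -> M) :
  (forall c : 'I_k -> D, \sum_i c i *: co (e i) = 0 -> forall i, c i = 0) -> lin_indep e.
Proof.
move=> h c c0; apply: h; rewrite -[RHS]co0 -c0 co_sum.
by apply: eq_bigr => i _; rewrite coZ.
Qed.

(** The bound is [l.+1] because [mmeasure mdeg] of a nonzero polynomial exceeds its degree by
    one. *)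
Definition harmonic_basis l k (h : 'I_k -> mpoly 3 K) (w : 'I_k -> bmultinom 3 l.+1 -> K) :=
  [/\ forall i, h i \is ishomog1 l mdeg /\ lapl (h i) = 0,
      forall i j, \sum_m w i m * mcoeff m (h j) = (i == j)%:R
    & forall p, p \is ishomog1 l mdeg -> lapl p = 0 ->
        p = \sum_i (\sum_m w i m * mcoeff m p) *: h i].

Lemma harmonic_bases : exists (k : nat -> nat) (h : forall l, 'I_(k l) -> mpoly 3 K)
    (w : forall l, 'I_(k l) -> bmultinom 3 l.+1 -> K),
  forall l, harmonic_basis (h l) (w l).
Proof.
apply: (@dependent_choice (fun=> fun k => 'I_k -> mpoly 3 K)
  (fun l k => 'I_k -> bmultinom 3 l.+1 -> K) harmonic_basis) => l.
have S p : p \is ishomog1 l mdeg /\ lapl p = 0 -> (mmeasure mdeg p <= l.+1)%N.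
  move=> [/dhomogP hp _]; rewrite mmeasureE; apply/bigmax_leqP_seq => m /hp /= <- _.
  exact: leqnn.
have [k [h [w [h1 h2 h3]]]] := dual_basis S.
by exists k, h, w; split=> // p hp lp; exact: h3.
Qed.

Lemma harmonic_free : is_free M.
Proof.
have [k [h [w hw]]] := harmonic_bases.
pose hI (x : {l & 'I_(k l)}) := h (tag x) (tagged x).
have hS x : hI x \is ishomog1 (tag x) mdeg /\ lapl (hI x) = 0.
  by have [+ _ _] := hw (tag x); exact.
(* The functionals [w] may be nonzero on monomials of lower degree; cutting them off makes them
   vanish on basis elements of other degrees. *)
pose w' (x : {l & 'I_(k l)}) (m : bmultinom 3 (tag x).+1) :=
  if mdeg m == tag x then w (tag x) (tagged x) m else 0.
have w'E x y : \sum_m w' x m * mcoeff m (hI y) = (x == y)%:R.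
  rewrite /w' /hI; case: x y (hS y) => [l a] [l' b] /= [hom _].
  have [e|ll'] := eqVneq l' l.
    move: b hom; rewrite e => b hom; rewrite -tag_eqE /tag_eq eqxx /= tagged_asE.
    have [_ wh _] := hw l; rewrite -wh; apply: eq_bigr => m _.
    case: eqP => // /eqP ml; rewrite mul0r.
    by rewrite (dhomog_nemf_coeff hom) ?mulr0.
  rewrite -tag_eqE /tag_eq eq_sym (negPf ll') /= big1 // => m _.
  case: eqP => [ml|_]; last by rewrite mul0r.
  by rewrite (dhomog_nemf_coeff hom) ?mulr0 //= ml eq_sym.
pose b x := se (lamconst (hI x)).
have cob x : co (b x) = lamconst (hI x).
  by apply: co_se; apply: lapl_lamconst0; have [] := hS x.
exists (range b); split.
  apply/seteqP; split=> // v _; apply: (@co_ind (lin_span (range b))) v.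
  - exact: lin_span0.
  - by move=> v v' Sv Sv'; rewrite -[v]scale1r; exact: lin_span_comb.
  - move=> c v Sv; rewrite -[_ *: v]addr0; apply: lin_span_comb Sv _; exact: lin_span0.
  move=> l p hp lp; have [_ _ hspan] := hw l; have pE := hspan p hp lp.
  have -> : se (lamconst p) =
      \sum_i (\sum_m w l i m * mcoeff m p)%:P *: b (existT (fun l => 'I_(k l)) l i).
    apply: co_inj; rewrite (co_se (lapl_lamconst0 lp)) co_sum {1}pE lamconst_sum.
    by apply: eq_bigr => i _; rewrite coZ cob.
  by apply: lin_span_sum => i; apply: lin_span_gen; eexists.
move=> n e e_inj Be; apply: lin_indepN => c.
have /choice[t tb] : forall i, exists t, b t = e i.
  by move=> i; have [t _ <-] := Be i; exists t.
have -> : \sum_i c i *: co (e i) = \sum_i c i *: lamconst (hI (t i)).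
  by apply: eq_bigr => i _; rewrite -tb cob.
move=> c0 i; have := dual_lamconst (w' (t i)) c (fun j => hI (t j)).
rewrite c0 big1 => [|m _]; last by rewrite mcoeff0 mulr0.
have -> : \sum_j c j * (\sum_m w' (t i) m * mcoeff m (hI (t j)))%:P =
    \sum_j c j * (t i == t j)%:R%:P.
  by apply: eq_bigr => j _; rewrite w'E.
rewrite (bigD1 i) //= eqxx mulr1 big1 ?addr0 => [//|j ji].
case: eqP => [tij|_]; last by rewrite mulr0.
by case/eqP: ji; apply: e_inj; rewrite -!tb tij.
Qed.

Lemma orth_act_algebraic v : exists n (e : 'I_n -> M) (c : 'I_n -> 'I_n -> mpoly (3 * 3) K),
  [/\ forall b : 'I_n -> K, \sum_i (b i)%:P *: e i = 0 -> forall i, b i = 0,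
      const_span (range e) v
    & forall A, A *m A^T = 1%:M -> forall j,
        orth_act A (e j) = \sum_i (meval (mxvec A 0) (c i j))%:P *: e i].
Proof.
suff [I [e [c [e1 [a e2] e3]]]] : exists (I : finType) (e : I -> M) (c : I -> I -> mpoly (3 * 3) K),
  [/\ forall b : I -> K, \sum_i (b i)%:P *: e i = 0 -> forall i, b i = 0,
      exists a : I -> K, v = \sum_i (a i)%:P *: e i
    & forall A, A *m A^T = 1%:M -> forall j,
        orth_act A (e j) = \sum_i (meval (mxvec A 0) (c i j))%:P *: e i].
  exists #|I|, (e \o enum_val), (fun i j => c (enum_val i) (enum_val j)); split.
  - move=> b b0 i; rewrite -(enum_valK i); apply: (e1 (fun x => b (enum_rank x))).
    by rewrite reindex_enum_val -[RHS]b0; apply: eq_bigr => j _; rewrite enum_valK.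
  - exists #|I|, (a \o enum_val), (e \o enum_val); split=> [i|]; first by exists i.
    by rewrite e2 reindex_enum_val.
  by move=> A hA j; rewrite /= (e3 A hA) reindex_enum_val.
pose N := mmeasure mdeg (co v); pose L := lambda_size (co v).
pose S p := lapl p = 0 /\ (mmeasure mdeg p <= N)%N.
have SN p : S p -> (mmeasure mdeg p <= N)%N by case.
have [k [h [w [hS wh hspan]]]] := dual_basis SN.
(* Powers of lambda below [L] times a basis of the harmonic polynomials of bounded degree: they span
   a finite dimensional stable complex space that contains [v]. *)
pose e (x : 'I_L * 'I_k) : M := 'X^(x.1) *: se (lamconst (h x.2)).
have eE x : co (e x) = 'X^(x.1) *: lamconst (h x.2).
  by rewrite /e coZ co_se // lapl_lamconst (hS x.2).1 lamconst0.
(* The group commutes with multiplication by lambda, so the matrix is block diagonal in the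
   exponent. *)
pose c (x y : 'I_L * 'I_k) : mpoly (3 * 3) K := if x.1 == y.1 then
  \sum_m w x.2 m *: mcoeff m (lsubst (genrot K) (map_mpoly (@mpolyC (3 * 3) K) (h y.2))) else 0.
have coS (b : 'I_L * 'I_k -> K) : co (\sum_x (b x)%:P *: e x) =
    \sum_i (\sum_(j < L) (b (j, i))%:P * 'X^j) *: lamconst (h i).
  transitivity (\sum_x (b (x.1, x.2))%:P *: ('X^(x.1) *: lamconst (h x.2))).
    rewrite reindex_enum_val co_sum [RHS]reindex_enum_val.
    by apply: eq_bigr => i _; rewrite coZ eE -surjective_pairing.
  rewrite -(pair_bigA _ (fun j i => (b (j, i))%:P *: ('X^j *: lamconst (h i)))) exchange_big /=.
  by apply: eq_bigr => i _; rewrite scaler_suml; apply: eq_bigr => j _; rewrite scalerA.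
have spanS p (Sp : S p) : lamconst p = \sum_i (\sum_m w i m * mcoeff m p)%:P *: lamconst (h i).
  by rewrite {1}(hspan p Sp) lamconst_sum.
exists ('I_L * 'I_k)%type, e, c; split.
- move=> b b0 [j i].
  have := coS b; rewrite b0 co0 => /esym/(constant_indep wh)/(_ i).
  move=> /(congr1 (fun p : D => p`_j)); rewrite coef0 coef_sum (bigD1 j) //= big1 ?addr0.
    by rewrite coefCM coefXn eqxx mulr1.
  move=> j' jj'; rewrite coefCM coefXn; case: eqP => [E|_]; last by rewrite mulr0.
  by case/eqP: jj'; apply/val_inj.
- exists (fun x : 'I_L * 'I_k => \sum_m w x.2 m * mcoeff m (lamcoef x.1 (co v))).
  apply: co_inj; rewrite coS {1}(sum_lamcoef (leqnn (lambda_size (co v)))) -/L.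
  transitivity (\sum_(j < L) 'X^j *: (\sum_i (\sum_m w i m * mcoeff m (lamcoef j (co v)))%:P *:
      lamconst (h i))).
    apply: eq_bigr => j _; congr (_ *: _); apply: spanS; split.
      by rewrite lapl_lamcoef co_harmonic; apply/mpolyP => m; rewrite mcoeff_lamcoef !mcoeff0 coef0.
    rewrite mmeasureE; apply/bigmax_leqP_seq => m; rewrite mcoeff_msupp mcoeff_lamcoef => mj _.
    apply: mmeasure_mnm_lt; rewrite mcoeff_msupp; apply: contra mj => /eqP ->.
    by rewrite coef0.
  under eq_bigr => j _ do rewrite scaler_sumr.
  rewrite exchange_big; apply: eq_bigr => i _ /=.
  by rewrite scaler_suml; apply: eq_bigr => j _; rewrite scalerA mulrC.
move=> A hA [j0 i0]; apply: co_inj; rewrite coS (co_orth_act _ hA) eE /=.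
have Sr : S (lsubst (rotmx A) (h i0)).
  split; first by rewrite (lapl_lsubst _ (rotmx_orth hA)) (hS i0).1 linear0.
  exact: leq_trans (msize_lsubst _ _) (hS i0).2.
rewrite lsubstZ; have -> : lsubst (rotpmx A) (lamconst (h i0)) = lamconst (lsubst (rotmx A) (h i0)).
  by rewrite /lamconst map_lsubst.
rewrite (spanS _ Sr) scaler_sumr; apply: eq_bigr => i _.
rewrite scalerA; congr (_ *: _).
rewrite [in RHS](bigD1 j0) //= [X in _ = _ + X]big1 ?addr0 => [|j jj0]; last first.
  by rewrite /c /= (negPf jj0) meval0 mul0r.
rewrite mulrC /c eqxx; congr (_%:P * _).
rewrite raddf_sum; apply: eq_bigr => m _ /=.
by rewrite mevalZ mcoeff_lsubst_rotmx.
Qed.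

Section Isotypic.
Variables (n : nat) (rho : 'M[K]_3 -> 'M[K]_n) (c : 'I_n -> 'I_n -> mpoly (3 * 3) K).
Hypothesis rhoE : forall A, A *m A^T = 1%:M ->
  forall i j, rho A i j = meval (mxvec A 0) (c i j).

Definition equivariant (e : 'I_n -> M) : Prop := forall A, A *m A^T = 1%:M ->
  forall j, orth_act A (e j) = \sum_i (rho A i j)%:P *: e i.

(** The matrix by which [rot k] acts on an equivariant family; the sign is that of the infinitesimal
    action on functions. *)
Definition so3_matrix k : 'M[K]_n := \matrix_(i, j) (- mxdiff (c i j) (rot_gen K k)).

Definition casimir_matrix : 'M[K]_n := \sum_k so3_matrix k *m so3_matrix k.

Variable s : K.
Hypothesis s2 : s ^+ 2 = -1.

Lemma equivariant_rot e k j : equivariant e ->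
  rot k (co (e j)) = \sum_i (so3_matrix k i j)%:P *: co (e i).
Proof.
move=> he; have hu A : A *m A^T = 1%:M -> lsubst (rotpmx A) (co (e j)) =
    \sum_i (meval (mxvec A 0) (c i j))%:P *: co (e i).
  move=> hA; rewrite -(co_orth_act _ hA) he // co_sum; apply: eq_bigr => i _.
  by rewrite coZ rhoE.
have := infinitesimal_rotD s2 hu (rot_gen_tr K k).
rewrite (bigD1 k) //= big1 ?addr0 => [|i ik]; last first.
  rewrite (_ : rot_gen K k (i + 2) (i + 1) = 0) ?scale0r //.
  move: ik; rewrite /rot_gen !mxE.
  by case: (ord3_cases i) => ->; case: (ord3_cases k) => -> //= _; rewrite subrr.
rewrite (_ : rot_gen K k (k + 2) (k + 1) = 1); last first.
  rewrite /rot_gen !mxE.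
  by case: (ord3_cases k) => -> /=; rewrite subr0.
rewrite scale1r => /(congr1 -%R); rewrite opprK => ->.
rewrite -sumrN; apply: eq_bigr => i _; rewrite !mxE.
by rewrite rmorphN scaleNr.
Qed.

Lemma equivariant_casimir e m j : equivariant e ->
  - (mdeg m * (mdeg m).+1)%:R * mcoeff m (co (e j)) =
  \sum_i (casimir_matrix i j)%:P * mcoeff m (co (e i)).
Proof.
move=> he; rewrite -mcoeff_casimir //.
have -> : \sum_k rot k (rot k (co (e j))) = \sum_i (casimir_matrix i j)%:P *: co (e i).
  transitivity (\sum_k \sum_i ((so3_matrix k *m so3_matrix k) i j)%:P *: co (e i)).
    apply: eq_bigr => k _; rewrite (equivariant_rot k j he) linear_sum.
    transitivity (\sum_i \sum_l (so3_matrix k i j)%:P *: ((so3_matrix k l i)%:P *: co (e l))).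
      by apply: eq_bigr => i _; rewrite linearZ /= (equivariant_rot k i he) scaler_sumr.
    rewrite exchange_big; apply: eq_bigr => l _ /=.
    rewrite mxE rmorph_sum scaler_suml; apply: eq_bigr => i _.
    by rewrite scalerA rmorphM mulrC.
  rewrite exchange_big; apply: eq_bigr => i _ /=.
  by rewrite -scaler_suml -rmorph_sum summxE.
by rewrite raddf_sum; apply: eq_bigr => i _; rewrite /= mcoeffZ.
Qed.

Lemma equivariant_bounded : exists N, forall e j p, equivariant e ->
  co (e j) = lamconst p -> (mmeasure mdeg p <= N)%N.
Proof.
pose ev l : K := - (l * l.+1)%:R.
have ev_inj : injective ev.
  move=> l l' /oppr_inj/eqP; rewrite eqr_nat => /eqP; clear; nia.
have [N hN] := root_bound (monic_neq0 (char_poly_monic casimir_matrix)) ev_inj.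
exists N => e j p he ep; rewrite mmeasureE; apply/bigmax_leqP_seq => m mp _ /=.
rewrite ltnNge; apply/negP => Nm.
have := hN _ Nm; rewrite -eigenvalue_root_char => /negP; apply.
(* Only [co (e j)] is known to be constant in lambda. Taking constant terms gives an eigenvector
   over K, and its entry of index j, the coefficient of [m] in [p], is nonzero. *)
apply/eigenvalueP; exists (\row_i (mcoeff m (co (e i)))`_0).
  apply/rowP => i; rewrite !mxE.
  have := congr1 (fun q : D => q`_0) (equivariant_casimir m i he).
  rewrite -(rmorph_nat polyC) -rmorphN coefCM coef_sum => e1.
  apply: (etrans _ (esym e1)); apply: eq_bigr => k _.
  by rewrite coefCM mxE mulrC.
apply/negP => /eqP/rowP/(_ j); rewrite !mxE ep mcoeff_map_mpoly coefC /= => /eqP.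
by rewrite mcoeff_eq0 mp.
Qed.

(** The matrices of [rho] do not depend on lambda, so an equivariant map splits into its
    lambda-coefficients. *)
Lemma equivariant_lamcoef e k : equivariant e ->
  equivariant (fun j => se (lamconst (lamcoef k (co (e j))))).
Proof.
move=> he A hA j; have lc0 i : lapl (lamconst (lamcoef k (co (e i)))) = 0.
  rewrite lapl_lamconst lapl_lamcoef co_harmonic.
  by apply/mpolyP => m; rewrite mcoeff_map_mpoly mcoeff_lamcoef !mcoeff0 coef0.
apply: co_inj; rewrite (co_orth_act _ hA) (co_se (lc0 j)) co_sum.
rewrite /lamconst /rotpmx -map_lsubst -lamcoef_lsubst -/(rotpmx A) -(co_orth_act _ hA) he //.
rewrite co_sum lamcoef_sum raddf_sum; apply: eq_bigr => i _.
rewrite (coZ (rho A i j)%:P (e i)) (coZ _ (se _)) (co_se (lc0 i)).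
have -> := lamcoefC_scale k (rho A i j) (co (e i)).
exact: lamconstZ.
Qed.

Lemma equivariant_scale e q : equivariant e -> equivariant (fun j => q *: e j).
Proof.
move=> he A hA j; rewrite (linear_funZ q (e j) (orth_act_linear hA)) he // scaler_sumr.
by apply: eq_bigr => i _; rewrite !scalerA mulrC.
Qed.

Lemma isotypic_fg_free :
  is_fg_free (const_span [set v | exists2 e, equivariant e & exists j, v = e j]).
Proof.
have [N hN] := equivariant_bounded.
(* The isotypic vectors that are constant in lambda. Their degrees are bounded, and by
   [equivariant_lamcoef] they generate the isotypic part over C[lambda]. *)
pose S p := exists e j, equivariant e /\ co (e j) = lamconst p.
have SN p : S p -> (mmeasure mdeg p <= N)%N by move=> [e [j [he ep]]]; exact: hN he ep.
have Sl p : S p -> lapl p = 0.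
  move=> [e [j [he ep]]]; have := co_harmonic (e j); rewrite ep lapl_lamconst.
  by move=> /(congr1 (lameval 0)); rewrite lameval_lamconst lameval0.
have [k [h [w [hS wh hspan]]]] := dual_basis SN.
pose b i := se (lamconst (h i)).
have cob i : co (b i) = lamconst (h i) by apply: co_se; apply: lapl_lamconst0; exact: Sl.
exists k, b; split.
  apply: lin_indepN => a; have -> : \sum_i a i *: co (b i) = \sum_i a i *: lamconst (h i).
    by apply: eq_bigr => i _; rewrite cob.
  exact: constant_indep wh a.
apply/seteqP; split=> v.
  (* A coefficient in C[lambda] cannot be a constant scalar of [const_span]; it is absorbed into the
     equivariant map instead. *)
  move=> [t [a [x [xb ->]]]]; exists t, (fun=> 1), (fun i => a i *: x i); split; last first.
    by apply: eq_bigr => i _; rewrite scale1r.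
  move=> i; have [i0 _ <-] := xb i; have [e [j [he ep]]] := hS i0.
  exists (fun j => a i *: e j); first exact: equivariant_scale.
  by exists j; congr (_ *: _); apply: co_inj; rewrite cob ep.
move=> [t [a [x [xe ->]]]]; apply: lin_span_sum => i.
have [e he [j ->]] := xe i.
have -> : e j = \sum_(l < lambda_size (co (e j))) 'X^l *: se (lamconst (lamcoef l (co (e j)))).
  apply: co_inj; rewrite co_sum {1}(sum_lamcoef (leqnn (lambda_size (co (e j))))).
  apply: eq_bigr => l _; rewrite coZ co_se // lapl_lamconst lapl_lamcoef co_harmonic.
  by apply/mpolyP => m; rewrite mcoeff_map_mpoly mcoeff_lamcoef !mcoeff0 coef0.
apply: lin_span_sum => l; set p := lamcoef l _.
have Sp : S p.
  exists (fun j => se (lamconst (lamcoef l (co (e j))))), j; split.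
    exact: equivariant_lamcoef.
  apply: co_se; rewrite lapl_lamconst lapl_lamcoef co_harmonic.
  by apply/mpolyP => m; rewrite mcoeff_map_mpoly mcoeff_lamcoef !mcoeff0 coef0.
have -> : se (lamconst p) = \sum_i (\sum_m w i m * mcoeff m p)%:P *: b i.
  apply: co_inj; rewrite (co_se (lapl_lamconst0 (Sl _ Sp))) co_sum {1}(hspan _ Sp) lamconst_sum.
  by apply: eq_bigr => i' _; rewrite coZ cob.
by apply: lin_span_sum => i'; apply: lin_span_gen; eexists.
Qed.

End Isotypic.

End HarmonicModule.

(** * The family of Harish-Chandra modules *)

Section RegularAction.
Variables (R : realType) (gamma : R) (F : nat -> R[i] -> R -> R[i]).
Local Notation C := R[i].
Local Notation D := {poly C}.
Hypothesis F_regular : forall l lam, is_regular_solution gamma l lam (F l lam).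

Local Notation ent := (radial_entire F_regular).
Local Notation siota := (siota ent).
Local Notation coordinates := (coordinates F_regular).
Local Notation section_of := (section_of F_regular).
Local Notation embed := (embed F_regular).
Local Notation acts := (acts_by siota).

Lemma acts_lin_span n (c : 'I_n -> D) (e : 'I_n -> operator_for gamma) :
  (forall i, @galg_gens R gamma (e i)) -> exists h, acts (\sum_i c i *: e i) h.
Proof.
elim: n c e => [|n IHn] c e Se.
  by rewrite big_ord0; eexists; exact: acts_by0 (siota_linear ent).
have [h hS] := IHn (c \o lift ord0) (e \o lift ord0) (fun i => Se _).
have [k kE] : exists k, acts (e ord0) k.
  case: (Se ord0) => -[i _ <-]; first by exists (rot i); exact: opL_acts.
  by exists (gen_runge gamma i); exact: opR_acts.
rewrite big_ord_recl; eexists.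
exact: (acts_by_comb (siota_linear ent) (opT_siota ent) (c ord0) kE hS).
Qed.

Lemma galg_acts (X : galg gamma) : exists h, acts (galg_op X) h.
Proof.
have /asboolP[n [c [e [Se eX]]]] := valP X.
have [h hX] := acts_lin_span c Se; exists h.
by rewrite -[galg_op X]/(val X) eX.
Qed.

(** A chosen map; on harmonic polynomials it does not depend on the choice, by [acts_by_uniq]. *)
Definition gop (X : galg gamma) : mpoly 3 D -> mpoly 3 D := projT1 (cid (galg_acts X)).

Lemma gopP X : acts (galg_op X) (gop X).
Proof. exact: projT2 (cid (galg_acts X)). Qed.

Lemma gop_eq X h u : acts (galg_op X) h -> lapl u = 0 -> gop X u = h u.
Proof. by move=> hX; exact: (acts_by_uniq (siota_linear ent) (@siota_inj _ _ ent)) (gopP X) hX. Qed.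

Definition gact (X : galg gamma) (Phi : regular F) : regular F :=
  section_of (gop X (coordinates Phi)).

Lemma coordinates_gact X Phi : coordinates (gact X Phi) = gop X (coordinates Phi).
Proof. by apply: section_ofK; have [_ /(_ _ (coordinates_harmonic F_regular Phi))[]] := gopP X. Qed.

Lemma galg_wave_embed (X : galg gamma) p l (Y : S2 R -> C) (P : mpoly 3 C) :
  P \is ishomog1 l mdeg -> lapl P = 0 ->
  (forall t : S2 R, Y t = meval (fun i => (val t i 0)%:C%C) P) ->
  galg_wave F X p l Y = embed (p *: gop X (lamconst P)).
Proof.
move=> hP lP YP; rewrite embedZ; apply/funext => lam; apply/funext => x.
have u0 : lapl (lamconst P) = 0 by rewrite lapl_lamconst lP lamconst0.
have [_ eX] := (gopP X).2 _ u0.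
rewrite /galg_wave (wave_swave F_regular lam hP YP) /op_apply.
have -> : insubd 0 (smooth_fun (siota lam P)) = siota lam P by exact: valKd.
by have := eX lam; rewrite lameval_lamconst => ->.
Qed.

Lemma galg_wave_regular (X : galg gamma) p l (Y : S2 R -> C) :
  spherical_harmonic l Y -> galg_wave F X p l Y \in regular_pred F.
Proof.
move=> [P [hP lP YP]]; rewrite (galg_wave_embed X p hP lP YP); apply: embed_regular.
have u0 : lapl (lamconst P) = 0 by rewrite lapl_lamconst [lapl P]lP lamconst0.
by have [h0 _] := (gopP X).2 _ u0; rewrite laplZ h0 scaler0.
Qed.

Lemma gact_wave X p l (Y : S2 R -> C) (Phi : regular F) : spherical_harmonic l Y ->
  regular_fun Phi = poly_wave F p l Y -> regular_fun (gact X Phi) = galg_wave F X p l Y.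
Proof.
move=> [P [hP lP YP]] eP; rewrite (coordinatesP F_regular (gact X Phi)).2 coordinates_gact.
rewrite (galg_wave_embed X p hP lP YP).
have -> : coordinates Phi = p *: lamconst P.
  apply: (embed_eq (F_regular := F_regular)).
  by rewrite -(coordinatesP F_regular Phi).2 eP (poly_wave_embed F_regular p hP YP).
have [gl _] := gopP X.
by congr embed; exact: linear_funZ.
Qed.

End RegularAction.

Lemma lameval_lsubst (K : numFieldType) n t (B : 'M[K]_n) (u : mpoly n {poly K}) :
  lameval t (lsubst (map_mx polyC B) u) = lsubst B (lameval t u).
Proof.
rewrite /lameval map_lsubst; congr (lsubst _ _).
by apply/matrixP => i j; rewrite !mxE; exact: hornerC.
Qed.

Lemma lsubst_generators (K : numFieldType) s q d (A : 'M[K]_3)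
    (a b : 'cV[{poly K}]_3) (u : mpoly 3 {poly K}) : A *m A^T = 1%:M ->
  lsubst (rotpmx A) (\sum_i (a i 0 *: rot i u + b i 0 *: runge s q d i u)) =
  \sum_i ((rotpmx A *m a) i 0 *: rot i (lsubst (rotpmx A) u) +
          (rotpmx A *m b) i 0 *: runge s q d i (lsubst (rotpmx A) u)).
Proof.
move=> hA; have B1 := rotpmx_orth hA; have d1 := det_rotpmx hA.
move: (rotpmx A) B1 d1 => B BB d1.
have comb (e : 'cV[{poly K}]_3) (f : 'I_3 -> mpoly 3 {poly K}) :
    \sum_i e i 0 *: (\sum_k B k i *: f k) = \sum_i (B *m e) i 0 *: f i.
  transitivity (\sum_i \sum_k (B k i * e i 0) *: f k).
    by apply: eq_bigr => i _; rewrite scaler_sumr; apply: eq_bigr => k _; rewrite scalerA mulrC.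
  by rewrite exchange_big; apply: eq_bigr => k _ /=; rewrite mxE scaler_suml.
rewrite [RHS]big_split -!comb -big_split linear_sum; apply: eq_bigr => i _.
by rewrite linearD !linearZ /= (lsubst_rot BB d1) (lsubst_runge _ _ _ _ _ BB).
Qed.

Section Family.
Variables (R : realType) (gamma : R) (F : nat -> R[i] -> R -> R[i]).
Local Notation C := R[i].
Local Notation D := {poly C}.
Hypothesis F_regular : forall l lam, is_regular_solution gamma l lam (F l lam).

Local Notation ent := (radial_entire F_regular).
Local Notation siota := (siota ent).
Local Notation coordinates := (coordinates F_regular).
Local Notation section_of := (section_of F_regular).
Local Notation embed := (embed F_regular).
Local Notation gact := (gact F_regular).
Local Notation gop := (gop F_regular).
Local Notation acts := (acts_by siota).

Definition kact (A : 'M[C]_3) (Phi : regular F) : regular F :=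
  orth_act coordinates section_of A Phi.

Lemma coordinates_inj : injective coordinates.
Proof. by move=> Phi Psi; exact: regular_eq. Qed.

Lemma O3_orth (A : 'M[C]_3) : A \in @O3 R -> A *m A^T = 1%:M.
Proof. by rewrite inE => /eqP. Qed.

Lemma coordinates_kact A Phi : A *m A^T = 1%:M ->
  coordinates (kact A Phi) = lsubst (rotpmx A) (coordinates Phi).
Proof.
exact: (co_orth_act (coordinates_harmonic F_regular) (section_ofK F_regular)).
Qed.

(** The combination of the maps chosen for [X] and [Y] also realises [p *: X + Y], so uniqueness
    identifies it with the chosen one. *)
Lemma gop_linear u : lapl u = 0 -> linear (fun X : galg gamma => gop X u).
Proof.
move=> u0 p X Y.
have h := acts_by_comb (siota_linear ent) (opT_siota ent) p (gopP F_regular X) (gopP F_regular Y).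
exact: (gop_eq (X := p *: X + Y) h u0).
Qed.

Lemma gop_gL i u : lapl u = 0 -> gop (gL gamma i) u = rot i u.
Proof. by apply: gop_eq; exact: opL_acts. Qed.

Lemma gop_gR i u : lapl u = 0 -> gop (gR gamma i) u = gen_runge gamma i u.
Proof. by apply: gop_eq; exact: opR_acts. Qed.

Lemma gop_gcomb a b u : lapl u = 0 -> gop (gcomb gamma a b) u =
  \sum_i (a i 0 *: rot i u + b i 0 *: gen_runge gamma i u).
Proof.
move=> u0; have l := gop_linear u0.
apply: (etrans (linear_fun_sum _ l)); apply: eq_bigr => i _.
apply: (etrans (l _ _ _)); congr (_ *: _ + _); first exact: gop_gL.
by apply: (etrans (linear_funZ _ _ l)); congr (_ *: _); exact: gop_gR.
Qed.

Lemma gop_so3 xi u : lapl u = 0 -> gop (so3_galg gamma xi) u =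
  - \sum_i (xi (i + 2) (i + 1))%:P *: rot i u.
Proof.
move=> u0; have l := gop_linear u0; rewrite /so3_galg -scaleN1r.
apply: (etrans (linear_funZ _ _ l)); rewrite scaleN1r; congr (- _).
apply: (etrans (linear_fun_sum _ l)); apply: eq_bigr => i _.
by apply: (etrans (linear_funZ _ _ l)); congr (_ *: _); exact: gop_gL.
Qed.

Lemma regular_HC_family : HC_family kact gact.
Proof.
have cl := coordinates_linear F_regular; have ch := coordinates_harmonic F_regular.
have cs := section_ofK F_regular; have ci := coordinates_inj.
have s2 : ('i%C : C) ^+ 2 = -1 by exact: sqr_i.
split.
- exact: (harmonic_free cl ch cs ci).
- move=> A /O3_orth hA p v w; exact: (orth_act_linear cl ch cs ci hA).
- exact: (orth_act1 ch cs ci).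
- move=> A B /O3_orth hA /O3_orth hB v; exact: (orth_actM ch cs ci v hA hB).
- move=> v; have [n [e [c [e1 e2 e3]]]] := orth_act_algebraic cl ch cs ci v.
  by exists n, e, c; split=> // A /O3_orth; exact: e3.
- move=> n rho [_ _ _ [c rhoE] _].
  have rhoE' A : A *m A^T = 1%:M -> forall i j, rho A i j = meval (mxvec A 0) (c i j).
    by move=> hA; apply: rhoE; rewrite inE; apply/eqP.
  have := isotypic_fg_free cl ch cs ci rhoE' s2; congr (is_fg_free (const_span _)).
  apply/seteqP; split=> v [e he ej]; exists e => // A hA; apply: he.
    by exact: O3_orth.
  by rewrite inE; apply/eqP.
- move=> p X Y v; apply: ci; apply: (etrans (coordinates_gact _ _ _)).
  apply: (etrans (gop_linear (ch v) p X Y)); apply/esym/(etrans (cl _ _ _)).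
  by congr (_ *: _ + _); exact: coordinates_gact.
- move=> X p v w; apply: ci; apply: (etrans (coordinates_gact _ _ _)).
  have [gl _] := gopP F_regular X.
  apply: (etrans (congr1 (gop X) (cl p v w))); apply: (etrans (gl _ _ _)).
  apply/esym/(etrans (cl _ _ _)).
  by congr (_ *: _ + _); exact: coordinates_gact.
- move=> X Y Z v eZ; apply: ci; apply: (etrans (coordinates_gact _ _ _)).
  (* The operator of [Z] is the commutator of those of [X] and [Y], hence realised by the commutator
     of their maps. *)
  have h := acts_by_comm (siota_linear ent) (gopP F_regular X) (gopP F_regular Y).
  apply: (etrans (gop_eq (X := Z) (h := fun u => gop X (gop Y u) - gop Y (gop X u)) _ (ch v))).
    by rewrite eZ.
  apply/esym/(etrans (linear_funB _ _ cl)); congr (_ - _).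
    exact: (etrans (coordinates_gact _ _ _) (congr1 _ (coordinates_gact _ _ _))).
  exact: (etrans (coordinates_gact _ _ _) (congr1 _ (coordinates_gact _ _ _))).
- move=> A /O3_orth hA a b v.
  have Ad e : Ad3 A e = rotpmx A *m e by rewrite /Ad3 (det_orthV hA).
  rewrite (Ad a) (Ad b); apply: ci; apply: (etrans (coordinates_kact _ hA)).
  apply/esym/(etrans (coordinates_gact _ _ _)).
  apply: (etrans (gop_gcomb _ _ (ch _))).
  pose G u := \sum_i ((rotpmx A *m a) i 0 *: rot i u + (rotpmx A *m b) i 0 *: gen_runge gamma i u).
  apply: (etrans (congr1 G (coordinates_kact v hA))).
  apply/esym/(etrans (congr1 _ (coordinates_gact _ _ _))).
  apply: (etrans (congr1 _ (gop_gcomb _ _ (ch v)))).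
  exact: lsubst_generators.
move=> xi v n e c xiT hv; apply: ci; apply: (etrans (coordinates_gact _ _ _)).
have sumE (z : 'I_n -> D) : coordinates (\sum_i z i *: e i) = \sum_i z i *: coordinates (e i).
  apply: (etrans (linear_fun_sum _ cl)); apply: eq_bigr => i _; exact: linear_funZ.
apply: (etrans (gop_so3 _ (ch v))); apply/esym/(etrans (sumE _))/esym.
apply: (infinitesimal_rotD (b := fun i => coordinates (e i)) (c := c) s2 _ xiT) => A hA.
have AO : A \in @O3 R by rewrite inE; apply/eqP.
apply: (etrans (esym (coordinates_kact v hA))).
apply: (etrans (congr1 coordinates (hv A AO))); exact: sumE.
Qed.

Lemma siota_lsubst lam (B : 'M[C]_3) P (x y : R30 R) : Defs.radius y = Defs.radius x ->
  (forall j, Defs.coord j x = \sum_i B i j * Defs.coord i y) ->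
  siota lam (lsubst B P) y = siota lam P x.
Proof.
move=> ryx exy; rewrite (siotaE ent lam (msize_lsubst B P)) /siota !smooth_sumE.
apply: eq_bigr => l _; rewrite pihomog_lsubst !swaveE; congr (_ * _).
  by rewrite /= /rfun ryx.
rewrite -[LHS]/(meval (fun i => Defs.coord i y) _) meval_lsubst.
by apply: meval_eq => j; rewrite exy.
Qed.

(** For real A the substitution is the geometric action: with B = (det A)^-1 A and y = B x, the
    radius is unchanged and the substituted polynomial at y is the original one at the transpose of
    B times y, which is x. *)
Lemma kact_real (A : 'M[R]_3) (Phi : regular F) (lam : C) (x y : R30 R) :
  A *m A^T = 1%:M -> val y = (\det A)^-1 *: (A *m val x) ->
  regular_fun (kact (map_mx (fun t : R => t%:C%C) A) Phi) lam y = regular_fun Phi lam x.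
Proof.
move=> hA eyx; pose A' : 'M[C]_3 := map_mx (real_complex R) A.
have hA' : A' *m A'^T = 1%:M by rewrite /A' map_trmx -map_mxM hA map_mx1.
have Q1 := mulmx1C (rotmx_orth hA).
have ey : val y = rotmx A *m val x by rewrite eyx (det_orthV hA) scalemxAl.
have ex : val x = (rotmx A)^T *m val y by rewrite ey mulmxA Q1 mul1mx.
have ryx : Defs.radius y = Defs.radius x.
  have sq (z : 'cV[R]_3) : \sum_i z i 0 ^+ 2 = (z^T *m z) 0 0.
    by rewrite mxE; apply: eq_bigr => i _; rewrite mxE expr2.
  by rewrite /Defs.radius /enorm !sq ey trmx_mul mulmxA -(mulmxA _ _ (rotmx A)) Q1 mulmx1.
rewrite (coordinatesP F_regular Phi).2 (coordinatesP F_regular (kact _ Phi)).2.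
rewrite (coordinates_kact Phi hA').
apply: (etrans (congr1 (fun P => siota lam P y) (lameval_lsubst lam (rotmx A') (coordinates Phi)))).
apply: siota_lsubst ryx _ => j.
have -> : rotmx A' = map_mx (real_complex R) (rotmx A).
  by rewrite /rotmx map_mxZ -det_map_mx.
rewrite /Defs.coord {1}ex mxE rmorph_sum; apply: eq_bigr => i _.
by rewrite !mxE rmorphM.
Qed.

End Family.

Unset Implicit Arguments.

Theorem theorem5p3p3 (R : realType) (gamma : R) (F : nat -> R[i] -> R -> R[i])
    (gamma_gt0 : 0 < gamma)
    (F_regular : forall (l : nat) (lam : R[i]),
       is_regular_solution gamma l lam (F l lam)) :
  [/\ forall (l : nat) (Y : S2 R -> R[i]) (lam : R[i]),
        spherical_harmonic l Y -> is_smooth (wave F l Y lam),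
      forall (X : galg gamma) (p : {poly R[i]}) (l : nat) (Y : S2 R -> R[i]),
        spherical_harmonic l Y -> galg_wave F X p l Y \in regular_pred F
    & exists (kact : 'M[R[i]]_3 -> regular F -> regular F)
             (gact : galg gamma -> regular F -> regular F),
      [/\ forall (X : galg gamma) (p : {poly R[i]}) (l : nat)
               (Y : S2 R -> R[i]) (Phi : regular F),
            spherical_harmonic l Y -> regular_fun Phi = poly_wave F p l Y ->
            regular_fun (gact X Phi) = galg_wave F X p l Y,
          forall (A : 'M[R]_3) (Phi : regular F) (lam : R[i]) (x y : R30 R),
            A *m A^T = 1%:M -> val y = (\det A)^-1 *: (A *m val x) ->
            regular_fun (kact (map_mx (fun t : R => t%:C%C) A) Phi) lam y =
            regular_fun Phi lam x
        & HC_family kact gact]].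
Proof.
split; first by move=> l Y lam; exact: (wave_smooth F_regular).
  by move=> X p l Y; exact: (galg_wave_regular F_regular).
exists (kact F_regular), (gact F_regular); split.
- exact: (gact_wave F_regular).
- exact: (kact_real F_regular).
exact: (regular_HC_family F_regular).
Qed.
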